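(* For every $m\geqslant 1$ write the differential operator $\theta_m$ (defined in the context) in normal form $$\theta_m=\theta^{(0)}_m\,\partial_u^{\,m}+\theta^{(1)}_m\,\partial_u^{\,m-1}+\dots+\theta^{(m-1)}_m\,\partial_u+\theta^{(m)}_m,$$ with each $\theta^{(k)}_m\in \mathrm{U}(\widehat{\mathfrak g}^{+})[[u]]$ placed to the left of the powers of $\partial_u$. Then the coefficients (elements of $\mathrm{U}(\widehat{\mathfrak g}^{+})$) of all the power series $\theta^{(k)}_m$, for all $m\geqslant 1$ and $0\leqslant k\leqslant m$, pairwise commute; i.e. they generate a commutative subalgebra of $\mathrm{U}(\widehat{\mathfrak g}^{+})$.
   Context: Let $E_{ij}$ ($1\le i,j\le N$) be the standard basis of $\mathfrak{gl}_N$ and $e_{ij}$ the matrix units of $\mathrm{End}\,\mathbb C^N$. Set $E_{ij}[r]=E_{ij}t^r$ in the loop algebra $\mathfrak{gl}_N[t,t^{-1}]$ (bracket $[E_{ij}[r],E_{kl}[s]]=\delta_{kj}E_{il}[r+s]-\delta_{il}E_{kj}[r+s]$). Let $\mathfrak b^+\subset\mathfrak{gl}_N$ be spanned by $E_{ij}$ with $i\le j$, and let $\widehat{\mathfrak g}^{+}=\mathfrak b^+\oplus t^{-1}\mathfrak{gl}_N[t^{-1}]$ (a Lie subalgebra of the loop algebra). Use $\mathrm{sgn}(0)=0$. Let $\mathcal L^+(u)=[\mathcal L^+_{ij}(u)]$ with $\mathcal L^+_{ij}(u)=\sum_{n\ge0}\mathcal L^+_{ij}[-n]u^n$, where $\mathcal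 L^+_{ij}[-n]=-2E_{ij}[-n]$ for $n\ge1$ and $\mathcal L^+_{ij}[0]=-(1+\mathrm{sgn}(j-i))E_{ij}$; regard $\mathcal L^+(u)=\sum_{i,j}e_{ij}\otimes \mathcal L^+_{ij}(u)$. Let $\mathrm U(\widehat{\mathfrak g}^{+})[[u,\partial_u]]$ denote differential operators in $u$ with coefficients in $\mathrm U(\widehat{\mathfrak g}^{+})[[u]]$ ($\partial_u$ commutes with $\mathrm U(\widehat{\mathfrak g}^{+})$ and $\partial_u g(u)=g(u)\partial_u+g'(u)$). Put $\mathcal L=2u\partial_u\cdot I-\mathcal L^+(u)\in\mathrm{End}\,\mathbb C^N\otimes \mathrm U(\widehat{\mathfrak g}^{+})[[u,\partial_u]]$. In the algebra $(\mathrm{End}\,\mathbb C^N)^{\otimes s}\otimes \mathrm U(\widehat{\mathfrak g}^{+})[[u,\partial_u]]$, $\mathcal L_a$ denotes $\mathcal L$ acting in the $a$-th tensor copy, and for $X\in \mathrm{End}\,\mathbb C^N\otimes\mathrm{End}\,\mathbb C^N$, $X_{ab}$ denotes $X$ acting in copies $a,b$ (identity elsewhere). Define $$T(y)=\sum_{i}e_{ii}\otimes e_{ii}+\frac{1}{1-y}\sum_{i<j}e_{ij}\otimes e_{ji}+\frac{1}{1+y}\sum_{i>j}e_{ij}\otimes e_{ji},$$ expanded as a power series in $y$. Define $\theta_m\in \mathrm U(\widehat{\mathfrak g}^{+})[[u,\partial_u]]$ by $$\sum_{m\ge1}\theta_m y^m=\sum_{s\ge1}y^s\,\mathrm{tr}_{1,\dots,s}\,T_{s-1\,s}(y)\cdots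 T_{12}(y)\,\mathcal L_1\cdots\mathcal L_s,$$ where the trace is over all $s$ copies of $\mathrm{End}\,\mathbb C^N$ (for $s=1$ the product of $T$'s is empty). *)

(* Defs.v *)
From HB Require Import structures.
From mathcomp Require Import all_boot all_order all_algebra.
Set Implicit Arguments. Unset Strict Implicit. Unset Printing Implicit Defensive.
Import Order.TTheory GRing.Theory Num.Theory.
Local Open Scope ring_scope.

Definition series (R : Type) := nat -> R.
Definition s0 {R : pzRingType} : series R := fun _ => 0.
Definition s1 {R : pzRingType} : series R := fun n => (n == 0%N)%:R.
Definition sadd {R : pzRingType} (f g : series R) : series R := fun n => f n + g n.
Definition smul {R : pzRingType} (f g : series R) : series R :=
  fun n => \sum_(i < n.+1) f i * g (n - i)%N.
Definition sder {R : pzRingType} (f : series R) : series R := fun n => f n.+1 *+ n.+1.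

(* the k-th entry of the list is the coefficient a_k(u) of d_u^k (placed on the left) *)
Definition dop (R : pzRingType) := seq (series R).
Definition dcoef {R : pzRingType} (P : dop R) (k : nat) : series R := nth s0 P k.
Definition dzero {R : pzRingType} : dop R := [::].
Definition done {R : pzRingType} : dop R := [:: s1].
Definition dadd {R : pzRingType} (P Q : dop R) : dop R :=
  mkseq (fun k => sadd (dcoef P k) (dcoef Q k)) (maxn (size P) (size Q)).
(* (a d^p)(b d^q) = sum_j C(p,j) a b^(j) d^(p+q-j) *)
Definition dmul {R : pzRingType} (P Q : dop R) : dop R :=
  mkseq (fun k => fun r =>
    \sum_(p < size P) \sum_(q < size Q) \sum_(j < p.+1)
      (if (p + q - j == k)%N
       then smul (dcoef P p) (iter j sder (dcoef Q q)) r *+ 'C(p, j)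
       else 0))
    (size P + size Q).
Definition dscal {R : pzRingType} (c : int) (P : dop R) : dop R :=
  map (fun f => fun n => c%:~R * f n) P.

(* ---------- tensor powers (End C^N)^{(x) s}: matrices indexed by multi-indices ---------- *)
Definition mi (N s : nat) := {ffun 'I_s -> 'I_N}.
Definition coord {N s : nat} (K : mi N s) (a : nat) (i : 'I_N) : bool :=
  [exists c : 'I_s, (val c == a) && (K c == i)].
Definition agree_off {N s : nat} (P : pred nat) (K K' : mi N s) : bool :=
  [forall c : 'I_s, ~~ P (val c) ==> (K c == K' c)].

(* scalar operators with coefficients in Z[[y]] *)
Definition smat (N s : nat) := mi N s -> mi N s -> series int.
Definition smatmul {N s : nat} (X Y : smat N s) : smat N s :=
  fun K K' => fun n => \sum_(L : mi N s) smul (X K L) (Y L K') n.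
Definition smatid {N s : nat} : smat N s := fun K K' => if K == K' then s1 else s0.
(* e_ij acting in copy a *)
Definition eop {N s : nat} (a : nat) (i j : 'I_N) : smat N s :=
  fun K K' => if [&& coord K a i, coord K' a j & agree_off (pred1 a) K K'] then s1 else s0.

Definition tcoef {N : nat} (i j : 'I_N) : series int :=
  if i == j then s1
  else if (i < j)%N then (fun _ => 1)           (* 1/(1-y) *)
  else (fun n => (-1) ^+ n).                    (* 1/(1+y) *)

Definition Top {N s : nat} (a b : nat) : smat N s :=
  fun K K' => fun n =>
    \sum_(i : 'I_N) \sum_(j : 'I_N)
      smul (tcoef i j) (smatmul (eop a i j) (eop b j i) K K') n.

(* T_{s-1 s} ... T_{12}   (copies numbered 0..s-1, so T_{a+1,a+2} = Top a a.+1) *)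
Definition Tprod (N s : nat) : smat N s :=
  \big[smatmul/smatid]_(a <- rev (iota 0 s.-1)) Top a a.+1.

(* E i j n stands for (the image of) E_ij[-n] *)
Definition Lplus {A : pzRingType} {N : nat} (E : 'I_N -> 'I_N -> nat -> A)
  (i j : 'I_N) : series A :=
  fun n => if n == 0%N then - ((1 + sgz (j%:Z - i%:Z))%:~R * E i j 0%N)
           else - (2%:R * E i j n).

(* L_ij = 2 u d_u delta_ij - L^+_ij(u) *)
Definition Lentry {A : pzRingType} {N : nat} (E : 'I_N -> 'I_N -> nat -> A)
  (i j : 'I_N) : dop A :=
  [:: (fun n => - Lplus E i j n);
      (fun n => if (i == j) && (n == 1%N) then 2%:R else 0)].

Definition dmat (A : pzRingType) (N s : nat) := mi N s -> mi N s -> dop A.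
Definition dmatmul {A : pzRingType} {N s : nat} (X Y : dmat A N s) : dmat A N s :=
  fun K K' => \big[dadd/dzero]_(L : mi N s) dmul (X K L) (Y L K').
Definition dmatid {A : pzRingType} {N s : nat} : dmat A N s :=
  fun K K' => if K == K' then done else dzero.

Definition Lop {A : pzRingType} {N s : nat} (E : 'I_N -> 'I_N -> nat -> A) (a : nat)
  : dmat A N s :=
  fun K K' => \big[dadd/dzero]_(i : 'I_N) \big[dadd/dzero]_(j : 'I_N)
    (if [&& coord K a i, coord K' a j & agree_off (pred1 a) K K']
     then Lentry E i j else dzero).

Definition Lprod {A : pzRingType} {N : nat} (E : 'I_N -> 'I_N -> nat -> A) (s : nat)
  : dmat A N s :=
  \big[dmatmul/dmatid]_(a < s) Lop E a.

(* theta_m = coefficient of y^m in sum_{s>=1} y^s tr_{1..s} T_{s-1 s}...T_{12} L_1...L_s,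
   i.e.  sum_{s=1}^m  [y^(m-s)] tr (Tprod s * Lprod s). *)
Definition theta {A : pzRingType} {N : nat} (E : 'I_N -> 'I_N -> nat -> A) (m : nat)
  : dop A :=
  \big[dadd/dzero]_(1 <= s < m.+1)
    \big[dadd/dzero]_(K : mi N s) \big[dadd/dzero]_(K' : mi N s)
      dscal (@Tprod N s K K' (m - s)%N) (@Lprod _ _ E s K' K).

(* coefficient of u^n in theta^{(k)}_m, the coefficient of d_u^(m-k) in theta_m *)
Definition theta_coef {A : pzRingType} {N : nat} (E : 'I_N -> 'I_N -> nat -> A)
  (m k n : nat) : A := dcoef (theta E m) (m - k) n.

(* E_ij[-n] lies in g^+ = b^+ (+) t^{-1} gl_N[t^{-1}] *)
Definition in_gplus {N : nat} (i j : 'I_N) (n : nat) : bool := (0 < n)%N || (i <= j)%N.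

(* E : basis of g^+ -> A respects the bracket
   [E_ij[-r], E_kl[-s]] = delta_kj E_il[-(r+s)] - delta_il E_kj[-(r+s)] *)
Definition lie_rep {A : pzRingType} {N : nat} (E : 'I_N -> 'I_N -> nat -> A) : Prop :=
  forall (i j k l : 'I_N) (r s : nat), in_gplus i j r -> in_gplus k l s ->
    E i j r * E k l s - E k l s * E i j r =
      (if k == j then E i l (r + s)%N else 0) - (if i == l then E k j (r + s)%N else 0).

(* Main.v *)
From HB Require Import structures.
From mathcomp Require Import all_boot all_order all_algebra.
From mathcomp Require Import zify ring.
From mathcomp Require Import boolp.
Require Import Defs.
Set Implicit Arguments. Unset Strict Implicit. Unset Printing Implicit Defensive.
Import Order.TTheory GRing.Theory Num.Theory.
Local Open Scope ring_scope.

(** Expanding [T(y)] as a geometric series in the signs [sgn(i - k)] resums the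
    generating function into [theta_m = sum_i ((L + S_i)^m)_ii], where
    [S_i = diag_k sgn(i - k)].  Operators on power series are truncated to matrices
    over the algebra, [u d_u] being diagonal and multiplication by a series Toeplitz.

    The factor 2 and the halved Cartan part of [L^+] are removed by acting on the
    algebra itself: adding to left multiplication by [E_aa] right multiplication by
    [- E_aa / 2 - a] is again a representation of [g^+].  It thus suffices to treat
    [th_m = sum_i ((l + J_i)^m)_ii], where [l = u d_u + sum E_ij[-n] u^n] and
    [J_i(a) = a - (1 if i < a else 0)].

    The coefficients of [th_m] are singular: at the critical level, bracketing with a
    lowering affine simple root vector [f] kills them modulo the left ideal of [f].  This
    is encoded by a representation of [g^+] by triangular 2 x 2 matrices whose corner
    entry is the bracket with [f], and it reduces to the symmetry in [a] and [c] of
    [sum_(p + q = m) (X'^p)_ck (X^q)_ak] with [X = l + x] and [X'] a diagonal shift of [X].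

    The commutator of two singular elements of weight zero is singular.  Its Cartan part
    cancels, so it is a combination of words beginning with a lower triangular letter
    and ending with an upper triangular one.  The leading symbol of such a singular
    combination is annihilated by all off-diagonal lowering derivations, which forces it
    to vanish; hence the commutator is zero by descent on the degree. *)

(** The algebra [A] is arbitrary, so leading terms cannot be compared inside it. Every intermediate
    identity is therefore stated for a fixed integer combination of words and for all
    representations of g^+ at once. This allows auxiliary representations to be substituted: the
    triangular one, which computes brackets with [f] although [f] itself lies outside g^+, and
    tensor products of evaluation modules, which separate words up to reordering and replace the
    Poincare-Birkhoff-Witt theorem.

    The end of the argument is the injectivity of a Harish-Chandra projection: a singular element of
    weight zero is determined by its Cartan part. Purely diagonal words must be excluded from the
    descent, since constants and the coefficients of [th_m] are singular without vanishing.

    Integer coefficients suffice up to the last step. The characteristic enters only through the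
    factor 1/2 of the twist and through the factorials that appear when coefficients are recovered
    from the action on monomials. *)

(* [ring] needs commutativity; [ncring] compares integer combinations of words. *)
Inductive nexp := NX of nat | N0 | N1 | NAdd of nexp & nexp | NOpp of nexp
  | NMul of nexp & nexp | NInt of int & nexp.

Section NCRing.
Variable R : pzRingType.
Implicit Type env : seq R.

Fixpoint neval env (e : nexp) : R :=
  match e with
  | NX n => nth 0 env n
  | N0 => 0
  | N1 => 1
  | NAdd a b => neval env a + neval env b
  | NOpp a => - neval env a
  | NMul a b => neval env a * neval env b
  | NInt z a => neval env a *~ z
  end.

Definition nmon env (t : int * seq nat) : R := (\prod_(i <- t.2) nth 0 env i) *~ t.1.
Definition nsum env (s : seq (int * seq nat)) : R := \sum_(t <- s) nmon env t.

Fixpoint nnf (e : nexp) : seq (int * seq nat) :=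
  match e with
  | NX n => [:: (1, [:: n])]
  | N0 => [::]
  | N1 => [:: (1, [::])]
  | NAdd a b => nnf a ++ nnf b
  | NOpp a => [seq (- t.1, t.2) | t <- nnf a]
  | NMul a b => [seq (t.1 * t'.1, t.2 ++ t'.2) | t <- nnf a, t' <- nnf b]
  | NInt z a => [seq (t.1 * z, t.2) | t <- nnf a]
  end.

Lemma nnfP env e : neval env e = nsum env (nnf e).
Proof.
elim: e => //= [n|||a IHa b IHb|a IHa|a IHa b IHb|z a IHa]; rewrite /nsum /nmon.
- by rewrite big_seq1 /= big_seq1.
- by rewrite big_nil.
- by rewrite big_seq1 /= big_nil.
- by rewrite big_cat /= IHa IHb.
- by rewrite big_map /= IHa -sumrN; apply: eq_bigr => t _; rewrite mulrNz.
- rewrite IHa IHb big_allpairs_dep mulr_suml; apply: eq_bigr => t _.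
  rewrite mulr_sumr; apply: eq_bigr => t' _.
  by rewrite /= big_cat /= /nmon mulrzAr mulrzAl -mulrzA mulrC.
- by rewrite big_map /= IHa /nsum mulrz_suml; apply: eq_bigr => t _; rewrite mulrzA.
Qed.

Fixpoint nins (t : int * seq nat) (s : seq (int * seq nat)) :=
  if s is t' :: s' then
    if t.2 == t'.2 then (t.1 + t'.1, t'.2) :: s' else t' :: nins t s'
  else [:: t].

Lemma ninsP env t s : nsum env (nins t s) = nmon env t + nsum env s.
Proof.
rewrite /nsum; elim: s => [|t' s IH] /=; first by rewrite big_seq1 big_nil addr0.
case: eqP => [e|_]; rewrite !big_cons; last by rewrite IH addrCA.
by rewrite addrA; congr (_ + _); rewrite /nmon /= e mulrzDr.
Qed.

Definition nchk e := all (fun t => t.1 == 0) (foldr nins [::] (nnf e)).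

Lemma nchkP env a b : nchk (NAdd a (NOpp b)) -> neval env a = neval env b.
Proof.
move=> h; apply/eqP; rewrite -subr_eq0; apply/eqP.
rewrite -[LHS]/(neval env (NAdd a (NOpp b))) nnfP.
have -> : nsum env (nnf (NAdd a (NOpp b))) =
          nsum env (foldr nins [::] (nnf (NAdd a (NOpp b)))).
  elim: (nnf _) => [|t s IH] //=; rewrite ninsP -IH.
  by rewrite /nsum big_cons.
rewrite /nsum big_seq big1 // => t /(allP h) /eqP.
by rewrite /nmon => ->; rewrite mulr0z.
Qed.
End NCRing.

Ltac nsame x y :=
  lazymatch x with
  | y => constr:(true)
  | _ => lazymatch x with
    | bigop _ _ _ => lazymatch y with
      | bigop _ _ _ => constr:(ltac:(first [unify x y; exact true | exact false]))
      | _ => constr:(false) end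
    | (_ *~ _)%R => lazymatch y with
      | (_ *~ _)%R => constr:(ltac:(first [unify x y; exact true | exact false]))
      | _ => constr:(false) end
    | (_ *+ _)%R => lazymatch y with
      | (_ *+ _)%R => constr:(ltac:(first [unify x y; exact true | exact false]))
      | _ => constr:(false) end
    | _ => constr:(false)
    end
  end.
Ltac nidx x env :=
  lazymatch env with
  | ?y :: ?t =>
    let b := nsame x y in
    lazymatch b with
    | true => constr:(0%N)
    | false => let n := nidx x t in constr:(S n)
    end
  end.
Ltac nmem x env :=
  lazymatch env with
  | [::] => constr:(false)
  | ?y :: ?t =>
    let b := nsame x y in
    lazymatch b with
    | true => constr:(true)
    | false => nmem x t
    end
  end.
Ltac nenv e env :=
  lazymatch e with
  | (?a + ?b)%R => let env := nenv a env in nenv b env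
  | (?a * ?b)%R => let env := nenv a env in nenv b env
  | (- ?a)%R => nenv a env
  | (?a *+ S _)%R => nenv a env
  | 0%R => env
  | 1%R => env
  | _ => let b := nmem e env in
         lazymatch b with true => env | false => constr:(e :: env) end
  end.
Ltac nreify e env :=
  lazymatch e with
  | (?a + ?b)%R => let a := nreify a env in let b := nreify b env in constr:(NAdd a b)
  | (?a * ?b)%R => let a := nreify a env in let b := nreify b env in constr:(NMul a b)
  | (- ?a)%R => let a := nreify a env in constr:(NOpp a)
  | (?a *+ S ?n)%R => let a := nreify a env in constr:(NInt (Posz (S n)) a)
  | 0%R => constr:(N0)
  | 1%R => constr:(N1)
  | _ => let n := nidx e env in constr:(NX n)
  end.
Ltac ncring :=
  lazymatch goal with
  | |- @eq ?T ?a ?b =>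
    let env := nenv a (@nil T) in
    let env := nenv b env in
    let ra := nreify a env in
    let rb := nreify b env in
    refine (@nchkP _ env ra rb _); vm_compute; reflexivity
  end.

Lemma sum_delta (V : nmodType) (I : finType) (a : I) (F : I -> V) :
  \sum_b F b *+ (a == b) = F a.
Proof.
rewrite (bigD1 a) //= eqxx mulr1n big1 ?addr0 // => b /negPf.
by rewrite eq_sym => ->; rewrite mulr0n.
Qed.

(** * Symmetry of convolutions of powers of [l + x] *)

Section ManinSymmetry.
Variables (R : pzRingType) (N : nat) (l ep q : 'I_N -> 'I_N -> R) (D : R).
Hypothesis lE : forall i j, l i j = ep i j + D *+ (i == j).
Hypothesis commE : forall a b c d, l a b * l c d - l c d * l a b =
  q c d *+ (a == b) - q a b *+ (c == d)
  + (q a d + ep a d *~ (1 - (b < a)%N%:Z - (d < c)%N%:Z)) *+ (b == c)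
  - (q c b + ep c b *~ (1 - (b < a)%N%:Z - (d < c)%N%:Z)) *+ (a == d).
Implicit Types (xi : 'I_N -> 'I_N -> R) (s : 'I_N -> int).

(* Acting by [l] on the first and on the second index, these satisfy
   [xconv m.+2 = (actr + actl) (xconv m.+1) - actl (actr (xconv m))],
   and [actl \o actr] and [actr + actl] preserve symmetry. *)
Definition actl s xi a c :=
  \sum_(b < N) l a b * xi b c + xi a c *~ (s a - (a < c)%N%:Z - (2 * (a == c))%N%:Z).
Definition actr s xi a c :=
  \sum_(b < N) l c b * xi a b + xi a c *~ (s c - (c <= a)%N%:Z).

(** Contracting [commE] with a symmetric tensor cancels the four [q] terms in pairs, because the
    indices of [xi] may be exchanged; only the weighted [ep] terms survive. *)
Lemma antisym_prod xi a c : (forall b d, xi b d = xi d b) ->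
  \sum_(b < N) \sum_(d < N) l a b * (l c d * xi b d) - \sum_(b < N) \sum_(d < N) l c b * (l a d * xi b d) =
  \sum_(d < N) (ep a d * xi c d) *~ (1 - (c < a)%N%:Z - (d < c)%N%:Z)
  - \sum_(d < N) (ep c d * xi a d) *~ (1 - (d < a)%N%:Z - (a < c)%N%:Z).
Proof.
move=> sxi.
have -> : \sum_(b < N) \sum_(d < N) l a b * (l c d * xi b d) - \sum_(b < N) \sum_(d < N) l c b * (l a d * xi b d)
  = \sum_(b < N) \sum_(d < N) (l a b * l c d - l c d * l a b) * xi b d.
  rewrite [X in _ - X]exchange_big /= -sumrB; apply: eq_bigr => b _.
  rewrite -sumrB; apply: eq_bigr => d _.
  by rewrite [xi d b]sxi !mulrA mulrBl.
pose w (b d : 'I_N) : int := 1 - (b < a)%N%:Z - (d < c)%N%:Z.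
have -> : \sum_(b < N) \sum_(d < N) (l a b * l c d - l c d * l a b) * xi b d =
  \sum_(b < N) \sum_(d < N) (q c d *+ (a == b)) * xi b d - \sum_(b < N) \sum_(d < N) (q a b *+ (c == d)) * xi b d
  + \sum_(b < N) \sum_(d < N) ((q a d + ep a d *~ w b d) *+ (b == c)) * xi b d
  - \sum_(b < N) \sum_(d < N) ((q c b + ep c b *~ w b d) *+ (a == d)) * xi b d.
  rewrite -sumrB -big_split -sumrB /=; apply: eq_bigr => b _.
  rewrite -sumrB -big_split -sumrB /=; apply: eq_bigr => d _.
  by rewrite commE !(mulrDl, mulNr).
have S1 F : \sum_(b < N) \sum_(d < N) (F d *+ (a == b)) * xi b d = \sum_(d < N) F d * xi a d.
  under eq_bigr => b _ do (under eq_bigr => d _ do rewrite mulrnAl; rewrite sumrMnl).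
  by rewrite sum_delta.
have S2 F : \sum_(b < N) \sum_(d < N) (F b *+ (c == d)) * xi b d = \sum_(b < N) F b * xi c b.
  under eq_bigr => b _ do (under eq_bigr => d _ do rewrite mulrnAl; rewrite sum_delta sxi).
  by [].
have S3 (F : 'I_N -> 'I_N -> R) : \sum_(b < N) \sum_(d < N) (F b d *+ (b == c)) * xi b d = \sum_(d < N) F c d * xi c d.
  under eq_bigr => b _ do (under eq_bigr => d _ do rewrite eq_sym mulrnAl; rewrite sumrMnl).
  by rewrite sum_delta.
have S4 (F : 'I_N -> 'I_N -> R) : \sum_(b < N) \sum_(d < N) (F b d *+ (a == d)) * xi b d = \sum_(b < N) F b a * xi a b.
  under eq_bigr => b _ do (under eq_bigr => d _ do rewrite mulrnAl; rewrite sum_delta sxi).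
  by [].
rewrite S1 S2 (S3 (fun b d => q a d + ep a d *~ w b d)) (S4 (fun b d => q c b + ep c b *~ w b d)).
have Sz (F G H : 'I_N -> R) (z : 'I_N -> int) :
  \sum_(d < N) (F d + G d *~ z d) * H d = \sum_(d < N) F d * H d + \sum_(d < N) (G d * H d) *~ z d.
  by rewrite -big_split; apply: eq_bigr => d _; rewrite mulrDl mulrzAl.
rewrite !Sz /w; ncring.
Qed.

(** The integer corrections in [actl] and [actr] are made to cancel the [ep] terms left by
    [antisym_prod]. They are not symmetric in [a] and [c], so the case [a < c] is computed and the
    opposite one follows by exchange. *)
Lemma actl_actr_sym s xi : (forall b d, xi b d = xi d b) ->
  forall a c, actl s (actr s xi) a c = actl s (actr s xi) c a.
Proof.
move=> sxi.
have main (a c : 'I_N) : (a < c)%N -> actl s (actr s xi) a c = actl s (actr s xi) c a.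
  move=> ac; apply/eqP; rewrite -subr_eq0; apply/eqP.
  have ca : (c < a)%N = false by lia.
  have neq : (a == c) = false by apply/eqP => e; rewrite e ltnn in ac.
  have -> : (actl s (actr s xi) a c - actl s (actr s xi) c a) =
   (\sum_(b < N) \sum_(d < N) l a b * (l c d * xi b d) - \sum_(b < N) \sum_(d < N) l c b * (l a d * xi b d))
   + \sum_(d < N) (l a d * xi c d) *~ (- (c <= d)%N%:Z)
   - \sum_(d < N) (l c d * xi a d) *~ (1 - (a <= d)%N%:Z).
    have act2 a' c' : \sum_(b < N) l a' b * actr s xi b c' =
        \sum_(b < N) \sum_(d < N) l a' b * (l c' d * xi b d) + (\sum_(b < N) l a' b * xi c' b) *~ s c'
        + \sum_(b < N) (l a' b * xi c' b) *~ (- (c' <= b)%N%:Z).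
      rewrite mulrz_suml -!big_split; apply: eq_bigr => b _ /=.
      by rewrite /actr mulrDr mulr_sumr mulrzAr [xi b c']sxi mulrzBr mulrNz addrA.
    rewrite /actl !act2 [c == a]eq_sym neq ac ca /actr (leqNgt c a) ac /=.
    rewrite ltnW // !(subr0, mulrzBr, mulrzDr, mulrzBl) [xi c a]sxi.
    have -> : \sum_(d < N) l c d * xi a d *~ (1 - (a <= d)%N%:Z) =
      \sum_(d < N) l c d * xi a d + \sum_(d < N) l c d * xi a d *~ (- (a <= d)%N%:Z).
      by rewrite -big_split; apply: eq_bigr => d _; rewrite /= mulrzBr mulrNz.
    rewrite !(mulrzBl, mulrzDl) mulr1z [_ *~ true]mulr1z [(xi a c *~ s c) *~ s a]mulrzAC.
    ncring.
  rewrite antisym_prod // ac ca.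
  (* The part [D] of [l] could contribute only at [d = a], where the coefficient vanishes because
     [a < c]; in [E2] the same happens at [d = c]. *)
  have E1 : \sum_(d < N) (l a d * xi c d) *~ (- (c <= d)%N%:Z) =
            - \sum_(d < N) (ep a d * xi c d) *~ (1 - false%:Z - (d < c)%N%:Z).
    rewrite -sumrN; apply: eq_bigr => d _; rewrite lE mulrDl mulrzDl -mulrNz.
    case: (a =P d) => [<-|_]; last by rewrite mulr0n mul0r mul0rz addr0; congr (_ *~ _); lia.
    by rewrite leqNgt ac /= mulr0z addr0.
  have E2 : \sum_(d < N) (l c d * xi a d) *~ (1 - (a <= d)%N%:Z) =
            - \sum_(d < N) (ep c d * xi a d) *~ (1 - (d < a)%N%:Z - true%:Z).
    rewrite -sumrN; apply: eq_bigr => d _; rewrite lE mulrDl mulrzDl -mulrNz.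
    case: (c =P d) => [<-|_]; last by rewrite mulr0n mul0r mul0rz addr0; congr (_ *~ _); lia.
    by rewrite (ltnW ac) ca subrr mulr0z addr0.
  rewrite E1 E2; ncring.
move=> a c; case: (ltngtP a c) => [h|h|/val_inj -> //]; first exact: main.
by symmetry; apply: main.
Qed.

Definition xmx (x : 'I_N -> int) : 'M[R]_N :=
  \matrix_(i, j) (l i j + (1 *~ x i) *+ (i == j)).

Lemma mul_xmx x (V : 'M[R]_N) i k :
  (xmx x * V) i k = \sum_(b < N) l i b * V b k + V i k *~ x i.
Proof.
rewrite mxE (eq_bigr (fun b => l i b * V b k + (V b k *~ x i) *+ (i == b))).
  by rewrite big_split sum_delta.
by move=> b _; rewrite mxE mulrDl mulrnAl mulrzAl mul1r.
Qed.

Variables (x : 'I_N -> int) (k : 'I_N).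

(** For [a = k] this is [x] raised by one at [k]; for [a = k'] and [x = jshift k] it is, once
    [u ^ eps] is moved across, the shift by the character of [f]. A single formula makes the two
    convolutions of [thop_singular] transposes of each other. *)
Definition xshift (a c : 'I_N) : int :=
  x c + (c == k)%:Z + (c <= k)%N%:Z - (c <= a)%N%:Z.

Definition xconv m (a c : 'I_N) : R :=
  \sum_(p < m.+1) (xmx (xshift a) ^+ p) c k * (xmx x ^+ (m - p)) a k.

(** Two requirements fix [s]: [s c - (c <= a)] must be [xshift a c] for [xconvS], and
    [s a - (a < k) - 2 (a == k)] must be [x a] for [actl_xc]. *)
Let s b := x b + (b < k)%N%:Z + (2 * (b == k))%N%:Z.

Let xc m a c := (xmx x ^+ m) a k *+ (c == k).

Lemma xconvS m a c : xconv m.+1 a c = actr s (xconv m) a c + xc m.+1 a c.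
Proof.
rewrite /xconv big_ord_recl expr0 subn0 addrC; congr (_ + _); last first.
  by rewrite !mxE /xc; case: (c == k); rewrite ?mul1r ?mul0r.
rewrite /actr.
under [in RHS]eq_bigr => b _ do rewrite mulr_sumr.
rewrite exchange_big mulrz_suml -big_split /=; apply: eq_bigr => p _.
rewrite /bump /= add1n subSS exprS mul_xmx mulrDl mulr_suml; congr (_ + _).
  by apply: eq_bigr => b _; rewrite mulrA.
rewrite mulrzAl; congr (_ *~ _); rewrite /xshift /s leq_eqVlt -val_eqE /=.
by case: (ltngtP c k) => /=; lia.
Qed.

Lemma actl_xc m a c : actl s (xc m) a c = xc m.+1 a c.
Proof.
rewrite /actl /xc; case: (c =P k) => [->|_]; last first.
  by rewrite mulr0n mul0rz addr0 big1 // => b _; rewrite mulr0n mulr0.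
rewrite !mulr1n exprS mul_xmx; congr (_ + _ *~ _).
by rewrite /s; lia.
Qed.

(** The inhomogeneous term [xc] of [xconvS] is reproduced by [actl], so it can be eliminated between
    two consecutive degrees. *)
Lemma xconvSS m a c : xconv m.+2 a c =
  actr s (xconv m.+1) a c + actl s (xconv m.+1) a c - actl s (actr s (xconv m)) a c.
Proof.
rewrite xconvS -[RHS]addrA; apply: (congr1 (+%R _)).
rewrite -actl_xc /actl (eq_bigr (fun b => l a b * xconv m.+1 b c - l a b * actr s (xconv m) b c)).
  by rewrite sumrB xconvS mulrzDl; ncring.
by move=> b _; rewrite xconvS mulrDr; ncring.
Qed.

Lemma actlr_sym xi a c : (forall b d, xi b d = xi d b) ->
  actr s xi a c + actl s xi a c = actr s xi c a + actl s xi c a.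
Proof.
move=> sxi; rewrite /actl /actr [xi c a]sxi.
rewrite (eq_bigr (fun b => l c b * xi b a)); last by move=> b _; rewrite sxi.
rewrite [in RHS](eq_bigr (fun b => l a b * xi b c)); last by move=> b _; rewrite sxi.
set u := bigop _ _ _; set v := bigop _ _ _; set z := xi a c.
have E : z *~ (s c - (c <= a)%N%:Z) + z *~ (s a - (a < c)%N%:Z - (2 * (a == c))%N%:Z)
       = z *~ (s a - (a <= c)%N%:Z) + z *~ (s c - (c < a)%N%:Z - (2 * (c == a))%N%:Z).
  rewrite -!mulrzDr; congr (_ *~ _); rewrite (eq_sym c a).
  by case: (ltngtP c a) => /=; lia.
transitivity (u + v + (z *~ (s c - (c <= a)%N%:Z) + z *~ (s a - (a < c)%N%:Z - (2 * (a == c))%N%:Z))).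
  by ncring.
by rewrite E; ncring.
Qed.

Theorem xconv_sym m a c : xconv m a c = xconv m c a.
Proof.
have S0 b d : xconv 0 b d = xconv 0 d b.
  rewrite /xconv !big_ord1 !expr0 !mxE.
  by case: (b == k); case: (d == k); rewrite ?mulr1 ?mulr0 ?mul0r.
have S1 b d : xconv 1 b d = xconv 1 d b.
  have E b' d' : xconv 1 b' d' = actr s (xconv 0) b' d' + actl s (xconv 0) b' d'.
    rewrite xconvS -actl_xc /actl; congr (_ + (_ + _ *~ _)); last first.
      by rewrite /xconv big_ord1 !expr0 !mxE /xc expr0 mxE; case: (b' == k); case: (d' == k); rewrite ?mulr1 ?mulr0 ?mul0r ?mulr0n.
    apply: eq_bigr => t _; congr (_ * _).
    by rewrite /xconv big_ord1 !expr0 !mxE /xc expr0 mxE; case: (t == k); case: (d' == k); rewrite ?mulr1 ?mulr0 ?mul0r ?mulr0n.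
  by rewrite !E; apply: actlr_sym.
suff: (forall b d, xconv m b d = xconv m d b) /\ (forall b d, xconv m.+1 b d = xconv m.+1 d b).
  by case.
elim: m => [|m [IH0 IH1]]; first by split.
split=> // b d; rewrite !xconvSS (actlr_sym _ _ IH1).
by rewrite (actl_actr_sym _ IH0).
Qed.

End ManinSymmetry.

(** * Operators on truncated power series *)

Section Toeplitz.
Variables (A : pzRingType) (P : nat).
Implicit Types f g : nat -> A.

(* The entry (q, p) is the coefficient of [u^q] in the image of [u^p], modulo [u^P]. *)
Definition toep f : 'M[A]_P := \matrix_(q, p) (if (p <= q)%N then f (q - p)%N else 0).
Definition udu : 'M[A]_P := \matrix_(q, p) (p%:R *+ (q == p)).

Lemma toepM f g :
  toep f * toep g = toep (fun n => \sum_(r < n.+1) f (n - r)%N * g r).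
Proof.
apply/matrixP => q p; rewrite !mxE.
under eq_bigr => j _ do rewrite !mxE.
rewrite -(big_mkord xpredT (fun j => (if (j <= q)%N then f (q - j)%N else 0) *
   (if (p <= j)%N then g (j - p)%N else 0))).
case: (leqP p q) => [pq|qp]; last first.
  rewrite big_nat big1 // => j _; case: ifP => h1; case: ifP => h2; rewrite ?mul0r ?mulr0 //; lia.
rewrite (big_cat_nat (n := p)) ?leq0n //=; last by apply: ltnW; exact: ltn_ord.
rewrite big_nat big1 ?add0r; last first.
  by move=> j /andP[_ h]; rewrite [(p <= j)%N]leqNgt h mulr0.
rewrite (big_cat_nat (n := q.+1)) //=; last by rewrite ltnW.
rewrite [X in _ + X]big_nat [X in _ + X]big1 ?addr0; last first.
  by move=> j /andP[h _]; rewrite leqNgt h mul0r.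
rewrite -{1}(add0n (p : nat)) big_addn subSn // big_mkord.
apply: eq_bigr => r _; rewrite leq_addl addnK.
have h : (r + p <= q)%N by have := ltn_ord r; lia.
by rewrite h addnC subnDA.
Qed.

Lemma udu_toep f : udu * toep f - toep f * udu = toep (fun n => f n *+ n).
Proof.
apply/matrixP => q p; rewrite !mxE.
rewrite (eq_bigr (fun j : 'I_P => ((j%:R : A) * toep f j p) *+ (q == j))); last first.
  by move=> j _; rewrite !mxE mulrnAl.
rewrite sum_delta (eq_bigr (fun j : 'I_P => (toep f q j * (p%:R : A)) *+ (p == j))); last first.
  by move=> j _; rewrite !mxE mulrnAr eq_sym.
rewrite sum_delta mxE; case: leqP => h; last by rewrite mulr0 mul0r subr0.
by rewrite mulr_natl mulr_natr -mulrnBr // leq_subr.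
Qed.

End Toeplitz.

Section LieOps.
Variables (A : pzRingType) (N P : nat) (E : 'I_N -> 'I_N -> nat -> A).

(** [lie_rep] says nothing about E_ij[0] with i > j, so these values are cut off before series are
    formed. *)
Definition emask i j n : A := if in_gplus i j n then E i j n else 0.
Definition lop i j : 'M[A]_P := toep P (emask i j) + udu A P *+ (i == j).

Hypothesis hE : lie_rep E.

Lemma emask_comm a b c d r s : in_gplus a b r -> in_gplus c d s ->
  emask a b r * emask c d s - emask c d s * emask a b r =
  emask a d (r + s)%N *+ (b == c) - emask c b (r + s)%N *+ (a == d).
Proof.
move=> g1 g2; rewrite /emask g1 g2 hE //; congr (_ - _); rewrite mulrb.
  rewrite eq_sym; case: eqP => // e; subst c; case: ifP => //.
  by move: g1 g2; rewrite /in_gplus; lia.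
case: eqP => // e; subst d; case: ifP => //.
by move: g1 g2; rewrite /in_gplus; lia.
Qed.

(** The coefficient of u^n is one bracket times the number of pairs of admissible modes with sum n.
    The growth of this number with n gives the derivative terms; its constant part records which
    letters lack a zero mode. *)
Lemma toep_comm a b c d :
  toep P (emask a b) * toep P (emask c d) - toep P (emask c d) * toep P (emask a b) =
  (toep P (fun n => emask a d n *+ n) + toep P (emask a d) *~ (1 - (b < a)%N%:Z - (d < c)%N%:Z))
    *+ (b == c)
  - (toep P (fun n => emask c b n *+ n) + toep P (emask c b) *~ (1 - (b < a)%N%:Z - (d < c)%N%:Z))
    *+ (a == d).
Proof.
set w := (1 - _ - _).
have hn n : \sum_(r < n.+1) emask a b (n - r)%N * emask c d r
   - \sum_(r < n.+1) emask c d (n - r)%N * emask a b r =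
  (emask a d n *+ (b == c) - emask c b n *+ (a == d)) *~ (w + n%:Z).
  rewrite [X in _ - X](reindex_inj rev_ord_inj) /= -sumrB.
  set X := (emask a d n *+ _ - _).
  rewrite (eq_bigr (fun r : 'I_n.+1 => X *+ (in_gplus a b (n - r) && in_gplus c d r))); last first.
    move=> r _; have rn : (r <= n)%N by rewrite -ltnS.
    rewrite subSS subKn //.
    case: (boolP (in_gplus a b (n - r))) => [g1|/negPf g1]; last by rewrite /emask g1 mul0r mulr0 subrr.
    case: (boolP (in_gplus c d r)) => [g2|/negPf g2]; last by rewrite /emask g2 mul0r mulr0 subrr.
    by rewrite emask_comm // subnK.
  rewrite sumrMnr pmulrn.
  (* The formula [w + k] is wrong only for [k = 0] with both letters lower triangular, where it
     gives -1 instead of 0; the bracket [X] vanishes in that case. *)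
  have H k : (\sum_(r < k.+1) (in_gplus a b (k - r) && in_gplus c d r))%N%:Z =
     w + k%:Z + [&& (b < a)%N, (d < c)%N & k == 0%N]%:Z.
    rewrite /w /in_gplus; case: k => [|k].
      by rewrite big_ord1 subnn /= (leqNgt a b) (leqNgt c d); case: (b < a)%N; case: (d < c)%N.
    rewrite big_ord_recr /= subnn ltnn /= big_ord_recl subn0 /= andbF.
    rewrite (eq_bigr (fun=> 1%N)); last first.
      move=> r _; rewrite /bump /= add1n subSS.
      by have -> : (0 < k - r)%N by rewrite subn_gt0.
    rewrite sum1_card card_ord andbT (leqNgt a b) (leqNgt c d).
    by case: (b < a)%N; case: (d < c)%N => /=; lia.
  rewrite H mulrzDr; case: and3P => /= [[ba dc /eqP n0]|_]; last by rewrite mulr0z addr0.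
  suff -> : X = 0 by rewrite !mul0rz addr0.
  rewrite /X /emask /in_gplus n0 /=.
  case: (b =P c) => [bc|_]; case: (a =P d) => [ad|_] /=; rewrite ?mulr1n ?subr0 ?sub0r //.
  - by subst; lia.
  - by case: leqP => //; subst; lia.
  - by case: leqP => //; subst; rewrite ?oppr0 //; lia.
rewrite !toepM; apply/matrixP => q p; rewrite !mxE.
have E1 (X Y : 'M[A]_P) (z : int) (t : bool) : ((X + Y *~ z) *+ t) q p = (X q p + Y q p *~ z) *+ t.
  have EZ : (Y *~ z) q p = Y q p *~ z by case: z => n; rewrite ?NegzE ?mulrNz -!pmulrn ?mxE mulmxnE.
  by case: t; rewrite ?mulr1n ?mulr0n mxE // EZ.
rewrite !E1 !mxE; case: leqP => _; last by rewrite !mul0rz !addr0 !mul0rn subrr.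
rewrite hn; have -> z : z *~ (w + (q - p)%N%:Z) = z *+ (q - p) + z *~ w by rewrite addrC mulrzDr.
case: (b == c); case: (a == d); rewrite ?mulr1n ?mulr0n ?mul0rz ?mul0rn ?addr0 ?subr0 ?sub0r ?mulNrz ?mulNrn ?mulrzBl ?mulrnBl; try ncring.
by rewrite mul0rn mul0rz addr0.
Qed.

Lemma lop_comm a b c d : lop a b * lop c d - lop c d * lop a b =
  toep P (fun n => emask c d n *+ n) *+ (a == b) - toep P (fun n => emask a b n *+ n) *+ (c == d)
  + (toep P (fun n => emask a d n *+ n) + toep P (emask a d) *~ (1 - (b < a)%N%:Z - (d < c)%N%:Z))
    *+ (b == c)
  - (toep P (fun n => emask c b n *+ n) + toep P (emask c b) *~ (1 - (b < a)%N%:Z - (d < c)%N%:Z))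
    *+ (a == d).
Proof.
rewrite -[RHS]addrA -toep_comm -!udu_toep /lop.
set x := toep _ _; set y := toep _ _; set u := udu _ _.
case: (a == b); case: (c == d); rewrite ?mulr1n ?mulr0n; ncring.
Qed.

End LieOps.

(** * Bracket with a simple root vector *)

Definition mx22 (A : Type) (a b c d : A) : 'M[A]_2 :=
  \matrix_(i, j) if i == 0 then (if j == 0 then a else b) else (if j == 0 then c else d).

Lemma mx22P (A : Type) (X Y : 'M[A]_2) :
  X 0 0 = Y 0 0 -> X 0 1 = Y 0 1 -> X 1 0 = Y 1 0 -> X 1 1 = Y 1 1 -> X = Y.
Proof.
move=> h00 h01 h10 h11; apply/matrixP => i j.
have o2 (x : 'I_2) : x = 0 \/ x = 1.
  by case: x => [[|[|//]] h]; [left|right]; apply: val_inj.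
by case: (o2 i) => ->; case: (o2 j) => ->.
Qed.

Lemma mulmx22E (A : pzRingType) (X Y : 'M[A]_2) i j :
  (X * Y) i j = X i 0 * Y 0 j + X i 1 * Y 1 j.
Proof.
by rewrite mxE big_ord_recl big_ord1; congr (_ + _ * _); congr fun_of_matrix; apply: val_inj.
Qed.

(* The root vector is [E_(k' k)[eps]] in the loop algebra; [eps] selects the affine root. *)
Definition simple_root (N : nat) (k k' : 'I_N) (eps : bool) : bool :=
  if eps then [&& (0 < k)%N, k.+1 == N & k' == 0%N :> nat] else k' == k.+1 :> nat.

Section SimpleRoot.
Variables (A : pzRingType) (N : nat) (E : 'I_N -> 'I_N -> nat -> A).
Variables (k k' : 'I_N) (eps : bool).
Hypothesis kk' : simple_root k k' eps.

(* [[f, x] = froot_der x + froot_char x * f] for [x] in [g^+]; the constant [N] in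
   [froot_der] is the central term at the critical level. *)
Definition froot_char (i j : 'I_N) (n : nat) : int :=
  if (n == 0%N) && (i == j) then (i == k)%:Z - (i == k')%:Z else 0.

Definition froot_der (i j : 'I_N) (n : nat) : A :=
  (if (i == k) && (eps <= n)%N then emask E k' j (n - eps) else 0)
  - (if (j == k') && (eps <= n)%N then emask E i k (n - eps) else 0)
  - (if [&& eps, i == k, j == k' & n == 1%N] then N%:R else 0).

(** Formally f x = (x + froot_char x) f + froot_der x, so carrying f to the right through a product
    amounts to multiplying these matrices. If the corner entry of a word w is zero, then f w lies in
    the left ideal of f. *)
Definition froot_ext (i j : 'I_N) (n : nat) : 'M[A]_2 :=
  mx22 (E i j n + (froot_char i j n)%:~R) (froot_der i j n) 0 (E i j n).

Lemma neq_kk' : (k == k') = false.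
Proof. by apply/eqP => e; move: kk'; rewrite e /simple_root; case: eps => /=; lia. Qed.

(** These are the Cartan elements whose bracket with f is a nonzero multiple of f and so leaves g^+;
    [froot_char] keeps track of the multiple. *)
Definition special (i j : 'I_N) n := [&& n == 0%N, i == j & (i == k) || (i == k')].

Lemma froot_der_special i j n : special i j n -> froot_der i j n = 0.
Proof.
case/and3P=> /eqP -> /eqP <-; rewrite /froot_der /emask /in_gplus !andbF subr0.
move: kk' neq_kk'; rewrite /simple_root; case: eps; rewrite ?andbF ?andbT ?subrr //=.
move=> h hk /orP[] /eqP ->; rewrite !eqxx ?hk 1?eq_sym ?hk ?subr0 ?sub0r.
  by rewrite leqNgt (eqP h) ltnSn.
by rewrite leqNgt (eqP h) ltnSn oppr0.
Qed.

Lemma special_row i j n : in_gplus i j n -> ~~ special i j n -> i = k ->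
  (eps <= n)%N && in_gplus k' j (n - eps).
Proof.
move=> g s ik; subst i; move: kk' g s; rewrite /simple_root /in_gplus /special eqxx andbT -val_eqE /=.
by case: eps => /=; case: eqP; have := ltn_ord j; lia.
Qed.

Lemma special_col i j n : in_gplus i j n -> ~~ special i j n -> j = k' ->
  (eps <= n)%N && in_gplus i k (n - eps).
Proof.
move=> g s jk; subst j; move: kk' g s; rewrite /simple_root /in_gplus /special -!val_eqE /=.
by case: eps => /=; case: eqP; case: eqP; have := ltn_ord i; lia.
Qed.

Lemma froot_derE i j n : in_gplus i j n -> ~~ special i j n ->
  froot_der i j n = E k' j (n - eps) *+ (i == k) - E i k (n - eps) *+ (j == k')
    - N%:R *+ [&& eps, i == k, j == k' & n == 1%N].
Proof.
move=> g s; rewrite /froot_der; congr (_ - _ - _); last by rewrite mulrb.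
  by case: eqP => //= /(special_row g s) /andP[-> g']; rewrite /emask g'.
by case: eqP => //= /(special_col g s) /andP[-> g']; rewrite /emask g'.
Qed.

Hypothesis hE : lie_rep E.

Lemma hEn a b c d r s : in_gplus a b r -> in_gplus c d s ->
  E a b r * E c d s = E c d s * E a b r + E a d (r + s) *+ (b == c) - E c b (r + s) *+ (a == d).
Proof.
by move=> g1 g2; rewrite -addrA !mulrb [b == c]eq_sym -hE // addrC subrK.
Qed.

Lemma froot_der_bracket a b c d r s : in_gplus a b r -> in_gplus c d s ->
  ~~ special a b r -> ~~ special c d s ->
  E a b r * froot_der c d s + froot_der a b r * E c d s
   - E c d s * froot_der a b r - froot_der c d s * E a b r =
  froot_der a d (r + s) *+ (b == c) - froot_der c b (r + s) *+ (a == d).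
Proof.
move=> g1 g2 s1 s2.
have gad : b = c -> in_gplus a d (r + s) by move=> e; subst c; move: g1 g2; rewrite /in_gplus; lia.
have gcb : a = d -> in_gplus c b (r + s) by move=> e; subst d; move: g1 g2; rewrite /in_gplus; lia.
have sad : b = c -> ~~ special a d (r + s).
  move=> e; subst c; move: g1 g2 s1 s2; rewrite /in_gplus /special -!val_eqE /=; lia.
have scb : a = d -> ~~ special c b (r + s).
  move=> e; subst d; move: g1 g2 s1 s2; rewrite /in_gplus /special -!val_eqE /=; lia.
(* For the affine root, E_kk'[-1] is not reached by bracketing two non-special elements, so no
   bracket here has to produce the central constant. *)
have noconst (i j l : 'I_N) n m : in_gplus i l n -> in_gplus l j m -> ~~ special i l n ->
    ~~ special l j m -> [&& eps, i == k, j == k' & (n + m)%N == 1%N] = false.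
  move: kk'; rewrite /in_gplus /special /simple_root -!val_eqE /=; case: eps => //=.
  have := ltn_ord l; have := ltn_ord i; lia.
have -> : froot_der a d (r + s) *+ (b == c) =
  (E k' d (r + s - eps) *+ (a == k) - E a k (r + s - eps) *+ (d == k')) *+ (b == c).
  case: (b =P c) => [e|//]; subst c.
  by rewrite froot_derE ?gad ?sad // (noconst _ _ _ _ _ g1 g2) // subr0.
have -> : froot_der c b (r + s) *+ (a == d) =
  (E k' b (r + s - eps) *+ (c == k) - E c k (r + s - eps) *+ (b == k')) *+ (a == d).
  case: (a =P d) => [e|//]; subst d.
  have nc := noconst _ _ _ _ _ g2 g1 s2 s1; rewrite addnC in nc.
  by rewrite froot_derE ?gcb ?scb // nc subr0.
have H1 : (E a b r * E k' d (s - eps) - E k' d (s - eps) * E a b r) *+ (c == k) =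
  (E a d (r + s - eps) *+ (b == k') - E k' b (r + s - eps) *+ (a == d)) *+ (c == k).
  case: (c =P k) => [e|//]; have /andP[h g] := special_row g2 s2 e.
  by rewrite !mulr1n hEn // addnBA //; ncring.
have H2 : (E a b r * E c k (s - eps) - E c k (s - eps) * E a b r) *+ (d == k') =
  (E a k (r + s - eps) *+ (b == c) - E c b (r + s - eps) *+ (a == k)) *+ (d == k').
  case: (d =P k') => [e|//]; have /andP[h g] := special_col g2 s2 e.
  by rewrite !mulr1n hEn // addnBA //; ncring.
have H3 : (E k' b (r - eps) * E c d s - E c d s * E k' b (r - eps)) *+ (a == k) =
  (E k' d (r + s - eps) *+ (b == c) - E c b (r + s - eps) *+ (d == k')) *+ (a == k).
  case: (a =P k) => [e|//]; have /andP[h g] := special_row g1 s1 e.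
  by rewrite !mulr1n hEn // addnBAC // [k' == d]eq_sym; ncring.
have H4 : (E a k (r - eps) * E c d s - E c d s * E a k (r - eps)) *+ (b == k') =
  (E a d (r + s - eps) *+ (c == k) - E c k (r + s - eps) *+ (a == d)) *+ (b == k').
  case: (b =P k') => [e|//]; have /andP[h g] := special_col g1 s1 e.
  by rewrite !mulr1n hEn // addnBAC // [k == c]eq_sym; ncring.
rewrite !froot_derE //; set n1 := N%:R *+ _; set n2 := N%:R *+ _.
have c1 : E a b r * n1 = n1 * E a b r by rewrite /n1 mulrnAr mulrnAl mulr_natl mulr_natr.
have c2 : n2 * E c d s = E c d s * n2 by rewrite /n2 mulrnAr mulrnAl mulr_natl mulr_natr.
transitivity
  ((E a b r * E k' d (s - eps) - E k' d (s - eps) * E a b r) *+ (c == k)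
   - (E a b r * E c k (s - eps) - E c k (s - eps) * E a b r) *+ (d == k')
   + (E k' b (r - eps) * E c d s - E c d s * E k' b (r - eps)) *+ (a == k)
   - (E a k (r - eps) * E c d s - E c d s * E a k (r - eps)) *+ (b == k')
   + (n1 * E a b r - E a b r * n1) + (E c d s * n2 - n2 * E c d s)).
  by case: (c == k); case: (d == k'); case: (a == k); case: (b == k'); rewrite ?mulr1n ?mulr0n; ncring.
rewrite H1 H2 H3 H4 c1 c2; clear.
by case: (c == k); case: (d == k'); case: (a == k); case: (b == k'); case: (a == d); case: (b == c);
  rewrite ?mulr1n ?mulr0n; ncring.
Qed.

Lemma froot_der_bracket_special a b c d r s : in_gplus a b r -> in_gplus c d s ->
  special a b r ->
  E a b r * froot_der c d s - froot_der c d s * E a b r + froot_der c d s *~ froot_char a b r =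
  froot_der a d (r + s) *+ (b == c) - froot_der c b (r + s) *+ (a == d).
Proof.
move=> g1 g2 s1; case/and3P: (s1) => /eqP r0 /eqP ab kab; subst b r; rewrite add0n.
have -> : froot_der a d s *+ (a == c) = froot_der c d s *+ (a == c) by case: (a =P c) => [->|].
have -> : froot_der c a s *+ (a == d) = froot_der c d s *+ (a == d) by case: (a =P d) => [->|].
rewrite /froot_char !eqxx /=.
have [s2|s2] := boolP (special c d s).
  by rewrite froot_der_special // !mulr0 mul0r !mul0rn mul0rz !subrr addr0.
have H1 : (E a a 0 * E k' d (s - eps) - E k' d (s - eps) * E a a 0) *+ (c == k) =
  (E k' d (s - eps) *+ (a == k') - E k' d (s - eps) *+ (a == d)) *+ (c == k).
  case: (c =P k) => [e|//]; have /andP[h g] := special_row g2 s2 e.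
  rewrite !mulr1n hEn // add0n.
  have -> : E a d (s - eps) *+ (a == k') = E k' d (s - eps) *+ (a == k') by case: (a =P k') => [->|].
  have -> : E k' a (s - eps) *+ (a == d) = E k' d (s - eps) *+ (a == d) by case: (a =P d) => [->|].
  by ncring.
have H2 : (E a a 0 * E c k (s - eps) - E c k (s - eps) * E a a 0) *+ (d == k') =
  (E c k (s - eps) *+ (a == c) - E c k (s - eps) *+ (a == k)) *+ (d == k').
  case: (d =P k') => [e|//]; have /andP[h g] := special_col g2 s2 e.
  rewrite !mulr1n hEn // add0n.
  have -> : E a k (s - eps) *+ (a == c) = E c k (s - eps) *+ (a == c) by case: (a =P c) => [->|].
  have -> : E c a (s - eps) *+ (a == k) = E c k (s - eps) *+ (a == k) by case: (a =P k) => [->|].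
  by ncring.
rewrite froot_derE //; set n1 := N%:R *+ _.
have c1 : E a a 0 * n1 = n1 * E a a 0 by rewrite /n1 mulrnAr mulrnAl mulr_natl mulr_natr.
have H3 : n1 = n1 *+ ((c == k) && (d == k')).
  by rewrite /n1; case: (c == k); case: (d == k'); rewrite ?andbF ?mulr0n ?mul0rn ?mulr1n.
transitivity
  ((E a a 0 * E k' d (s - eps) - E k' d (s - eps) * E a a 0) *+ (c == k)
   - (E a a 0 * E c k (s - eps) - E c k (s - eps) * E a a 0) *+ (d == k')
   + (n1 * E a a 0 - E a a 0 * n1)
   + (E k' d (s - eps) *+ (c == k) - E c k (s - eps) *+ (d == k') - n1) *~ ((a == k)%:Z - (a == k')%:Z)).
  by case: (c == k); case: (d == k'); rewrite ?mulr1n ?mulr0n; ncring.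
rewrite H1 H2 c1 H3; move: n1 {H3 c1 H1 H2 s2 g1 g2 s1}; move: (E k' d _) (E c k _) => u v n1.
move: kab neq_kk'.
case: (c =P k) => [->|ck]; case: (d =P k') => [->|dk];
case/orP => /eqP -> nk; rewrite ?eqxx ?nk ?[k' == k]eq_sym ?nk /= ?subr0 ?sub0r ?mulr1n ?mulr0n ?mulr1z ?mulrN1z;
 rewrite ?addr0 ?subr0 ?sub0r.
all: by rewrite ?mulNrn ?mul0rn; ncring.
Qed.

Lemma froot_char_der_bracket a b c d r s : in_gplus a b r -> in_gplus c d s ->
  E a b r * froot_der c d s + froot_der a b r * E c d s
   - E c d s * froot_der a b r - froot_der c d s * E a b r
   + froot_der c d s *~ froot_char a b r - froot_der a b r *~ froot_char c d s =
  froot_der a d (r + s) *+ (b == c) - froot_der c b (r + s) *+ (a == d).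
Proof.
move=> g1 g2.
have nsp i j n : ~~ special i j n -> froot_char i j n = 0.
  rewrite /special /froot_char; case: eqP => //= _; case: eqP => //= _.
  by rewrite negb_or => /andP[/negPf -> /negPf ->].
have [s1|s1] := boolP (special a b r).
  rewrite -(froot_der_bracket_special g1 g2 s1) (froot_der_special s1) mul0rz.
  by ncring.
have [s2|s2] := boolP (special c d s).
  rewrite [(r + s)%N]addnC.
  have := froot_der_bracket_special g2 g1 s2.
  rewrite [d == a]eq_sym [c == b]eq_sym (froot_der_special s2) mul0rz => h.
  transitivity (- (E c d s * froot_der a b r - froot_der a b r * E c d s
     + froot_der a b r *~ froot_char c d s)); first by ncring.
  by rewrite h; ncring.
by rewrite !nsp // !mulr0z -froot_der_bracket //; ncring.
Qed.

Lemma froot_ext_lie : lie_rep froot_ext.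
Proof.
move=> a b c d r s g1 g2; rewrite [c == b]eq_sym.
have R1 : forall (X : 'M[A]_2) (t : bool), (if t then X else 0) = X *+ t by move=> X [].
rewrite !R1.
have nE (X : 'M[A]_2) (t : bool) i j : (X *+ t) i j = X i j *+ t by rewrite mulmxnE.
have hc := hEn g1 g2.
have cint (x : A) (z : int) : x * z%:~R = z%:~R * x by rewrite mulrzr mulrzl.
have c0 : (froot_char a d (r + s))%:~R *+ (b == c) - (froot_char c b (r + s))%:~R *+ (a == d) = 0 :> A.
  rewrite /froot_char; case: (r + s =P 0)%N => [h|_] /=; last by rewrite !mul0rn subr0.
  case: (b =P c) => [e1|nbc]; case: (a =P d) => [e2|_]; rewrite ?mulr0n ?subr0 //.
  - have ba : b = a by apply: val_inj; move: g1 g2; rewrite -e1 -e2 /in_gplus /=; lia.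
    by rewrite -e1 ba eqxx; exact: subrr.
  - by case: eqP => [e|_]; [case: nbc | rewrite mul0rn subr0].
have eB (X Y : 'M[A]_2) i j : (X - Y) i j = X i j - Y i j by rewrite !mxE.
apply: mx22P; rewrite !eB !mulmx22E !nE !mxE /= ?mulr0 ?mul0r ?addr0 ?add0r ?mul0rn ?subrr //.
- transitivity (E a b r * E c d s - E c d s * E a b r); last first.
    rewrite hc.
    transitivity (E a d (r + s) *+ (b == c) - E c b (r + s) *+ (a == d) +
      ((froot_char a d (r + s))%:~R *+ (b == c) - (froot_char c b (r + s))%:~R *+ (a == d))).
      by rewrite c0; ncring.
    by rewrite !mulrnDl; ncring.
  move: (froot_char a b r) (froot_char c d s) => z1 z2.
  by rewrite !(mulrDl, mulrDr) (cint _ z1) (cint _ z2) (cint z1%:~R z2); ncring.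
- move: (froot_char_der_bracket g1 g2) => <-.
  by rewrite !mulrDl !mulrzl; ncring.
- by rewrite oppr0.
- by rewrite hc; ncring.
Qed.
End SimpleRoot.

(** Covers the entry maps of a ring of 2 x 2 matrices, which send a product to a sum of two
    products. *)
Lemma map_mx_mul2 (B A : pzRingType) n (h f1 h1 f2 h2 : B -> A) :
  h 0 = 0 -> {morph h : x y / x + y} ->
  (forall x y, h (x * y) = f1 x * h1 y + f2 x * h2 y) ->
  forall X Y : 'M[B]_n, map_mx h (X * Y) =
    map_mx f1 X * map_mx h1 Y + map_mx f2 X * map_mx h2 Y.
Proof.
move=> h0 hD hM X Y; apply/matrixP => i j; rewrite !mxE (big_morph h hD h0) -big_split.
by apply: eq_bigr => t _; rewrite hM !mxE.
Qed.

Lemma map_mx_morph0 (B A : pzRingType) n (h : B -> A) : h 0 = 0 ->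
  map_mx h (0 : 'M[B]_n) = 0.
Proof. by move=> h0; apply/matrixP => i j; rewrite !mxE h0. Qed.

Lemma map_mx_morphD (B A : pzRingType) n (h : B -> A) : {morph h : x y / x + y} ->
  {morph (map_mx h : 'M[B]_n -> 'M[A]_n) : X Y / X + Y}.
Proof. by move=> hD X Y; apply/matrixP => i j; rewrite !mxE hD. Qed.

(** Models the corner entry in the powers of a triangular matrix with diagonal [s], [X] and corner
    [e * X - s * e + t]: the coboundary part telescopes, and only [t] leaves a sum. *)
Lemma skew_exp (R : pzRingType) (d : nat -> R) (s e X t : R) :
  d 0%N = 0 -> (forall m, d m.+1 = s * d m + (e * X - s * e + t) * X ^+ m) ->
  forall m, d m = e * X ^+ m - s ^+ m * e + \sum_(a < m) s ^+ a * t * X ^+ (m - a.+1).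
Proof.
move=> d0 dS; elim=> [|m IH]; first by rewrite big_ord0 d0 !expr0; ncring.
rewrite dS IH big_ord_recl subSS subn0 expr0 mul1r !exprS mulrDr mulr_sumr.
rewrite [in RHS](eq_bigr (fun a : 'I_m => s * (s ^+ a * t * X ^+ (m - a.+1)))).
  by ncring.
by move=> a _; rewrite lift0 subSS exprS !mulrA.
Qed.

Lemma exp_sum (R : pzRingType) (X Y : R) m :
  (X + Y) ^+ m = X ^+ m + \sum_(a < m) (X + Y) ^+ a * Y * X ^+ (m - a.+1).
Proof.
elim: m => [|m IH]; first by rewrite big_ord0 addr0.
rewrite {1}exprS {1}IH big_ord_recl subSS subn0 expr0 mul1r exprS mulrDr mulr_sumr.
rewrite [in RHS](eq_bigr (fun a : 'I_m => (X + Y) * ((X + Y) ^+ a * Y * X ^+ (m - a.+1)))).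
  by ncring.
by move=> a _; rewrite lift0 subSS exprS !mulrA.
Qed.

(** * Traces of powers of the shifted operator matrix *)

Section Theta.
Variables (A : pzRingType) (N P : nat) (E : 'I_N -> 'I_N -> nat -> A).

Definition jshift (i a : 'I_N) : int := (a : nat)%:Z - (i < a)%N%:Z.

Definition thop m : 'M[A]_P := \sum_i (xmx (lop P E) (jshift i) ^+ m) i i.

Lemma eq_xmx x y : x =1 y -> xmx (lop P E) x = xmx (lop P E) y.
Proof. by move=> xy; apply/matrixP => i j; rewrite !mxE xy. Qed.

Definition ushift (eps : bool) : 'M[A]_P := toep P (fun n => (n == eps)%:R).

Lemma ushift_toep eps f : ushift eps * toep P f =
  toep P (fun n => if (eps <= n)%N then f (n - eps)%N else 0).
Proof.
rewrite toepM; apply/matrixP => q p; rewrite !mxE; case: leqP => // _.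
move: (q - p)%N => n; case: leqP => h.
  rewrite (bigD1 (Ordinal (n:=n.+1) (m:= n - eps) (ltac:(lia)))) //= subKn // eqxx mul1r big1 ?addr0 //.
  move=> r /eqP rn; have := ltn_ord r; case: eqP => [e|_]; last by rewrite mul0r.
  by move=> hr; case: rn; apply: val_inj => /=; lia.
by rewrite big1 // => r _; case: eqP => [e|_]; rewrite ?mul0r //; lia.
Qed.

Lemma toep_ushift eps f : toep P f * ushift eps =
  toep P (fun n => if (eps <= n)%N then f (n - eps)%N else 0).
Proof.
rewrite toepM; apply/matrixP => q p; rewrite !mxE; case: leqP => // _.
move: (q - p)%N => n; case: leqP => h.
  rewrite (bigD1 (Ordinal (n:=n.+1) (m:= eps) (ltac:(lia)))) //= eqxx mulr1 big1 ?addr0 //.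
  move=> r /eqP rn; case: eqP => [e|_]; last by rewrite mulr0.
  by case: rn; apply: val_inj.
by rewrite big1 // => r _; case: eqP => [e|_]; rewrite ?mulr0 //; have := ltn_ord r; lia.
Qed.

Lemma udu_ushift (eps : bool) : udu A P * ushift eps = ushift eps * (udu A P + eps%:R).
Proof.
have := udu_toep P (fun n => (n == eps)%:R : A).
have -> : toep P (fun n => ((n == eps)%:R : A) *+ n) = ushift eps *+ eps.
  by apply/matrixP => q p; rewrite mulmxnE !mxE; case: leqP => _; rewrite ?mul0rn //; case: (@eqP nat (q - p)%N eps) => [->|_]; rewrite ?mul0rn.
rewrite -/(ushift eps) => h.
by rewrite -[LHS](subrK (ushift eps * udu A P)) h mulrDr mulr_natr addrC.
Qed.

(** Multiplication by u commutes with the Toeplitz part and moves [u d_u] by one, so it crosses a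
    power at the cost of a uniform diagonal shift. *)
Lemma xmx_ushift eps x m i j : (xmx (lop P E) x ^+ m) i j * ushift eps =
  ushift eps * (xmx (lop P E) (fun a => x a + eps%:Z) ^+ m) i j.
Proof.
elim: m i => [|m IH] i; first by rewrite !expr0 !mxE; case: (i == j); rewrite ?mulr1 ?mul1r ?mulr0 ?mul0r.
have lU a b : lop P E a b * ushift eps = ushift eps * (lop P E a b + eps%:R *+ (a == b)).
  rewrite /lop mulrDl toep_ushift -ushift_toep.
  by case: (a == b); rewrite ?mulr1n ?mulr0n ?mul0r ?udu_ushift; ncring.
rewrite !exprS !mul_xmx mulrDl mulr_suml mulrDr mulr_sumr mulrzDr.
rewrite (eq_bigr (fun b => ushift eps * (lop P E i b * (xmx (lop P E) (fun a => x a + eps%:Z) ^+ m) b j)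
  + (ushift eps * (xmx (lop P E) (fun a => x a + eps%:Z) ^+ m) b j *+ eps) *+ (i == b))).
  rewrite big_split sum_delta /= mulrzAl IH -mulrzAr [in RHS]mulrDr -pmulrn mulrnAr.
  by ncring.
move=> b _; rewrite -mulrA IH !mulrA lU; case: (i == b); last by rewrite !mulr0n; ncring.
by rewrite !mulr1n mulrDr mulrDl mulr_natr mulrnAl; ncring.
Qed.

End Theta.

Lemma intmxE (A : pzRingType) n (z : int) (i j : 'I_n) :
  (z%:~R : 'M[A]_n) i j = z%:~R *+ (i == j).
Proof.
have nE m : (m%:R : 'M[A]_n) i j = m%:R *+ (i == j) by rewrite mulmxnE mxE mulrnAC.
by case: z => m; rewrite ?NegzE ?mulrNz ?mxE -!pmulrn nE // mulNrn.
Qed.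

(** * Singularity of the coefficients of the normalised operators *)

Section Singular.
Variables (A : pzRingType) (N P : nat) (E : 'I_N -> 'I_N -> nat -> A).
Variables (k k' : 'I_N) (eps : bool).
Hypothesis kk' : simple_root k k' eps.
Hypothesis hE : lie_rep E.

Let E2 := froot_ext E k k' eps.
Let ent (i j : 'I_2) (b : 'M[A]_2) : A := b i j.
Let cmp i j (X : 'M['M['M[A]_2]_P]_N) : 'M['M[A]_P]_N := map_mx (map_mx (ent i j)) X.
Let X i := xmx (lop P E) (jshift i).
Let h (a : 'I_N) : int := (a == k)%:Z - (a == k')%:Z.
Let sX i := xmx (lop P E) (fun a => jshift i a + h a).
Let X2 i := xmx (lop P E2) (jshift i).
Let U : 'M[A]_P := ushift A P eps.
Let e : 'M['M[A]_P]_N := \matrix_(a, b) (U *+ ((a == k) && (b == k'))).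

Let ent0 i j : ent i j 0 = 0. Proof. by rewrite /ent mxE. Qed.
Let entD i j : {morph ent i j : x y / x + y}. Proof. by move=> x y; rewrite /ent mxE. Qed.

Lemma cmpM i j (Y Z : 'M['M['M[A]_2]_P]_N) :
  cmp i j (Y * Z) = cmp i 0 Y * cmp 0 j Z + cmp i 1 Y * cmp 1 j Z.
Proof.
apply: map_mx_mul2; [exact/map_mx_morph0|exact/map_mx_morphD|].
by apply: map_mx_mul2 => [||x y]; [exact: ent0|exact: entD|exact: mulmx22E].
Qed.

Lemma emask_ext i j n : emask E2 i j n =
  mx22 (emask E i j n + (froot_char k k' i j n)%:~R) (froot_der E k k' eps i j n) 0 (emask E i j n).
Proof.
rewrite /emask; case: ifP => // g.
apply: mx22P; rewrite !mxE //=.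
  rewrite /froot_char; case: ifP; rewrite ?add0r // => /andP[/eqP n0 /eqP ij].
  by move: g; rewrite /in_gplus n0 ij leqnn orbT.
move: g; rewrite /in_gplus => /negbT; rewrite negb_or -leqNgt leqn0 -ltnNge => /andP[/eqP -> ji].
rewrite /froot_der !andbF subr0 /emask /in_gplus.
move: kk'; rewrite /simple_root; case: eps; rewrite ?andbF ?subrr //= !andbT => kk.
case: eqP => [ik|_]; case: eqP => [jk|_]; rewrite ?subr0 ?sub0r ?oppr0 //.
- by subst; lia.
- by subst; case: leqP => //; lia.
- by subst; case: leqP; rewrite ?oppr0 //; lia.
Qed.

Lemma cmp_X2 i a b x y : cmp x y (X2 i) a b =
  toep P (fun n => emask E2 a b n x y) + ((udu A P + 1 *~ jshift i a) *+ (a == b)) *+ (x == y).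
Proof.
apply/matrixP => q p; rewrite !mxE /ent.
rewrite !mxE /lop.
rewrite !mulmxnE !mxE.
have -> : (if (p <= q)%N then emask E2 a b (q - p) else 0) x y =
  if (p <= q)%N then emask E2 a b (q - p) x y else 0 by case: ifP; rewrite ?mxE.
rewrite -addrA; congr (_ + _).
case: (a == b); rewrite ?mulr1n ?mulr0n ?mxE ?addr0 ?mul0rn // !intmxE !mulmxnE.
case: (q == p); rewrite ?mulr1n ?mulr0n ?mxE ?addr0 ?mul0rn // !intmxE.
by rewrite mulrnDl mulrnAC.
Qed.

Lemma cmp10 i : cmp 1 0 (X2 i) = 0.
Proof.
apply/matrixP => a b; rewrite cmp_X2 mulr0n addr0; apply/matrixP => q p.
by rewrite !mxE emask_ext !mxE; case: ifP.
Qed.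

Lemma cmp11 i : cmp 1 1 (X2 i) = X i.
Proof.
apply/matrixP => a b; rewrite cmp_X2 !mxE /lop mulr1n mulrnDl addrA.
by congr (_ + _ + _); apply/matrixP => q p; rewrite !mxE emask_ext !mxE.
Qed.

Lemma cmp00 i : cmp 0 0 (X2 i) = sX i.
Proof.
apply/matrixP => a b; rewrite cmp_X2 !mxE /lop mulr1n.
have -> : toep P (fun n => emask E2 a b n 0 0) = toep P (emask E a b) + (1 *~ h a) *+ (a == b).
  apply/matrixP => q p; rewrite !mxE emask_ext !mxE /= /froot_char.
  rewrite mulmxnE intmxE -(val_eqE q p) /= /h; case: (a == b); rewrite ?andbF ?andbT ?mulr0n ?mulr1n ?addr0 //.
  case: leqP => pq; last first.
    have -> : (q == p :> nat) = false by lia.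
    by rewrite add0r.
  have -> : (q - p == 0)%N = (q == p :> nat) by lia.
  by case: eqP.
by case: (a == b); rewrite ?mulr1n ?mulr0n ?mulrzDr; ncring.
Qed.

(** The matrix [l] pairs the letters with matrix units, so bracketing its letters with f is, up to
    the twist by the character, commutation with [e], the matrix unit times [u ^ eps]. The diagonal
    shifts and the central constant combine into the single extra term at [i = k]. *)
Lemma cmp01 i : cmp 0 1 (X2 i) = e * X i - sX i * e + e *+ (i == k).
Proof.
apply/matrixP => a b; rewrite cmp_X2 mulr0n addr0.
have eXE : (e * X i) a b = (U * X i k' b) *+ (a == k).
  rewrite mxE (eq_bigr (fun c => ((U * X i c b) *+ (a == k)) *+ (k' == c))) ?sum_delta //.
  by move=> c _; rewrite [e _ _]mxE [k' == c]eq_sym; case: (a == k); case: (c == k'); rewrite ?mulr0n ?mul0r ?mul0rn.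
have XeE : (sX i * e) a b = (sX i a k * U) *+ (b == k').
  rewrite mxE (eq_bigr (fun c => ((sX i a c * U) *+ (b == k')) *+ (k == c))) ?sum_delta //.
  by move=> c _; rewrite [e _ _]mxE [k == c]eq_sym; case: (b == k'); case: (c == k); rewrite ?mulr0n ?mulr0 ?mul0rn.
have eB (V : zmodType) (Y Z W : 'M[V]_N) : (Y - Z + W) a b = Y a b - Z a b + W a b by rewrite !mxE.
rewrite eB eXE XeE mulmxnE [e a b]mxE.
have -> : X i k' b = toep P (emask E k' b) + (udu A P + 1 *~ jshift i k') *+ (k' == b).
  by rewrite mxE /lop mulrnDl addrA.
have -> : sX i a k = toep P (emask E a k) + (udu A P + 1 *~ (jshift i k + 1)) *+ (a == k).
  rewrite mxE /lop -addrA -mulrnDl /h; congr (_ + _); case: (a =P k) => [->|//].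
  by rewrite (neq_kk' kk') subr0.
have -> : toep P (fun n => emask E2 a b n 0 1) =
   (U * toep P (emask E k' b)) *+ (a == k) - (toep P (emask E a k) * U) *+ (b == k')
   - U *+ [&& eps, a == k & b == k'] *+ N.
  apply/matrixP => q p; rewrite /U ushift_toep toep_ushift !mxE !mulmxnE !mxE emask_ext !mxE /= /froot_der.
  case: leqP => _; last by rewrite !mul0rn !subr0.
  congr (_ - _ - _); [by case: (a == k)|by case: (b == k')|].
  by case: eps => /=; rewrite ?mul0rn //; case: (a == k); case: (b == k'); rewrite /= ?mul0rn // eq_sym; case: eqP; rewrite ?mul0rn.
have hU := udu_ushift A P eps; rewrite -/U in hU.
case: (a =P k) => [ak|_]; case: (b =P k') => [bk|nbk]; rewrite ?andbF ?mulr0n ?mulr1n.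
- rewrite bk !eqxx mulr1n.
  rewrite !(mulrDr, mulrDl) hU mulrDr mulrzAr mulrzAl mulr1 mul1r mulr_natr ?andTb ?andbT.
  (* This identity ties the constant [N] to [jshift]. For the affine root [jshift i k'] is 0 and
     [jshift i k] is N - 1 - (i < k), and the right-hand side adds up to -N because every i
     satisfies i <= k. *)
  have Ez : - (U *+ eps *+ N) = U *~ jshift i k' - U *+ eps - U *~ (jshift i k + 1) + U *+ (i == k).
    have zz : - (eps * N)%N%:Z = jshift i k' - eps%:Z - (jshift i k + 1) + (i == k)%:Z.
      move: kk'; rewrite /simple_root /jshift -val_eqE /=; have := ltn_ord i.
      by case: eps => /=; case: (ltngtP i k); case: (ltngtP i k'); lia.
    transitivity (U *~ (- (eps * N)%N%:Z)); first by rewrite mulrNz -pmulrn mulrnA.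
    by rewrite zz [LHS]mulrzDr mulrzBr mulrzBr -!pmulrn.
  rewrite Ez; ncring.
- have -> : (k' == b) = false by rewrite eq_sym; apply/eqP.
  by rewrite ?andbF ?mulr0n ?mul0rn; ncring.
- by rewrite ?andbF ?mulr0n ?mul0rn; ncring.
- by rewrite ?andbF ?mulr0n ?mul0rn; ncring.
Qed.

Lemma cmp01_exp i m : cmp 0 1 (X2 i ^+ m) =
  e * X i ^+ m - sX i ^+ m * e + (\sum_(a < m) sX i ^+ a * e * X i ^+ (m - a.+1)) *+ (i == k).
Proof.
have c11 n : cmp 1 1 (X2 i ^+ n) = X i ^+ n.
  elim: n => [|n IH]; last by rewrite !exprS cmpM cmp10 mul0r add0r cmp11 IH.
  by rewrite !expr0; apply/matrixP => a b; apply/matrixP => q p; rewrite !mxE /ent; case: (a == b); rewrite /= ?mxE; case: (q == p); rewrite ?mxE.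
rewrite (@skew_exp _ (fun m => cmp 0 1 (X2 i ^+ m)) (sX i) e (X i) (e *+ (i == k))).
- congr (_ + _); rewrite -sumrMnl; apply: eq_bigr => a _; by rewrite mulrnAr mulrnAl.
- rewrite expr0; apply/matrixP => a b; apply/matrixP => q p; rewrite !mxE /ent; case: (a == b); rewrite /= ?mxE; case: (q == p); rewrite ?mxE //.
- by move=> n; rewrite exprS cmpM cmp00 cmp01 c11.
Qed.

(** In the trace of [cmp01_exp] the matrix [e] selects the diagonal positions [k] and [k']. Once [u]
    stands on the left and [exp_sum] has split off the unit at [k], the difference is that of the
    two convolutions identified by [xconv_sym]. *)
Theorem thop_singular m : map_mx (ent 0 1) (thop P E2 m) = 0.
Proof.
case: m => [|m].
  apply/matrixP => q p; rewrite !mxE summxE /ent summxE big1 // => i _.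
  by rewrite expr0 mxE eqxx !mxE; case: (q == p); rewrite !mxE.
have -> : map_mx (ent 0 1) (thop P E2 m.+1) = \sum_i (cmp 0 1 (X2 i ^+ m.+1)) i i.
  rewrite /thop (big_morph (map_mx (ent 0 1)) (map_mx_morphD (entD 0 1)) (map_mx_morph0 _ (ent0 0 1))).
  by apply: eq_bigr => i _; rewrite [in RHS]mxE.
have eXE Y i : (e * Y) i i = (U * Y k' k) *+ (i == k).
  rewrite mxE (eq_bigr (fun c => ((U * Y c i) *+ (i == k)) *+ (k' == c))).
    by rewrite sum_delta; case: (i =P k) => [->|].
  by move=> c _; rewrite [e _ _]mxE [k' == c]eq_sym; case: (i == k); case: (c == k'); rewrite ?mulr0n ?mul0r ?mul0rn.
have XeE Y i j : (Y * e) i j = (Y i k * U) *+ (j == k').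
  rewrite mxE (eq_bigr (fun c => ((Y i c * U) *+ (j == k')) *+ (k == c))) ?sum_delta //.
  by move=> c _; rewrite [e _ _]mxE [k == c]eq_sym; case: (j == k'); case: (c == k); rewrite ?mulr0n ?mulr0 ?mul0rn.
have XeYE Y Z : (Y * e * Z) k k = Y k k * U * Z k' k.
  rewrite mxE (eq_bigr (fun c => (Y k k * U * Z c k) *+ (k' == c))) ?sum_delta //.
  by move=> c _; rewrite XeE [k' == c]eq_sym; case: (c == k'); rewrite ?mulr0n ?mul0r.
rewrite (eq_bigr (fun i => (U * (X k ^+ m.+1) k' k
     + \sum_(a < m.+1) (sX k ^+ a) k k * U * (X k ^+ (m.+1 - a.+1)) k' k) *+ (k == i)
     - ((sX k' ^+ m.+1) k' k * U) *+ (k' == i))); last first.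
  move=> i _; rewrite cmp01_exp.
  have eB (V : zmodType) (Y Z W : 'M[V]_N) : (Y - Z + W) i i = Y i i - Z i i + W i i by rewrite !mxE.
  rewrite eB eXE XeE mulmxnE summxE [k == i]eq_sym [k' == i]eq_sym.
  have [-> | ik] := eqVneq i k.
    by rewrite (neq_kk' kk') !mulr1n !mulr0n (eq_bigr _ (fun a _ => XeYE _ _)) !subr0.
  have [-> | ik'] := eqVneq i k'; last by rewrite !mulr0n; ncring.
  by rewrite !mulr1n !mulr0n; ncring.
rewrite sumrB !sum_delta.
(* Changing the base point of [jshift] from [k'] to [k] absorbs the entry -1 of the character at
   [k']; for the affine root this costs a shift by one, which [u] undoes. *)
have sxk' : sX k' = xmx (lop P E) (fun a => jshift k a - eps%:Z + (a == k)%:Z).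
  apply: eq_xmx => a; move: kk'; rewrite /h /simple_root /jshift -!val_eqE /=; have := ltn_ord a.
  by case: eps => /=; case: (ltngtP k a); case: (ltngtP k' a); lia.
have sxk a : U * (xmx (lop P E) (xshift (jshift k) k k') ^+ a) k k = (sX k ^+ a) k k * U.
  rewrite xmx_ushift; congr (_ * fun_of_matrix (_ ^+ _) k k); apply: eq_xmx => b.
  move: kk'; rewrite /h /simple_root /xshift -!val_eqE /=; have := ltn_ord b.
  by case: eps => /=; case: (ltngtP k b); case: (ltngtP k' b); lia.
have sym := @xconv_sym _ _ (lop P E) _ _ _ (fun _ _ => erefl) (lop_comm P hE) (jshift k) k m k' k.
have -> : (sX k' ^+ m.+1) k' k * U = U * ((X k ^+ m.+1) k' k + xconv (lop P E) (jshift k) k m k k').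
  rewrite sxk' xmx_ushift; congr (_ * _).
  have -> : xmx (lop P E) (fun a => jshift k a - eps%:Z + (a == k)%:Z + eps%:Z) = X k + delta_mx k k.
    apply/matrixP => a b; rewrite !mxE -[RHS]addrA; congr (_ + _).
    case: (a =P b) => [<-|ab].
      by rewrite !mulr1n andbb [_%:R]pmulrn -mulrzDr; congr (_ *~ _); lia.
    by rewrite !mulr0n add0r; case: (a =P k) => //= ak; case: (b =P k) => //= bk; case: ab; rewrite ak bk.
  rewrite exp_sum mxE; congr (_ + _); rewrite summxE /xconv; apply: eq_bigr => p _.
  have dk (Y Z : 'M['M[A]_P]_N) : (Y * delta_mx k k * Z) k' k = Y k' k * Z k k.
    rewrite mxE (eq_bigr (fun c => (Y k' k * Z c k) *+ (k == c))) ?sum_delta //.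
    move=> c _; rewrite mxE (eq_bigr (fun d => (Y k' d *+ (c == k)) *+ (k == d))).
      by rewrite sum_delta [k == c]eq_sym mulrnAl.
    by move=> d _; rewrite !mxE [k == d]eq_sym; case: (d == k); case: (c == k); rewrite ?mulr1 ?mulr0.
  rewrite dk subSS; congr (_ * _); congr (fun_of_matrix (_ ^+ _) k' k).
  apply/matrixP => a b; rewrite !mxE -[LHS]addrA; congr (_ + _).
  case: (a =P b) => [<-|ab].
    by rewrite !mulr1n andbb [_%:R]pmulrn -mulrzDr; congr (_ *~ _); rewrite /xshift; lia.
  by rewrite !mulr0n add0r; case: (a =P k) => //= ak; case: (b =P k) => //= bk; case: ab; rewrite ak bk.
rewrite -sym /xconv mulrDr mulr_sumr.
rewrite (eq_bigr (fun p : 'I_m.+1 => U * ((xmx (lop P E) (xshift (jshift k) k k') ^+ p) k k * (X k ^+ (m - p)) k' k))).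
  by ncring.
by move=> p _; rewrite -sxk mulrA subSS.
Qed.

End Singular.

(** * Symbols of words *)

Section Words.
Variable N : nat.
Definition letter : Type := ('I_N * 'I_N * nat)%type.
HB.instance Definition _ := Choice.on letter.
Implicit Types (x y : letter) (u v w : seq letter).

Lemma letter_eqE x y : (x == y) = [&& x.1.1 == y.1.1, x.1.2 == y.1.2 & x.2 == y.2].
Proof. by case: x y => [[x1 x2] x3] [[y1 y2] y3]; rewrite !xpair_eqE /= andbA. Qed.

Definition evx (A : pzRingType) (E : 'I_N -> 'I_N -> nat -> A) x : A := E x.1.1 x.1.2 x.2.
Definition evw (A : pzRingType) (E : 'I_N -> 'I_N -> nat -> A) w : A := \prod_(x <- w) evx E x.
Definition evl (A : pzRingType) (E : 'I_N -> 'I_N -> nat -> A) (s : seq (int * seq letter)) : A :=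
  \sum_(t <- s) evw E t.2 *~ t.1.

Fixpoint dropsum (f : letter -> int) (g : seq letter -> int) u : int :=
  if u is y :: u' then f y * g u' + dropsum f (fun t => g (y :: t)) u' else 0.

(* [psi w u] counts the bijections between positions matching the letters of [u] and [w]. *)
Fixpoint psi w : seq letter -> int :=
  if w is x :: w' then dropsum (fun y => (y == x)%:Z) (psi w') else fun u => (u == [::])%:Z.

Lemma eq_dropsum f f' g g' u : f =1 f' -> (forall t, (size t).+1 = size u -> g t = g' t) ->
  dropsum f g u = dropsum f' g' u.
Proof.
move=> ff; elim: u g g' => [|y u IH] g g' gg //=.
by rewrite ff gg //; congr (_ + _); apply: IH => t ht; rewrite gg //= -ht.
Qed.

Lemma dropsum0 f u : dropsum f (fun=> 0) u = 0.
Proof. by elim: u => //= y u ->; rewrite mulr0 addr0. Qed.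

Section Step.
Variables (A : pzRingType) (E : 'I_N -> 'I_N -> nat -> A) (P : nat).
Hypothesis hE : lie_rep E.
Local Notation R := 'M['M[A]_P]_N.

(* Tensoring with the evaluation module adds one letter to the words that can be detected. *)
Definition rho (i j : 'I_N) (n : nat) : R :=
  \matrix_(a, b) (toep P (fun m => (m == n)%:R) *+ ((a == i) && (b == j))).
Definition iota2 (a : A) : R := (a%:M)%:M.
Definition stepE i j n : R := rho i j n + iota2 (E i j n).

Lemma rhoM i j n k l m : rho i j n * rho k l m = rho i l (n + m)%N *+ (j == k).
Proof.
have tM : toep P (fun m' => (m' == n)%:R) * toep P (fun m' => (m' == m)%:R)
   = toep P (fun m' => (m' == (n + m)%N)%:R : A).
  rewrite toepM; apply/matrixP => q p; rewrite !mxE; case: leqP => // _.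
  move: (q - p)%N => t; case: (t =P (n + m)%N) => [->|ne].
    rewrite (bigD1 (Ordinal (n:=(n+m).+1) (m:= m) (ltac:(lia)))) //= addnK !eqxx mulr1 big1 ?addr0 //.
    move=> r /eqP rn; case: (@eqP nat r m) => [e|_]; last by rewrite mulr0.
    by case: rn; apply: val_inj.
  rewrite big1 // => r _; case: (@eqP nat r m) => [e|_]; last by rewrite mulr0.
  by rewrite e; case: eqP => [e'|_]; rewrite ?mul0r //; have := ltn_ord r; lia.
apply/matrixP => a b; rewrite mxE (eq_bigr (fun c => (toep P (fun m' => (m' == (n + m)%N)%:R : A)
   *+ ((a == i) && (b == l)) *+ (j == k)) *+ (j == c))).
  by rewrite sum_delta mulmxnE mxE.
move=> c _; rewrite !mxE [j == c]eq_sym.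
case: (a == i); case: (c =P j) => [->|_]; case: (b == l); case: (j == k);
  by rewrite ?mulr0n ?mulr1n ?mul0r ?mulr0 ?mul0rn ?tM.
Qed.

Lemma iota2M a b : iota2 (a * b) = iota2 a * iota2 b.
Proof. by rewrite /iota2 !scalar_mxM. Qed.

Lemma iota2B a b : iota2 (a - b) = iota2 a - iota2 b.
Proof. by rewrite /iota2 !raddfB. Qed.

Lemma iota2E a (i j : 'I_N) (q p : 'I_P) : iota2 a i j q p = a *+ ((i == j) && (q == p)).
Proof. by rewrite !mxE; case: (i == j); rewrite ?mulr0n ?mulr1n mxE. Qed.

Lemma mulRE (X Y : R) i j q p : (X * Y) i j q p = \sum_k \sum_r X i k q r * Y k j r p.
Proof.
by rewrite mxE summxE; apply: eq_bigr => k _; rewrite mxE.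
Qed.

Lemma iota2_mul a (Y : R) i j q p : (iota2 a * Y) i j q p = a * Y i j q p.
Proof.
rewrite mulRE (eq_bigr (fun k => (\sum_r (a * Y k j r p) *+ (q == r)) *+ (i == k))).
  by rewrite sum_delta sum_delta.
move=> k _; rewrite -sumrMnl; apply: eq_bigr => r _.
by rewrite iota2E; case: (i == k); case: (q == r); rewrite ?mulr0n ?mulr1n ?mul0r.
Qed.

Lemma mul_iota2 a (Y : R) i j q p : (Y * iota2 a) i j q p = Y i j q p * a.
Proof.
rewrite mulRE (eq_bigr (fun k => (\sum_r (Y i k q r * a) *+ (p == r)) *+ (j == k))).
  by rewrite sum_delta sum_delta.
move=> k _; rewrite -sumrMnl; apply: eq_bigr => r _.
by rewrite iota2E [j == k]eq_sym [p == r]eq_sym; case: (k == j); case: (r == p);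
  rewrite ?mulr0n ?mulr1n ?mulr0.
Qed.

Lemma rhoE i j n a b (q p : 'I_P) : rho i j n a b q p =
  [&& a == i, b == j, (p <= q)%N & (q - p)%N == n]%:R.
Proof.
rewrite !mxE mulmxnE mxE; case: (a == i); case: (b == j); rewrite ?mulr0n ?mulr1n //=.
by case: (p <= q)%N.
Qed.

Lemma iota2_rho a i j n : iota2 a * rho i j n = rho i j n * iota2 a.
Proof.
apply/matrixP => b c; apply/matrixP => q p; rewrite iota2_mul mul_iota2 rhoE.
by rewrite mulr_natl mulr_natr.
Qed.

Lemma stepE_lie : lie_rep stepE.
Proof.
move=> i j k l r s g1 g2; rewrite /stepE.
have -> (X Y : R) t : (if t then X + Y else 0) = X *+ t + Y *+ t by case: t; rewrite ?addr0.
have -> (X Y : R) t : (if t then X + Y else 0) = X *+ t + Y *+ t by case: t; rewrite ?addr0.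
have := hE g1 g2; set x := E i j r; set y := E k l s => h.
have h2 : iota2 x * iota2 y - iota2 y * iota2 x =
   iota2 (E i l (r + s)%N) *+ (k == j) - iota2 (E k j (r + s)%N) *+ (i == l).
  rewrite -!iota2M -iota2B h iota2B; congr (_ - _); case: ifP => //; by rewrite /iota2 !raddf0.
rewrite !(mulrDl, mulrDr) !rhoM !iota2_rho [l == i]eq_sym [j == k]eq_sym [(s + r)%N]addnC.
have -> : iota2 x * iota2 y = iota2 y * iota2 x + (iota2 (E i l (r + s)%N) *+ (k == j) - iota2 (E k j (r + s)%N) *+ (i == l)).
  by rewrite -h2 addrC subrK.
by ncring.
Qed.

Variables (lam : {additive A -> int}) (d : nat).
Hypothesis lam0 : forall u, (size u < d)%N -> lam (evw E u) = 0.

Lemma evw_cons (B : pzRingType) (F : 'I_N -> 'I_N -> nat -> B) x u : evw F (x :: u) = evx F x * evw F u.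
Proof. by rewrite /evw big_cons. Qed.

Lemma evw_cat (B : pzRingType) (F : 'I_N -> 'I_N -> nat -> B) u v : evw F (u ++ v) = evw F u * evw F v.
Proof. by rewrite /evw big_cat. Qed.

Definition rhoz (a b : 'I_N) (q p : 'I_P) x : int :=
  [&& a == x.1.1, b == x.1.2, (p <= q)%N & (q - p)%N == x.2]%:Z.

(** Each letter acts either through [rho] or on the old factor. If two letters went to [rho], the
    remaining word would be shorter than [d] and killed by [lam]; hence at most one letter is
    extracted. *)
Lemma lam_step v u a b q p : (size v + size u <= d.+1)%N ->
  lam (evw E v * evw stepE u a b q p) =
  ((a == b) && (q == p))%:Z * lam (evw E (v ++ u))
  + dropsum (rhoz a b q p) (fun t => lam (evw E (v ++ t))) u.
Proof.
elim: u v a q => [|x u IH] v a q hs.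
  rewrite /= addr0 cats0 /evw big_nil !mxE.
  by case: (a == b); rewrite /= ?mxE; case: (q == p); rewrite ?mulr1 ?mulr0 ?mul0r ?mul1r ?raddf0.
rewrite evw_cons /= in hs *.
have eD (X Y : R) : (X + Y) a b q p = X a b q p + Y a b q p by rewrite !mxE.
rewrite {1}/evx {1}/stepE mulrDl eD iota2_mul mulrDr raddfD /=.
have -> : v ++ x :: u = rcons v x ++ u by rewrite cat_rcons.
have -> : evw E v * (E x.1.1 x.1.2 x.2 * evw stepE u a b q p) = evw E (rcons v x) * evw stepE u a b q p.
  by rewrite mulrA -cats1 evw_cat /evw big_seq1.
rewrite IH; last by rewrite size_rcons; lia.
rewrite addrCA; congr (_ + (_ + _)); last by apply: eq_dropsum => // t _; rewrite cat_rcons.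
rewrite mulRE mulr_sumr raddf_sum /= (eq_bigr (fun k => (\sum_r
   (rhoz a k q r x * lam (evw E (v ++ u))) *+ (p == r)) *+ (b == k))).
  by rewrite sum_delta sum_delta.
move=> k _; rewrite mulr_sumr raddf_sum /= -sumrMnl; apply: eq_bigr => r _.
have -> : rho x.1.1 x.1.2 x.2 a k q r = (rhoz a k q r x)%:~R by rewrite rhoE.
rewrite mulrzl mulrzAr raddfMz IH; last by lia.
rewrite (@eq_dropsum _ (rhoz k b r p) _ (fun=> 0)) //; last first.
  by move=> t ht; rewrite lam0 // size_cat; lia.
rewrite dropsum0 addr0 [k == b]eq_sym [r == p]eq_sym -mulrzl mulrC.
case: (b == k); case: (p == r); rewrite ?mul1r ?mul0r ?mulr0n ?mulr1n ?mul0rn //=.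
by rewrite intz mulrC.
Qed.

End Step.

Definition wfun (w : seq letter) (A : pzRingType) (E : 'I_N -> 'I_N -> nat -> A)
  (lam : A -> int) :=
  (forall u, (size u < size w)%N -> lam (evw E u) = 0) /\
  (forall u, size u = size w -> lam (evw E u) = psi w u).

(** Stands in for the Poincare-Birkhoff-Witt theorem: the functional is blind to words shorter than
    [w] and sees words of the same length only through their multiset of letters. Each letter of [w]
    costs one more evaluation factor. *)
Lemma symbol_functional w : exists (A : pzRingType) (E : 'I_N -> 'I_N -> nat -> A)
  (lam : {additive A -> int}), lie_rep E /\ wfun w E lam.
Proof.
elim: w => [|x w [A [E [lam [hE [lam0 lamw]]]]]].
  exists int, (fun _ _ _ => 0), idfun; split=> [i j k l r s _ _|].
    by rewrite mulr0 subrr; do 2 case: ifP => //; rewrite subrr.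
  by split=> [//|[]// _]; rewrite /evw big_nil.
(* With this truncation order the entry of [rho] at (a, b) from u^0 to u^(x.2) is nonzero on the
   letter [x] only. *)
pose P := x.2.+1; pose q : 'I_P := ord_max; pose p : 'I_P := ord0.
pose a := x.1.1; pose b := x.1.2.
pose R := ('M['M[A]_P]_N * A)%type.
pose F i j n : R := (stepE E P i j n, E i j n).
have evF u : evw F u = (evw (stepE E P) u, evw E u).
  elim: u => [|y u IH]; first by rewrite /evw !big_nil.
  by rewrite !evw_cons IH.
pose c : int := ((a == b) && (q == p))%:Z.
(* The second component subtracts the contribution in which no letter goes to the new factor. *)
pose mu (X : R) : int := lam (X.1 a b q p) - c * lam X.2.
have muB : zmod_morphism mu.
  by move=> X Y; rewrite /mu !mxE !raddfB /=; ring.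
pose hmu := GRing.isZmodMorphism.Build R int mu muB.
pose mu' : {additive R -> int} := HB.pack mu hmu.
have muE u : (size u <= size w + 1)%N -> mu (evw F u) =
   dropsum (rhoz a b q p) (fun t => lam (evw E t)) u.
  move=> hu; rewrite evF /mu /=.
  have := @lam_step A E P lam (size w) lam0 [::] u a b q p.
  rewrite /evw big_nil mul1r -/(evw _ _) /= => ->; last by move: hu => /=; lia.
  by rewrite /c addrC addKr.
exists R, F, mu'; split.
  move=> i j k l r s g1 g2; rewrite /F.
  have h1 := @stepE_lie A E P hE i j k l r s g1 g2; have h2 := hE i j k l r s g1 g2.
  apply: (etrans (y := (stepE E P i j r * stepE E P k l s - stepE E P k l s * stepE E P i j r,
     E i j r * E k l s - E k l s * E i j r))); first by [].
  by rewrite h1 h2; case: ifP; case: ifP.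
have rz y : rhoz a b q p y = (y == x)%:Z.
  rewrite /rhoz leq0n subn0 letter_eqE /= /a /b.
  by rewrite (eq_sym x.1.1) (eq_sym x.1.2) (eq_sym x.2).
split=> u hu.
  apply: etrans (muE u _) _; first by move: hu => /=; lia.
  by rewrite (@eq_dropsum _ _ _ (fun=> 0) _ (fun _ => erefl)) ?dropsum0 // => t ht; rewrite lam0 //; move: hu => /=; lia.
apply: etrans (muE u _) _; first by move: hu => /= ->; lia.
rewrite /=; apply: eq_dropsum => // t ht; apply: lamw; move: hu => /=; lia.
Qed.

End Words.

Lemma perm_swap_ind (T : eqType) (Q : seq T -> seq T -> Prop) :
  (forall s, Q s s) -> (forall s t r, Q s t -> Q t r -> Q s r) ->
  (forall p a b q, Q (p ++ a :: b :: q) (p ++ b :: a :: q)) ->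
  forall s t, perm_eq s t -> Q s t.
Proof.
move=> Qr Qt Qs.
have front p q1 a q2 : Q (p ++ q1 ++ a :: q2) (p ++ a :: q1 ++ q2).
  elim: q1 p => [|b q1 IH] p //=.
  apply: Qt (Qs p b a (q1 ++ q2)).
  by have := IH (rcons p b); rewrite !cat_rcons.
suff H p s t : perm_eq s t -> Q (p ++ t) (p ++ s).
  by move=> s t; rewrite perm_sym => /(H [::]).
elim: s p t => [|a s IH] p t; first by move/perm_size; case: t.
move=> st; have at_ : a \in t by rewrite -(perm_mem st) mem_head.
case/splitPr: at_ st => t1 t2; rewrite perm_sym -[a :: t2]cat1s perm_catCA /= perm_cons perm_sym => st.
apply: Qt (front _ _ _ _) _.
by have := IH (rcons p a) _ st; rewrite !cat_rcons.
Qed.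

(** * Lowering derivations on functionals of words *)

Section Descent.
Variable N : nat.
Implicit Types (x y z a b : letter N) (u v w t : seq (letter N)).
Implicit Types (p : seq (letter N) -> int) (q : letter N -> int).

Definition good x := in_gplus x.1.1 x.1.2 x.2.

(* The transpose of the projected bracket with the lowering element [a]. *)
Definition adt a (q : letter N -> int) x : int :=
  (if x.1.1 == a.1.1 then q (a.1.2, x.1.2, x.2 + a.2)%N else 0)
  - (if x.1.2 == a.1.2 then q (x.1.1, a.1.1, x.2 + a.2)%N else 0).

(** The letter [a] = (i, j, n) stands for E_ij[n], while a letter of a word stands for E_ij[-n]; the
    bracket lowers the mode of a word, so its transpose [adt] adds modes. *)
Fixpoint nab a p w : int :=
  if w is x :: w' then adt a (fun z => p (z :: w')) x + nab a (fun t => p (x :: t)) w' else 0.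

Lemma adtB a q1 q2 x : adt a (fun z => q1 z - q2 z) x = adt a q1 x - adt a q2 x.
Proof. by rewrite /adt; case: ifP; case: ifP => _ _; ring. Qed.
Lemma adtD a q1 q2 x : adt a (fun z => q1 z + q2 z) x = adt a q1 x + adt a q2 x.
Proof. by rewrite /adt; case: ifP; case: ifP => _ _; ring. Qed.

Lemma nabD a p1 p2 w : nab a (fun t => p1 t + p2 t) w = nab a p1 w + nab a p2 w.
Proof. by elim: w p1 p2 => [|x w IH] p1 p2 //=; rewrite IH adtD; ring. Qed.
Lemma nabB a p1 p2 w : nab a (fun t => p1 t - p2 t) w = nab a p1 w - nab a p2 w.
Proof. by elim: w p1 p2 => [|x w IH] p1 p2 //=; rewrite IH adtB; ring. Qed.
Lemma nab0 a w : nab a (fun=> 0) w = 0.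
Proof. by elim: w => //= x w ->; rewrite /adt; case: ifP; case: ifP. Qed.

Lemma eq_nab1 a p p' w : p =1 p' -> nab a p w = nab a p' w.
Proof.
elim: w p p' => [|x w IH] p p' pp //=; congr (_ + _); last by apply: IH => t; apply: pp.
by rewrite /adt !pp.
Qed.

Lemma nab_adt a b (G : letter N -> seq (letter N) -> int) x w :
  nab a (fun t => adt b (fun z => G z t) x) w = adt b (fun z => nab a (G z) w) x.
Proof.
rewrite {1}/adt nabB /adt; congr (_ - _); case: ifP => _; by rewrite ?nab0.
Qed.

Definition brk a b (q : letter N -> int) : int :=
  (if a.1.2 == b.1.1 then q (a.1.1, b.1.2, a.2 + b.2)%N else 0)
  - (if a.1.1 == b.1.2 then q (b.1.1, a.1.2, a.2 + b.2)%N else 0).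

Lemma adt_comm a b q x : adt a (adt b q) x - adt b (adt a q) x = brk a b (fun c => adt c q x).
Proof.
case: a b x => [[a1 a2] a3] [[b1 b2] b3] [[x1 x2] x3]; rewrite /brk /adt /=.
have e1 : (x3 + a3 + b3)%N = (x3 + (a3 + b3))%N by lia.
have e2 : (x3 + b3 + a3)%N = (x3 + (a3 + b3))%N by lia.
rewrite !e1 !e2 [b2 == a1]eq_sym [b1 == a2]eq_sym.
by case: (x1 == a1); case: (x2 == a2); case: (x1 == b1); case: (x2 == b2); case: (a2 == b1); case: (a1 == b2); ring.
Qed.

Lemma nab_comm a b p w :
  nab a (nab b p) w - nab b (nab a p) w = brk a b (fun c => nab c p w).
Proof.
elim: w p => [|x w IH] p; first by rewrite /= subrr /brk /=; case: ifP; case: ifP.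
rewrite /=.
have E1 a' b' : nab a' (fun t => adt b' (fun z => p (z :: t)) x + nab b' (fun t' => p (x :: t')) t) w =
   adt b' (fun z => nab a' (fun t => p (z :: t)) w) x + nab a' (nab b' (fun t' => p (x :: t'))) w.
  by rewrite nabD (nab_adt a' b' (fun z t => p (z :: t))).
have E2 a' b' : adt a' (fun z => adt b' (fun y => p (y :: w)) z + nab b' (fun t => p (z :: t)) w) x =
   adt a' (adt b' (fun y => p (y :: w))) x + adt a' (fun z => nab b' (fun t => p (z :: t)) w) x.
  by rewrite adtD.
rewrite !E1 !E2.
have := IH (fun t => p (x :: t)); have := adt_comm a b (fun y => p (y :: w)) x.
rewrite /brk; case: ifP => _; case: ifP => _ h1 h2; lia.
Qed.

(** The basis vectors E_ij[n] of the loop algebra outside g^+; for them [adt] evaluates its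
    functional at good letters only, by [eq_adt]. *)
Definition neg a := (0 < a.2)%N || (a.1.2 < a.1.1)%N.

Lemma eq_adt a q q' x : neg a -> good x -> (forall z, good z -> q z = q' z) ->
  adt a q x = adt a q' x.
Proof.
move=> na gx qq; rewrite /adt; congr (_ - _); case: eqP => // e; apply: qq; move: na gx;
  rewrite /neg /good /in_gplus /= -?e; lia.
Qed.

Lemma eq_nab a p p' w : neg a -> all good w ->
  (forall t, all good t -> size t = size w -> p t = p' t) -> nab a p w = nab a p' w.
Proof.
move=> na; elim: w p p' => [|x w IH] p p' //= /andP[gx gw] pp; congr (_ + _).
  by apply: eq_adt => // z gz; apply: pp; rewrite //= gz.
by apply: IH => // t gt st; apply: pp; rewrite /= ?gx ?st.
Qed.

Section Kill.
Variables (p : seq (letter N) -> int) (d : nat).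
Definition kills a := forall w, all good w -> size w = d -> nab a p w = 0.

Lemma kills_brk a b w : neg a -> neg b -> kills a -> kills b -> all good w -> size w = d ->
  brk a b (fun c => nab c p w) = 0.
Proof.
move=> na nb ka kb gw sw; rewrite -nab_comm.
rewrite (@eq_nab a _ (fun=> 0)) // ?nab0; last by move=> t gt st; apply: kb; rewrite // st.
rewrite (@eq_nab b _ (fun=> 0)) // ?nab0 ?subrr //.
by move=> t gt st; apply: ka; rewrite // st.
Qed.

Hypothesis kill_simple : forall (k k' : 'I_N) (eps : bool), simple_root k k' eps ->
  kills (k', k, nat_of_bool eps).

Lemma kills_low (i j : 'I_N) : (j < i)%N -> kills (i, j, 0%N).
Proof.
move: {2}(i - j)%N (leqnn (i - j)) => n; elim: n i j => [|n IH] i j; first by lia.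
move=> hn ji; have [e|ne] := eqVneq (i : nat) j.+1.
  by apply: (kill_simple (eps := false)); rewrite /simple_root e.
have jN : (j.+1 < N)%N by have := ltn_ord i; lia.
pose c := Ordinal jN.
move=> w gw sw; have := @kills_brk (i, c, 0%N) (c, j, 0%N) w.
rewrite /brk /= eqxx addn0 -val_eqE /= gtn_eqF // subr0; apply=> //.
- by rewrite /neg /=; lia.
- by rewrite /neg /=; lia.
- by apply: IH; rewrite /=; lia.
- by apply: IH; rewrite /=; lia.
Qed.

Lemma kills_up1 (i j : 'I_N) : (i < j)%N -> kills (i, j, 1%N).
Proof.
move=> ij; have N0 : (0 < N)%N by have := ltn_ord i; lia.
have NN : (N.-1 < N)%N by lia.
pose o := Ordinal N0; pose l := Ordinal NN.
have k1 : kills (o, l, 1%N).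
  apply: (kill_simple (eps := true)); rewrite /simple_root /= eqxx andbT.
  by have := ltn_ord j; move: ij; lia.
have k2 : kills (o, j, 1%N).
  have [e|ne] := eqVneq j l; first by rewrite e.
  move=> w gw sw; have := @kills_brk (o, l, 1%N) (l, j, 0%N) w.
  rewrite /brk /= eqxx addn0 -(val_eqE o) /= ltn_eqF ?subr0; last by lia.
  have jl : (j < l)%N by move: ne; rewrite -val_eqE /=; have := ltn_ord j; lia.
  by apply => //; apply: kills_low.
have [e|ne] := eqVneq i o; first by rewrite e.
move=> w gw sw; have := @kills_brk (i, o, 0%N) (o, j, 1%N) w.
have oi : (o < i)%N by move: ne; rewrite -val_eqE /=; lia.
rewrite /brk /= ?eqxx add0n -(val_eqE i) /= ltn_eqF ?subr0 //.
by apply => //; apply: kills_low.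
Qed.

(** The simple root vectors generate brackets in sl_N rather than gl_N, so among the E_ii[1] only
    differences are shown to kill [p]. Bracketing with such a difference still raises the power of t
    in E_ij[m]. *)
Lemma kills_off (i j : 'I_N) n : i != j -> neg (i, j, n) -> kills (i, j, n).
Proof.
move=> ij.
have step (i' j' : 'I_N) m m' m1 : i' != j' -> (m1 + m' = 1)%N -> neg (i', j', m) ->
   neg (i', j', m1) -> neg (j', i', m') -> kills (i', j', m) ->
   kills (i', j', m1) -> kills (j', i', m') -> kills (i', j', m.+1).
  move=> ne m11 n1 n2 n3 k1 k2 k3 w gw sw.
  have kH t : all good t -> size t = d -> nab (i', i', 1%N) p t = nab (j', j', 1%N) p t.
    move=> gt st; have := kills_brk n2 n3 k2 k3 gt st.
    by rewrite /brk /= !eqxx m11; lia.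
  have nii (c : 'I_N) : neg (c, c, 1%N) by [].
  have h1 := nab_comm (i', i', 1%N) (i', j', m) p w.
  have h2 := nab_comm (j', j', 1%N) (i', j', m) p w.
  have e1 c : nab (c, c, 1%N) (nab (i', j', m) p) w = 0.
    rewrite (@eq_nab _ _ (fun=> 0)) ?nab0 // => t gt st.
    by apply: k1; rewrite // st.
  have e2 : nab (i', j', m) (nab (i', i', 1%N) p) w = nab (i', j', m) (nab (j', j', 1%N) p) w.
    by apply: eq_nab => // t gt st; apply: kH; rewrite // st.
  (* The two commutators have opposite right-hand sides and equal left-hand sides, so twice the
     derivation by E_ij[m+1] vanishes. *)
  move: h1 h2; rewrite /brk /= !eqxx !e1 e2 eq_sym [j' == i']eq_sym (negPf ne) add1n; lia.
have [ltij|ltji] : ((i < j) \/ (j < i))%N by move: ij; rewrite -val_eqE /=; lia.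
  case: n => [|n] ; first by rewrite /neg /=; lia.
  move=> _; elim: n => [|n IH]; first exact: kills_up1.
  apply: (step _ _ _ 0%N 1%N) => //; [exact: kills_up1|exact: kills_low].
move=> _; elim: n => [|n IH]; first exact: kills_low.
have nn m : neg (i, j, m) by rewrite /neg /= ltji orbT.
by apply: (step _ _ _ 1%N 0%N) => //; [exact: kills_low|exact: kills_up1].
Qed.

End Kill.
End Descent.
Arguments good {N} x.
Arguments neg {N} a.

(** * Vanishing of functionals killed by off-diagonal lowering *)

Section Vanishing.
Variable N : nat.
Implicit Types (x y z a b : letter N) (u v w t : seq (letter N)).
Implicit Types (p : seq (letter N) -> int) (q : letter N -> int).

Lemma sum_eq_count (T : eqType) (x : T) (s : seq T) : (\sum_(z <- s) (z == x) = count_mem x s)%N.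
Proof. by elim: s => [|y s IH]; rewrite ?big_nil // big_cons IH. Qed.

Lemma perm_swap (T : eqType) (s : seq T) (x y : T) : perm_eq (x :: y :: s) (y :: x :: s).
Proof. by apply/permP => f /=; rewrite addnCA. Qed.

Definition perm_inv p := forall u v, perm_eq u v -> p u = p v.

Lemma nab_perm a p w : perm_inv p ->
  nab a p w = \sum_(z <- w) adt a (fun y => p (y :: rem z w)) z.
Proof.
have eq_adt1 q q' z : q =1 q' -> adt a q z = adt a q' z by move=> qq; rewrite /adt !qq.
elim: w p => [|x w IH] p ip; first by rewrite big_nil.
rewrite big_cons /= eqxx; congr (_ + _); rewrite IH; last first.
  by move=> u v uv; apply: ip; rewrite perm_cons.
rewrite big_seq [RHS]big_seq; apply: eq_bigr => z zw; apply: eq_adt1 => y; apply: ip.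
rewrite -cat1s -[y :: rem z w]cat1s perm_catCA /= perm_cons; case: eqP => [->|_].
  by rewrite perm_sym perm_to_rem.
by rewrite perm_refl.
Qed.

Definition offd x := x.1.1 != x.1.2.

(* Induction on the number of off-diagonal letters, then downwards on the power of [t] in
   one of them, then on the multiplicity of [E_ii[0]]. *)
Lemma vanishing p d M : perm_inv p ->
  (forall i j n, i != j -> neg (i, j, n) -> kills p d (i, j, n)) ->
  (forall w, all good w -> size w = d -> ~~ has offd w -> p w = 0) ->
  (forall x w, (M < x.2)%N -> p (x :: w) = 0) ->
  forall w, all good w -> size w = d -> p w = 0.
Proof.
move=> ip kp p0 pM.
suff H k w : (count offd w <= k)%N -> all good w -> size w = d -> p w = 0.
  by move=> w; apply: (H (count offd w)).
elim: k w => [|k IH] w.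
  by rewrite leqn0 => /eqP c0 gw sw; apply: p0; rewrite // has_count c0.
move=> ck gw sw; have [/hasP[x xw ox]|no] := boolP (has offd w); last by apply: p0.
rewrite (ip _ _ (perm_to_rem xw)).
have gx : good x by apply: (allP gw).
have: all good (rem x w) by apply/allP => y /mem_rem; apply: (allP gw).
have: (size (rem x w)).+1 = d by rewrite -sw (perm_size (perm_to_rem xw)).
have: (count offd (rem x w) <= k)%N.
  by move: ck; rewrite (permP (perm_to_rem xw)) /= ox.
move: (rem x w) => {w xw gw sw ck}w.
case: x ox gx => [[i j] n]; rewrite /offd /= => ij gx.
move: {2}(M.+1 - n)%N (leqnn (M.+1 - n)) => e he.
elim: e n he gx w => [|e IHe] n he gx w; first by move=> *; rewrite pM //=; lia.
have [m hm] := ubnP (count_mem (i, i, 0%N) w).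
elim: m w hm => // m IHb w hb cw sw gw.
(* The derivation by E_ji[n], tested on [jj :: w], turns the added letter E_jj[0] into the letter
   (i, j, n) and so recovers the wanted value. Acting on a letter of [w], it gives that same value
   again if the letter is E_jj[0], and otherwise a term covered by one of the inductions. *)
pose a : letter N := (j, i, n); pose jj : letter N := (j, j, 0%N).
have na : neg a by move: gx ij; rewrite /good /in_gplus /neg -val_eqE /=; lia.
have gjj : good jj by rewrite /good /in_gplus /= leqnn.
have ka := kp j i n; rewrite eq_sym ij in ka.
have := ka isT na (jj :: w); rewrite /= gjj gw => /(_ isT sw).
rewrite /adt /= eqxx add0n eq_sym (negPf ij) subr0 nab_perm; last first.
  by move=> u v uv; apply: ip; rewrite perm_cons.
rewrite big_seq (eq_bigr (fun z => p ((i, j, n) :: w) *+ (z == jj))); last first.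
  move=> z zw; set r := rem z w.
  have pw : perm_eq w (z :: r) by rewrite perm_to_rem.
  have gz : good z by apply: (allP gw).
  have gr : all good r by apply/allP => y /mem_rem; apply: (allP gw).
  have sr : (size r).+2 = d by rewrite -sw (perm_size pw).
  have cr : (count offd w = offd z + count offd r)%N by rewrite (permP pw).
  have hz y : (count offd (y :: r) <= k)%N -> good y -> p (jj :: y :: r) = 0.
    by move=> h1 h2; apply: IH; rewrite /= ?gjj ?h2 ?gr ?sr // /jj {1}/offd /= eqxx.
  have hn n' y : y = (i, j, n') -> (n < n')%N -> offd z = false -> good y -> p (jj :: y :: r) = 0.
    move=> -> h1 h2 h3; rewrite (ip _ ((i, j, n') :: jj :: r)); last first.
      exact: perm_swap.
    apply: IHe => //=; rewrite ?gjj ?gr ?sr //; first by lia.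
    by rewrite eqxx; move: cw; rewrite cr h2.
  have zE : (z == jj) = [&& z.1.1 == j, z.1.2 == j & z.2 == 0%N] by rewrite letter_eqE.
  have [zd|zo] := boolP (offd z); last first.
    move: (zo); rewrite /offd negbK => /eqP z12; rewrite /adt /a /= zE.
    have [zj|nzj] := eqVneq z.1.1 j.
      rewrite -z12 zj eqxx [j == i]eq_sym (negPf ij) subr0 /=.
      case: (z.2 =P 0%N) => [z0|nz0].
        rewrite z0 add0n mulr1n; apply: ip.
        apply: perm_trans (perm_swap _ _ _) _; rewrite perm_cons perm_sym.
        by suff <- : z = jj by []; apply/eqP; rewrite zE -z12 zj eqxx z0.
      rewrite mulr0n; apply: (hn (z.2 + n)%N _ erefl); [by rewrite -[X in (X < _)%N]add0n ltn_add2r lt0n; apply/eqP|exact: negbTE|].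
      by rewrite /good /in_gplus /= addn_gt0 lt0n; apply/orP; left; apply/orP; left; apply/eqP.
    rewrite /= mulr0n -z12; have [zi|nzi] := eqVneq z.1.1 i; last by rewrite subr0.
    rewrite zi; case: (z.2 =P 0%N) => [z0|nz0].
      rewrite z0 add0n (ip _ _ (perm_swap _ _ _)) IHb ?subr0 //= ?gjj ?sr //.
      - move: hb; rewrite (permP pw) /= -ltnS.
        have -> : z == (i, i, 0%N) by rewrite letter_eqE /= -z12 zi z0 eqxx.
        by rewrite letter_eqE /= [j == i]eq_sym (negPf ij).
      - by move: cw; rewrite cr /jj {2}/offd /= eqxx (negPf zo).
    rewrite (hn (z.2 + n)%N _ erefl) ?subr0; [by []|by rewrite -[X in (X < _)%N]add0n ltn_add2r lt0n; apply/eqP|exact: negbTE|].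
    by rewrite /good /in_gplus /= addn_gt0 lt0n; apply/orP; left; apply/orP; left; apply/eqP.
  have -> : (z == jj) = false.
    rewrite zE; case: (z.1.1 =P j) => //= e1; case: (z.1.2 =P j) => //= e2.
    by move: zd; rewrite /offd e1 e2 eqxx.
  have hz' y : good y -> p (jj :: y :: r) = 0.
    move=> gy; apply: hz => //=; apply: leq_trans cw; rewrite cr zd.
    by rewrite leq_add2r; case: (offd y).
  rewrite /adt /a /= mulr0n.
  have -> : (if z.1.1 == j then p [:: jj, (i, z.1.2, (z.2 + n)%N) & r] else 0) = 0.
    case: eqP => // e1; apply: hz'.
    by move: gz gx; rewrite /good /in_gplus /= e1; clear; lia.
  rewrite sub0r.
  have -> : (if z.1.2 == i then p [:: jj, (z.1.1, j, (z.2 + n)%N) & r] else 0) = 0.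
    case: eqP => // e1; apply: hz'.
    by move: gz gx; rewrite /good /in_gplus /= e1; clear; lia.
  by rewrite oppr0.
(* The total is the wanted value times one plus the multiplicity of E_jj[0] in [w], so the value is
   zero. *)
rewrite -big_seq sumrMnr sum_eq_count.
set c := count _ _; rewrite -mulrS => /eqP; rewrite mulrn_eq0 /= => /eqP -> //.
Qed.
End Vanishing.

(** * The pairing of words and its derivations *)

Section Symbol.
Variable N : nat.
Implicit Types (x y z a b : letter N) (u v w t : seq (letter N)).
Implicit Types (f : letter N -> int) (g : seq (letter N) -> int).

Lemma dropsum_perm f g u : perm_inv g -> dropsum f g u = \sum_(z <- u) f z * g (rem z u).
Proof.
elim: u g => [|y u IH] g ig; first by rewrite big_nil.
rewrite big_cons /= eqxx; congr (_ + _); rewrite IH; last first.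
  by move=> s t st; apply: ig; rewrite perm_cons.
rewrite big_seq [RHS]big_seq; apply: eq_bigr => z zu; congr (_ * _); apply: ig.
case: eqP => [->|_]; last by rewrite perm_refl.
by rewrite perm_sym perm_to_rem.
Qed.

Lemma psi_perm w : perm_inv (psi w).
Proof.
elim: w => [|x w IH] u v uv.
  by rewrite /=; congr (_%:Z : int); have := perm_size uv; case: u {uv} => [|? ?]; case: v.
rewrite /= !dropsum_perm // (perm_big _ uv) /= big_seq [RHS]big_seq.
apply: eq_bigr => z zv; congr (_ * _); apply: IH.
have zu : z \in u by rewrite (perm_mem uv).
by rewrite -(perm_cons z) -(permPl (perm_to_rem zu)) perm_sym -(permPl (perm_to_rem zv)) perm_sym.
Qed.

Lemma psi_cons x w u : psi (x :: w) u = psi w (rem x u) *+ count_mem x u.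
Proof.
rewrite /= dropsum_perm; last exact: psi_perm.
rewrite (eq_bigr (fun z => psi w (rem x u) *+ (z == x))).
  by rewrite sumrMnr sum_eq_count.
by move=> z _; case: eqP => [->|_]; rewrite ?mul1r ?mul0r.
Qed.

Lemma psi_neq0 w u : psi w u != 0 -> perm_eq u w.
Proof.
elim: w u => [|x w IH] u; first by case: u.
rewrite psi_cons mulrn_eq0 negb_or -lt0n -has_count => /andP[+ /IH].
case/hasP=> z zu /eqP zx; subst z => h.
by rewrite (permPl (perm_to_rem zu)) perm_cons.
Qed.

Lemma psi_gt0 w : 0 < psi w w.
Proof.
by elim: w => [|x w IH] //; rewrite psi_cons /= eqxx pmulrn_lgt0.
Qed.

Lemma psi_perml u : perm_inv (fun w => psi w u).
Proof.
move=> w w' ww; move: w w' ww u; apply: perm_swap_ind => [//|w1 w2 w3 h1 h2 u|s a b t u].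
  by rewrite h1.
elim: s u => [|x s IH] u; last by rewrite !cat_cons !psi_cons IH.
rewrite /= -/(psi (a :: b :: t) u) -/(psi (b :: a :: t) u) !psi_cons -!mulrnA.
have [->|ab] := eqVneq a b; first by [].
have -> : psi t (rem b (rem a u)) = psi t (rem a (rem b u)).
  congr psi; elim: u => //= y u IHu.
  case ya: (y == a); case yb: (y == b) => /=; rewrite ?ya ?yb ?IHu //.
  by rewrite -(eqP ya) (eqP yb) eqxx in ab.
congr (_ *+ _).
have cr x y : x != y -> count_mem x (rem y u) = count_mem x u.
  by move=> xy; rewrite count_rem /= [y == x]eq_sym (negPf xy) andbF subn0.
by rewrite (cr b a) 1?eq_sym // (cr a b) // mulnC.
Qed.

Section Der.
Variables (k k' : 'I_N) (eps : bool).
Hypothesis kk' : simple_root k k' eps.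

(** The part of the bracket with f that preserves word length; the character and the central
    constant shorten words and do not appear. *)
Definition fder f y : int :=
  (if [&& y.1.1 == k, (eps <= y.2)%N & in_gplus k' y.1.2 (y.2 - eps)]
   then f (k', y.1.2, (y.2 - eps)%N) else 0)
  - (if [&& y.1.2 == k', (eps <= y.2)%N & in_gplus y.1.1 k (y.2 - eps)]
   then f (y.1.1, k, (y.2 - eps)%N) else 0).

Fixpoint ddr g u : int :=
  if u is y :: u' then fder (fun z => g (z :: u')) y + ddr (fun t => g (y :: t)) u' else 0.

Lemma fderD f1 f2 y : fder (fun z => f1 z + f2 z) y = fder f1 y + fder f2 y.
Proof. by rewrite /fder; case: ifP; case: ifP => _ _; ring. Qed.

Lemma ddrD g1 g2 u : ddr (fun t => g1 t + g2 t) u = ddr g1 u + ddr g2 u.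
Proof. by elim: u g1 g2 => [|y u IH] g1 g2 //=; rewrite IH fderD; ring. Qed.

Lemma ddrZ c g u : ddr (fun t => c * g t) u = c * ddr g u.
Proof.
elim: u g => [|y u IH] g /=; first by rewrite mulr0.
by rewrite IH mulrDr; congr (_ + _); rewrite /fder; case: ifP; case: ifP => _ _; ring.
Qed.

Lemma eq_ddr g g' u : (forall t, size t = size u -> g t = g' t) -> ddr g u = ddr g' u.
Proof.
elim: u g g' => [|y u IH] g g' gg //=; congr (_ + _); last first.
  by apply: IH => t st; apply: gg; rewrite /= st.
by rewrite /fder; congr (_ - _); case: ifP => // _; apply: gg.
Qed.

Lemma ddr0 u : ddr (fun=> 0) u = 0.
Proof. by elim: u => //= y u ->; rewrite /fder; case: ifP; case: ifP. Qed.

Lemma dropsumD f g1 g2 u : dropsum f (fun t => g1 t + g2 t) u = dropsum f g1 u + dropsum f g2 u.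
Proof. by elim: u g1 g2 => [|y u IH] g1 g2 //=; rewrite IH; ring. Qed.

Lemma dropsumBr f g1 g2 u : dropsum f (fun t => g1 t - g2 t) u = dropsum f g1 u - dropsum f g2 u.
Proof. by elim: u g1 g2 => [|y u IH] g1 g2 //=; rewrite IH; ring. Qed.

Lemma ddr_dropsum f g u :
  ddr (dropsum f g) u = dropsum (fder f) g u + dropsum f (ddr g) u.
Proof.
elim: u g => [|y u IH] g //=.
rewrite fderD ddrD ddrZ IH dropsumD.
have -> : fder (fun z => f z * g u) y = fder f y * g u.
  by rewrite /fder; case: ifP; case: ifP => _ _; ring.
have -> : fder (fun z => dropsum f (fun t => g (z :: t)) u) y =
   dropsum f (fun t => fder (fun z => g (z :: t)) y) u.
  by rewrite /fder dropsumBr; case: ifP; case: ifP => _ _; rewrite ?dropsum0.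
ring.
Qed.

Local Notation fa := ((k', k, nat_of_bool eps) : letter N).

Lemma fder_adt x y : good x -> fder (fun z => (z == x)%:Z) y = adt fa (fun z => (y == z)%:Z) x.
Proof.
case: x y => [[x1 x2] x3] [[y1 y2] y3]; rewrite /good /fder /adt /= => gx.
have ifb (b c : bool) : (if b then c%:Z else 0) = (b && c)%:Z by case: b.
rewrite !ifb !letter_eqE /=; congr (_%:Z - _%:Z); congr nat_of_bool; apply/idP/idP.
- case/andP=> /and3P[/eqP -> h1 h2] /and3P[/eqP <- /eqP -> /eqP <-].
  by rewrite !eqxx /= subnK.
- case/andP=> /eqP e1 /and3P[/eqP -> /eqP -> /eqP ->]; subst x1.
  by rewrite !eqxx leq_addl addnK gx eqxx.
- case/andP=> /and3P[/eqP -> h1 h2] /and3P[/eqP -> /eqP <- /eqP <-].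
  by rewrite !eqxx /= subnK.
- case/andP=> /eqP e1 /and3P[/eqP -> /eqP -> /eqP ->]; subst x2.
  by rewrite !eqxx leq_addl addnK gx eqxx.
Qed.

Lemma dropsumB f1 f2 g u : dropsum (fun y => f1 y - f2 y) g u = dropsum f1 g u - dropsum f2 g u.
Proof. by elim: u g => [|y u IH] g //=; rewrite IH; ring. Qed.

Lemma dropsum0l g u : dropsum (fun=> 0) g u = 0.
Proof. by elim: u g => [|y u IH] g //=; rewrite IH mul0r. Qed.

Lemma dropsum_adt q x g u (G : letter N -> letter N -> int) :
  dropsum (fun y => adt q (G y) x) g u = adt q (fun z => dropsum (fun y => G y z) g u) x.
Proof.
by rewrite /adt dropsumB; congr (_ - _); case: ifP => _; rewrite ?dropsum0l.
Qed.

Lemma dropsum_nab q f (G : seq (letter N) -> seq (letter N) -> int) w u :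
  dropsum f (fun t => nab q (fun w' => G w' t) w) u = nab q (fun w' => dropsum f (G w') u) w.
Proof.
elim: w G => [|x w IH] G /=; first exact: dropsum0.
rewrite dropsumD IH; congr (_ + _); rewrite /adt.
elim: u G {IH} => [|y u IHu] G /=; first by case: ifP; case: ifP.
rewrite (IHu (fun w' t => G w' (y :: t))); case: ifP; case: ifP => _ _; ring.
Qed.

(** The bracket with f and its transpose are adjoint for the pairing [psi]. The Leibniz rule
    [ddr_dropsum] reduces this to single letters, where it is [fder_adt]. *)
Lemma ddr_psi w u : all good w -> ddr (psi w) u = nab fa (fun w' => psi w' u) w.
Proof.
elim: w u => [|x w IH] u gw.
  rewrite /=; elim: u => [|y u IHu] //=.
  rewrite -[RHS](ddr0 u) -[RHS]add0r; congr (_ + _); first by rewrite /fder; case: ifP; case: ifP.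
case/andP: gw => gx gw; rewrite /= ddr_dropsum.
rewrite (eq_dropsum (f' := fun y => adt fa (fun z => (y == z)%:Z) x) (g' := psi w)) //; last first.
  by move=> y; apply: fder_adt.
rewrite dropsum_adt; congr (_ + _).
rewrite (eq_dropsum (f' := fun y => (y == x)%:Z) (g' := fun t => nab fa (fun w' => psi w' t) w)) //.
  by rewrite dropsum_nab.
by move=> t _; apply: IH.
Qed.

End Der.
End Symbol.

(** * Leading symbols of singular combinations *)

Section DescentStep.
Variable N : nat.
Implicit Types (x y z : letter N) (u v w t : seq (letter N)) (s : seq (int * seq (letter N))).

Section Functional.
Variables (A : pzRingType) (E : 'I_N -> 'I_N -> nat -> A) (k k' : 'I_N) (eps : bool).
Let E2 := froot_ext E k k' eps.

Lemma evw_ext11 u : (evw E2 u) 1 0 = 0 /\ (evw E2 u) 1 1 = evw E u.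
Proof.
elim: u => [|y u [h0 h1]]; first by rewrite /evw !big_nil !mxE.
by rewrite !evw_cons !mulmx22E h0 h1 /evx !mxE /= !mul0r !add0r mulr0.
Qed.

Variables (lam : {additive A -> int}) (d : nat).
Hypothesis lam0 : forall u, (size u < d)%N -> lam (evw E u) = 0.

(** Modulo shorter words, which [lam] kills, taking the corner entry is a derivation: the twist by
    the character and the central constant both lower the length. *)
Lemma lam_der v u : (size v + size u <= d)%N ->
  lam (evw E v * (evw E2 u) 0 1) = ddr k k' eps (fun t => lam (evw E (v ++ t))) u.
Proof.
elim: u v => [|y u IH] v hs; first by rewrite /evw big_nil mxE mulr0 raddf0.
rewrite evw_cons mulmx22E (evw_ext11 u).2 /= in hs *.
have -> : evx E2 y 0 0 = evx E y + (froot_char k k' y.1.1 y.1.2 y.2)%:~R by rewrite /evx mxE.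
have -> : evx E2 y 0 1 = froot_der E k k' eps y.1.1 y.1.2 y.2 by rewrite /evx mxE.
rewrite mulrDl !mulrDr mulrA mulrzl mulrzAr !raddfD raddfMz /=.
have -> : evw E v * evx E y = evw E (rcons v y) by rewrite -cats1 evw_cat /evw big_seq1.
rewrite (IH (rcons v y)); last by rewrite size_rcons; lia.
rewrite (IH v); last by lia.
rewrite (@eq_ddr _ _ _ _ (fun t => lam (evw E (v ++ t))) (fun=> 0)); last first.
  by move=> t ht; rewrite lam0 // size_cat; lia.
rewrite ddr0 mul0rz addr0 addrC; congr (_ + _); last first.
  by apply: eq_ddr => t _; rewrite cat_rcons.
rewrite /froot_der !mulrBl !mulrBr !raddfB /=.
set c := lam (evw E v * (_ * _)).
have ec : lam (evw E v * ((if [&& eps, y.1.1 == k, y.1.2 == k' & y.2 == 1%N] then N%:R else 0) * evw E u)) = 0.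
  case: ifP => _; last by rewrite mul0r mulr0 raddf0.
  by rewrite mulr_natl mulrnAr raddfMn /= -evw_cat lam0 ?mul0rn // size_cat; lia.
rewrite ec subr0 /c /fder /emask; congr (_ - _).
  case: (y.1.1 == k); rewrite /= ?mul0r ?mulr0 ?raddf0 //.
  case: (eps <= y.2)%N; rewrite /= ?mul0r ?mulr0 ?raddf0 //.
  by case: ifP => _; rewrite ?mul0r ?mulr0 ?raddf0 // evw_cat evw_cons.
case: (y.1.2 == k'); rewrite /= ?mul0r ?mulr0 ?raddf0 //.
case: (eps <= y.2)%N; rewrite /= ?mul0r ?mulr0 ?raddf0 //.
by case: ifP => _; rewrite ?mul0r ?mulr0 ?raddf0 // evw_cat evw_cons.
Qed.
End Functional.

Definition singular s := forall (A : pzRingType) (E : 'I_N -> 'I_N -> nat -> A), lie_rep E ->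
  forall k k' eps, simple_root k k' eps -> (evl (froot_ext E k k' eps) s) 0 1 = 0.

Definition symb d s w : int := \sum_(c <- s | size c.2 == d) c.1 * psi w c.2.

(** The functional attached to the test word [w] is applied to the vanishing corner entry, and
    [ddr_psi] moves the derivation from the words of [s] to [w]. *)
Lemma symb_kills d s k k' eps : simple_root k k' eps -> singular s ->
  all (fun c => size c.2 <= d)%N s -> kills (symb d s) d (k', k, nat_of_bool eps).
Proof.
move=> kk' sg hs w gw sw.
have [A [E [lam [hE [lam0 lamw]]]]] := symbol_functional w.
have := sg A E hE k k' eps kk'; rewrite /evl summxE => /(congr1 lam); rewrite raddf0 raddf_sum /= => h.
rewrite sw in lam0 lamw.
have ns (c : int) (F : seq (letter N) -> int) w' : nab (k', k, nat_of_bool eps) (fun t => c * F t) w' = c * nab (k', k, nat_of_bool eps) F w'.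
  elim: w' F => [|x w' IH] F /=; first by rewrite mulr0.
  by rewrite IH mulrDr; congr (_ + _); rewrite /adt; case: ifP; case: ifP => _ _; ring.
rewrite -[RHS]h /symb.
have -> : nab (k', k, nat_of_bool eps) (fun w' => \sum_(c <- s | size c.2 == d) c.1 * psi w' c.2) w =
  \sum_(c <- s | size c.2 == d) c.1 * nab (k', k, nat_of_bool eps) (fun w' => psi w' c.2) w.
  elim: s {hs h sg} => [|c s IH].
    rewrite big_nil -[RHS](nab0 (k', k, nat_of_bool eps) w); apply: eq_nab1 => t; by rewrite big_nil.
  rewrite big_cons -IH; case: ifP => sc.
    by rewrite -ns -nabD; apply: eq_nab1 => t; rewrite big_cons sc.
  by apply: eq_nab1 => t; rewrite big_cons sc.
rewrite big_mkcond /= big_seq [RHS]big_seq; apply: eq_bigr => c cs.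
have EZ (Y : 'M[A]_2) (z : int) : (Y *~ z) 0 1 = Y 0 1 *~ z.
  by case: z => n; rewrite ?NegzE ?mulrNz -!pmulrn ?mxE mulmxnE.
have hc : (size c.2 <= d)%N by apply: (allP hs).
have := @lam_der A E k k' eps lam d lam0 [::] c.2.
rewrite /= add0n => /(_ hc); rewrite /evw big_nil mul1r -/(evw _ _) => hl.
rewrite EZ raddfMz hl -mulrzl intz.
case: eqP => sc; last first.
  rewrite (@eq_ddr _ _ _ _ _ (fun=> 0)) ?ddr0 ?mulr0 // => t ht.
  by rewrite -/(evw _ _) lam0 //; move: hc sc; rewrite -ht; lia.
congr (_ * _); rewrite -ddr_psi //; apply: eq_ddr => t ht.
by rewrite -/(evw _ _) lamw // ht.
Qed.

Definition lower x := (x.1.2 < x.1.1)%N.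
Definition upper x := (x.1.1 < x.1.2)%N.
(** This shape survives, up to corrections of the same shape, reordering between two such words as
    well as multiplication by diagonal letters and by one another. The lower first letter keeps
    purely diagonal words out of the symbol. *)
Definition kword w := all good w && (if w is x :: w' then lower x && upper (last x w') else false).
Definition ksmall d (c : int * seq (letter N)) := kword c.2 && (size c.2 < d)%N.

Lemma symb_vanish d s w : singular s -> all (ksmall d.+1) s -> all good w -> size w = d ->
  symb d s w = 0.
Proof.
move=> sg hs gw sw.
have hs' : all (fun c => size c.2 <= d)%N s.
  by apply/allP => c /(allP hs) /andP[_]; rewrite ltnS.
pose M := (\max_(c <- s) \max_(x <- c.2) x.2)%N.
have hM c x : c \in s -> x \in c.2 -> (x.2 <= M)%N.
  move=> cs xc; apply: (bigmaxn_sup_seq c) => //; exact: (bigmaxn_sup_seq x).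
apply: (@vanishing N (symb d s) d M) gw sw => //.
- by move=> u v uv; apply: eq_bigr => c _; rewrite (psi_perml _ uv).
- move=> i j n; apply: kills_off => k k' eps kk'; exact: symb_kills.
- move=> t gt st nt; rewrite /symb big_seq_cond big1 // => c /andP[cs _].
  have [->|] := eqVneq (psi t c.2) 0; first by rewrite mulr0.
  move/psi_neq0 => pt; case/negP: nt; have /andP[/andP[_ kc] _] := allP hs _ cs.
  case: (c.2) kc pt => // x w' /andP[lx _] pt; apply/hasP; exists x.
    by rewrite -(perm_mem pt) mem_head.
  by rewrite /offd; move: lx; rewrite /lower -val_eqE /=; lia.
- move=> x t hx; rewrite /symb big_seq_cond big1 // => c /andP[cs _].
  have [->|] := eqVneq (psi (x :: t) c.2) 0; first by rewrite mulr0.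
  move/psi_neq0 => pt; have := hM c x cs; rewrite (perm_mem pt) mem_head => /(_ isT).
  by rewrite leqNgt hx.
Qed.

End DescentStep.

(** * Reordering of words and descent on the degree *)

Section Descent.
Variable N : nat.
Implicit Types (x y z a b : letter N) (p q u v w m : seq (letter N)) (s : seq (int * seq (letter N))).

Section Evl.
Variables (A : pzRingType) (E : 'I_N -> 'I_N -> nat -> A).
Lemma evl_cat s1 s2 : evl E (s1 ++ s2) = evl E s1 + evl E s2.
Proof. by rewrite /evl big_cat. Qed.
Lemma evl_cons c s : evl E (c :: s) = evw E c.2 *~ c.1 + evl E s.
Proof. by rewrite /evl big_cons. Qed.
Lemma evl_nil : evl E [::] = 0.
Proof. by rewrite /evl big_nil. Qed.
Definition scalel (z : int) s := [seq (z * c.1, c.2) | c <- s].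
Lemma evl_scale (z : int) s : evl E (scalel z s) = evl E s *~ z.
Proof.
rewrite /evl big_map mulrz_suml; apply: eq_bigr => c _ /=.
by rewrite mulrC mulrzA.
Qed.
End Evl.

Definition brks a b p q : seq (int * seq (letter N)) :=
  (if a.1.2 == b.1.1 then [:: (1 : int, p ++ (a.1.1, b.1.2, (a.2 + b.2)%N) :: q)] else [::]) ++
  (if a.1.1 == b.1.2 then [:: (-1 : int, p ++ (b.1.1, a.1.2, (a.2 + b.2)%N) :: q)] else [::]).

Lemma evw_swap (A : pzRingType) (E : 'I_N -> 'I_N -> nat -> A) a b p q :
  lie_rep E -> good a -> good b ->
  evw E (p ++ a :: b :: q) = evw E (p ++ b :: a :: q) + evl E (brks a b p q).
Proof.
move=> hE ga gb; rewrite !evw_cat !evw_cons !mulrA.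
have -> : evl E (brks a b p q) = evw E p *
   (E a.1.1 b.1.2 (a.2 + b.2)%N *+ (a.1.2 == b.1.1) - E b.1.1 a.1.2 (a.2 + b.2)%N *+ (a.1.1 == b.1.2)) * evw E q.
  rewrite /brks evl_cat; case: eqP => _; case: eqP => _; rewrite ?evl_cons ?evl_nil /= ?mulr1z ?mulrN1z ?evw_cat ?evw_cons;
    rewrite ?mulr1n ?mulr0n ?/(evx _ _) /=; rewrite /evx /=; ncring.
have hab : evx E a * evx E b = evx E b * evx E a + E a.1.1 b.1.2 (a.2 + b.2)%N *+ (a.1.2 == b.1.1)
   - E b.1.1 a.1.2 (a.2 + b.2)%N *+ (a.1.1 == b.1.2) := hEn hE ga gb.
by rewrite -[evw E p * evx E a * evx E b]mulrA hab; ncring.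
Qed.

Lemma good_brk a b : good a -> good b -> a.1.2 = b.1.1 -> good (a.1.1, b.1.2, (a.2 + b.2)%N).
Proof.
case: a b => [[a1 a2] a3] [[b1 b2] b3]; rewrite /good /in_gplus /= => h1 h2 e; subst a2.
by move: h1 h2; clear; lia.
Qed.

Definition keq d u u' := exists s, all (ksmall d) s /\
  forall (A : pzRingType) (E : 'I_N -> 'I_N -> nat -> A), lie_rep E -> evw E u = evw E u' + evl E s.

Lemma keq_refl d u : keq d u u.
Proof. by exists [::]; split=> // A E _; rewrite evl_nil addr0. Qed.

Lemma keq_trans d u v w : keq d u v -> keq d v w -> keq d u w.
Proof.
move=> [s1 [h1 e1]] [s2 [h2 e2]]; exists (s1 ++ s2); split; first by rewrite all_cat h1 h2.
by move=> A E hE; rewrite (e1 A E hE) (e2 A E hE) evl_cat; ncring.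
Qed.

Lemma all_scale d (z : int) s : all (ksmall d) s -> all (ksmall d) (scalel z s).
Proof. by move=> h; rewrite /scalel all_map; apply: sub_all h. Qed.

(** When the swap touches an end of the word, both letters are of the type required at that end, and
    then so is their bracket; the correction words keep the shape. *)
Lemma keq_swap p a b q : kword (p ++ a :: b :: q) -> kword (p ++ b :: a :: q) ->
  keq (size (p ++ a :: b :: q)) (p ++ a :: b :: q) (p ++ b :: a :: q).
Proof.
move=> k1 k2.
have [ga gb gp gq] : [/\ good a, good b, all good p & all good q].
  by move: k1; rewrite /kword all_cat /= => /andP[/and4P[-> -> -> ->] _].
exists (brks a b p q); split; last by move=> A E hE; apply: evw_swap.
have H a' b' : good a' -> good b' -> kword (p ++ a' :: b' :: q) -> kword (p ++ b' :: a' :: q) ->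
  a'.1.2 = b'.1.1 -> ksmall (size (p ++ a :: b :: q)) (1, p ++ (a'.1.1, b'.1.2, (a'.2 + b'.2)%N) :: q)
  /\ ksmall (size (p ++ a :: b :: q)) (-1, p ++ (a'.1.1, b'.1.2, (a'.2 + b'.2)%N) :: q).
  move=> ga' gb' h1 h2 e; rewrite /ksmall /= !size_cat /= ltn_add2l ltnSn !andbT.
  suff -> : kword (p ++ (a'.1.1, b'.1.2, (a'.2 + b'.2)%N) :: q) by [].
  move: h1 h2; rewrite /kword !all_cat /= gp gq ga' gb' (good_brk ga' gb' e) /=.
  case: p {k1 k2 gp} => [|x p] /=.
    case/andP=> la lq /andP[lb lq'].
    case: q lq lq' {gq} => [|y q] /= lq lq'; first by move: lb lq; rewrite /lower /upper; lia.
    rewrite lq andbT; move: la lb; rewrite /lower /= e; lia.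
  case/andP=> lx; rewrite lx /= !last_cat /=; case: q {gq} => [|y q] //= lq lq'.
  by move: lq lq'; rewrite /upper /= e; lia.
rewrite /brks all_cat; apply/andP; split; case: eqP => //= e; rewrite andbT.
  by have [] := H a b ga gb k1 k2 e.
by have [] := H b a gb ga k2 k1 (esym e); rewrite addnC.
Qed.

Lemma keq_mid x y m m' : all good m -> good x -> good y -> lower x -> upper y ->
  perm_eq m m' -> keq (size m).+2 (x :: rcons m y) (x :: rcons m' y).
Proof.
move=> gm gx gy lx uy pm.
have kw n : all good n -> kword (x :: rcons n y).
  by move=> gn; rewrite /kword /= gx all_rcons gy gn lx last_rcons uy.
pose Q (n n' : seq (letter N)) := all good n ->
   all good n' /\ keq (size n).+2 (x :: rcons n y) (x :: rcons n' y) /\ size n = size n'.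
suff: Q m m' by move=> /(_ gm) [_ []].
apply: (perm_swap_ind (Q := Q)) pm => [n gn|n1 n2 n3 h1 h2 g1|p a b q g1].
- by split=> //; split=> //; apply: keq_refl.
- have [g2 [k12 s12]] := h1 g1; have [g3 [k23 s23]] := h2 g2.
  split=> //; split; last by rewrite s12.
  by apply: keq_trans k12 _; rewrite s12.
- have g2 : all good (p ++ b :: a :: q) by move: g1; rewrite !all_cat /= [good a && _]andbCA.
  split=> //; split; last by rewrite !size_cat.
  have := @keq_swap (x :: p) a b (rcons q y); rewrite /= -!rcons_cons -!rcons_cat.
  move=> /(_ (kw _ g1) (kw _ g2)); congr keq; rewrite size_rcons !size_cat /=; lia.
Qed.

(** The letter wanted in front is first brought to second place by [keq_mid] and then swapped with
    the head, both being lower. The last letter is treated in the same way among upper letters, and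
    [keq_mid] arranges the interior. *)
Lemma keq_perm u v : kword u -> kword v -> perm_eq u v -> keq (size u) u v.
Proof.
case: u => // x u ku; case: v => [|x' v] kv; first by move/perm_size.
case/lastP: u ku => [|m y] ku.
  by move: ku; rewrite /kword /= /lower /upper; lia.
case/lastP: v kv => [|m' y'] kv.
  by move: kv; rewrite /kword /= /lower /upper; lia.
have /andP[/= /andP[gx]] := ku; rewrite all_rcons last_rcons => /andP[gy gm] /andP[lx uy].
have /andP[/= /andP[gx']] := kv; rewrite all_rcons last_rcons => /andP[gy' gm'] /andP[lx' uy'].
move=> pe; rewrite /= size_rcons.
have sz : size m = size m' by have := perm_size pe; rewrite /= !size_rcons => -[].
have xy : x == y' = false by apply/eqP => e; move: lx uy'; rewrite e /lower /upper; clear; lia.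
have xy' : x' == y = false by apply/eqP => e; move: lx' uy; rewrite e /lower /upper; clear; lia.
have Hfirst : exists n, [/\ keq (size m).+2 (x :: rcons m y) (x' :: rcons n y), all good n,
    size n = size m & perm_eq (rcons n y) (rcons m' y')].
  have [e|ne] := eqVneq x x'.
    exists m; split=> //; first by rewrite -e; apply: keq_refl.
    by move: pe; rewrite e perm_cons.
  have x'm : x' \in m.
    have: x' \in x :: rcons m y by rewrite (perm_mem pe) mem_head.
    by rewrite inE mem_rcons inE eq_sym (negPf ne) xy'.
  have pm := perm_to_rem x'm; set r := rem x' m in pm.
  have gr : all good r by apply/allP => z /mem_rem; apply: (allP gm).
  exists (x :: r); split; last 1 first.
  - rewrite -(perm_cons x') -(permPr pe) /=.
    apply: perm_trans (perm_swap _ _ _) _; rewrite perm_cons -rcons_cons.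
    by rewrite -!cats1 perm_cat2r perm_sym.
  - have k1 := keq_mid gm gx gy lx uy pm.
    apply: keq_trans k1 _; rewrite rcons_cons.
    have := @keq_swap [::] x x' (rcons r y); rewrite /= size_rcons.
    have -> : (size r).+3 = (size m).+2 by rewrite (perm_size pm).
    by apply; rewrite /kword /= !all_rcons gx gx' gy gr ?lx ?lx' last_rcons uy.
  - by rewrite /= gx gr.
  - by rewrite (perm_size pm).
case: Hfirst => n [k1 gn sn pn]; apply: keq_trans k1 _; rewrite -sn in sz *.
have [e|ne] := eqVneq y y'.
  subst y'; apply: keq_mid => //.
  by move: pn; rewrite -!cats1 perm_cat2r.
have y'n : y' \in n.
  have: y' \in rcons n y by rewrite (perm_mem pn) mem_rcons mem_head.
  by rewrite mem_rcons inE eq_sym (negPf ne).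
have pm := perm_to_rem y'n; set r := rem y' n in pm.
have gr : all good r by apply/allP => z /mem_rem; apply: (allP gn).
have pm' : perm_eq n (rcons r y') by rewrite perm_sym perm_rcons perm_sym.
have k1 := keq_mid gn gx' gy lx' uy pm'; apply: keq_trans k1 _.
have k2 : keq (size n).+2 (x' :: rcons (rcons r y') y) (x' :: rcons (rcons r y) y').
  have := @keq_swap (x' :: r) y' y [::].
  rewrite -!cats1 -!catA /= size_cat /= addn2 (perm_size pm).
  by apply; rewrite /kword /= all_cat /= gx' gr gy gy' lx' last_cat /= ?uy ?uy'.
apply: keq_trans k2 _.
have -> : (size n).+2 = (size (rcons r y)).+2 by rewrite size_rcons (perm_size pm).
apply: keq_mid => //; first by rewrite all_rcons gy gr.
have: perm_eq (rcons (rcons r y') y) (rcons m' y').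
  by apply: perm_trans pn; rewrite -!(cats1 _ y) perm_cat2r perm_sym.
move=> h; rewrite -(perm_cat2r [:: y']) !cats1; apply: perm_trans h.
by rewrite -!cats1 -!catA perm_cat2l; apply: perm_swap.
Qed.

(** All words of a permutation class are rewritten on one representative, whose total coefficient is
    zero; only the shorter corrections remain. *)
Lemma top_reduce d s : all (fun c => kword c.2 && (size c.2 == d)) s ->
  (forall w, kword w -> size w = d -> \sum_(c <- s | perm_eq c.2 w) c.1 = 0) ->
  exists s', all (ksmall d) s' /\
  forall (A : pzRingType) (E : 'I_N -> 'I_N -> nat -> A), lie_rep E -> evl E s = evl E s'.
Proof.
have [n] := ubnP (size s); elim: n s => // n IH [|c0 s0] hn hs h0.
  by exists [::]; split=> //.
set s := c0 :: s0 in hn hs h0 *; set w := c0.2.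
have /andP[kw /eqP sw] : kword w && (size w == d) by case/andP: hs.
pose s1 := [seq c <- s | perm_eq c.2 w]; pose s2 := [seq c <- s | ~~ perm_eq c.2 w].
have [|||s2' [hs2' e2]] := IH s2.
- rewrite /s2 /s /= perm_refl /=; apply: leq_ltn_trans (_ : (size s0 < n)%N); last by [].
  by rewrite size_filter count_size.
- by apply/allP => c; rewrite mem_filter => /andP[_]; apply: (allP hs).
- move=> v kv sv; have [vw|nvw] := boolP (perm_eq v w).
    rewrite /s2 big_filter_cond big1 // => c /andP[/negP nc cv]; case: nc.
    exact: perm_trans cv vw.
  rewrite -[RHS](h0 v kv sv) /s2 big_filter_cond; apply: eq_bigl => c.
  apply/andP/idP => [[]//|cv]; split=> //.
  by apply: contra nvw => cw; rewrite perm_sym in cv; apply: perm_trans cv cw.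
have H1 : exists s1', all (ksmall d) s1' /\
  forall (A : pzRingType) (E : 'I_N -> 'I_N -> nat -> A), lie_rep E ->
    evl E s1 = evw E w *~ (\sum_(c <- s1) c.1) + evl E s1'.
  have: all (fun c => [&& kword c.2, size c.2 == d & perm_eq c.2 w]) s1.
    by apply/allP => c; rewrite mem_filter => /andP[cw /(allP hs) /andP[-> ->]].
  elim: s1 => [|c s1 IH1].
    by exists [::]; split=> // A E _; rewrite !evl_nil big_nil mulr0z addr0.
  case/andP=> /and3P[kc /eqP sc cw] /IH1 [s1' [h1 e1]].
  have [s3 [h3 e3]] := keq_perm kc kw cw; rewrite sc in h3.
  exists (scalel c.1 s3 ++ s1'); split; first by rewrite all_cat h1 all_scale.
  move=> A E hE; rewrite evl_cons (e1 A E hE) (e3 A E hE) big_cons evl_cat evl_scale mulrzDr mulrzDl.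
  by ncring.
case: H1 => s1' [hs1' e1]; exists (s1' ++ s2'); split; first by rewrite all_cat hs1'.
move=> A E hE; rewrite evl_cat -(e2 A E hE).
have -> : evl E s = evl E s1 + evl E s2.
  by rewrite /evl (bigID (fun c => perm_eq c.2 w)) /= !big_filter.
rewrite (e1 A E hE) (_ : \sum_(c <- s1) c.1 = 0) ?mulr0z ?add0r //.
by rewrite /s1 big_filter h0.
Qed.

Theorem descent d s : all (ksmall d) s -> singular s ->
  forall (A : pzRingType) (E : 'I_N -> 'I_N -> nat -> A), lie_rep E -> evl E s = 0.
Proof.
elim: d s => [|d IH] s hs sg.
  by case: s hs {sg} => [|c s] /=; [move=> _ A E _; exact: evl_nil | rewrite /ksmall ltn0 andbF].
have [||s1 [h1 e1]] := @top_reduce d [seq c <- s | size c.2 == d].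
- by apply/allP => c; rewrite mem_filter => /andP[-> /(allP hs) /andP[-> _]].
- move=> w kw sw; have gw : all good w by case/andP: kw.
  have := symb_vanish sg hs gw sw; rewrite /symb => h.
  rewrite big_filter_cond; set S := bigop _ _ _.
  (* [psi w] is zero outside the permutation class of [w] and has a constant positive value on it,
     so the vanishing of the symbol is that of the coefficient sum. *)
  have : S * psi w w = 0.
    rewrite mulr_suml -[RHS]h big_mkcondr; apply: eq_bigr => c _.
    case: ifP => [pc|/negbT npc]; first by rewrite -(psi_perm w pc).
    have [->|/psi_neq0] := eqVneq (psi w c.2) 0; first by rewrite mulr0.
    by rewrite (negPf npc).
  by move/eqP; rewrite mulf_eq0 (gt_eqF (psi_gt0 w)) orbF => /eqP.
pose s2 := s1 ++ [seq c <- s | size c.2 != d].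
have e2 (A : pzRingType) (E : 'I_N -> 'I_N -> nat -> A) : lie_rep E -> evl E s = evl E s2.
  move=> hE; rewrite evl_cat -(e1 A E hE) /evl (bigID (fun c => size c.2 == d)) /=.
  by rewrite !big_filter.
move=> A E hE; rewrite (e2 A E hE); apply: IH hE.
- rewrite all_cat h1; apply/allP => c; rewrite mem_filter => /andP[nd /(allP hs) /andP[kc]].
  by rewrite /ksmall kc ltnS leq_eqVlt (negPf nd).
(* The rewriting is valid in every representation, in particular in the triangular one, so the
   shortened combination is again singular. *)
- move=> B F hF k k' eps kk'; rewrite -e2; last exact: froot_ext_lie.
  exact: sg.
Qed.

End Descent.

(** * Normal forms and commutators *)

Section NormalForm.
Variable N : nat.
Implicit Types (x y z a b : letter N) (u w m : seq (letter N)) (s : seq (int * seq (letter N))).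

Definition wt x : int := (x.1.2 : nat)%:Z - (x.1.1 : nat)%:Z.
Definition wtw w : int := \sum_(x <- w) wt x.

(** An expression in the E_ij[-n] that makes sense over every ring; it plays the role of an element
    of the enveloping algebra. *)
Definition family := forall A : pzRingType, ('I_N -> 'I_N -> nat -> A) -> A.

Definition weighted v (c : int * seq (letter N)) := all good c.2 && (wtw c.2 == v).

Definition rep v (f : family) := exists s, all (weighted v) s /\ forall A E, f A E = evl E s.

Lemma wtw_cat u w : wtw (u ++ w) = wtw u + wtw w.
Proof. by rewrite /wtw big_cat. Qed.
Lemma wtw_cons x w : wtw (x :: w) = wt x + wtw w.
Proof. by rewrite /wtw big_cons. Qed.

Definition mull s1 s2 : seq (int * seq (letter N)) :=
  [seq (c.1 * c'.1, c.2 ++ c'.2) | c <- s1, c' <- s2].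

Lemma evl_mul (A : pzRingType) (E : 'I_N -> 'I_N -> nat -> A) s1 s2 :
  evl E (mull s1 s2) = evl E s1 * evl E s2.
Proof.
rewrite /evl big_allpairs_dep mulr_suml; apply: eq_bigr => c _.
rewrite mulr_sumr; apply: eq_bigr => c' _ /=.
by rewrite evw_cat mulrzAr mulrzAl -mulrzA mulrC.
Qed.

Lemma rep0 v : rep v (fun A E => 0).
Proof. by exists [::]; split=> // A E; rewrite evl_nil. Qed.

Lemma rep1 : rep 0 (fun A E => 1).
Proof.
exists [:: (1, [::])]; split; first by rewrite /= /weighted /wtw big_nil eqxx.
by move=> A E; rewrite evl_cons evl_nil /evw big_nil mulr1z addr0.
Qed.

Lemma repD v f g : rep v f -> rep v g -> rep v (fun A E => f A E + g A E).
Proof.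
move=> [s1 [h1 e1]] [s2 [h2 e2]]; exists (s1 ++ s2); split; first by rewrite all_cat h1.
by move=> A E; rewrite evl_cat e1 e2.
Qed.

Lemma repMz v f (z : int) : rep v f -> rep v (fun A E => f A E *~ z).
Proof.
move=> [s [h e]]; exists (scalel z s); split; last by move=> A E; rewrite evl_scale e.
by rewrite /scalel all_map; apply: sub_all h.
Qed.

Lemma repM v v' f g : rep v f -> rep v' g -> rep (v + v') (fun A E => f A E * g A E).
Proof.
move=> [s1 [h1 e1]] [s2 [h2 e2]]; exists (mull s1 s2); split; last by move=> A E; rewrite evl_mul e1 e2.
apply/allP => c /allpairsP [[c1 c2] /= [/(allP h1) /andP[g1 w1] /(allP h2) /andP[g2 w2] ->]].
by rewrite /weighted /= all_cat g1 g2 wtw_cat (eqP w1) (eqP w2) eqxx.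
Qed.

Lemma rep_sum v (I : Type) (r : seq I) (f : I -> family) :
  (forall i, rep v (f i)) -> rep v (fun A E => \sum_(i <- r) f i A E).
Proof.
move=> h; elim: r => [|i r [s [hs es]]].
  by have [s [hs es]] := rep0 v; exists s; split=> // A E; rewrite big_nil; exact: es.
have [s' [hs' es']] := repD (h i) (ex_intro _ s (conj hs es)).
by exists s'; split=> // A E; rewrite big_cons -es' es.
Qed.

Lemma rep_eq v f g : (forall A E, f A E = g A E) -> rep v f -> rep v g.
Proof. by move=> e [s [h es]]; exists s; split=> // A E; rewrite -e. Qed.

Lemma rep_emask (i j : 'I_N) n : rep ((j : nat)%:Z - (i : nat)%:Z) (fun A E => emask E i j n).
Proof.
rewrite /emask; case g: (in_gplus i j n); last exact: rep0.
exists [:: (1, [:: (i, j, n)])]; split.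
  by rewrite /= /weighted /= /good g /wtw big_seq1 eqxx.
by move=> A E; rewrite evl_cons evl_nil /evw big_seq1 mulr1z addr0.
Qed.

Lemma rep_xmx P (x : 'I_N -> int) k (i j : 'I_N) (q p : 'I_P) :
  rep ((j : nat)%:Z - (i : nat)%:Z) (fun A E => (xmx (lop P E) x ^+ k) i j q p).
Proof.
elim: k i q => [|k IH] i q.
  have [<-|ij] := eqVneq i j.
    rewrite subrr; have [<-|qp] := eqVneq q p.
      by apply: rep_eq rep1 => A E; rewrite expr0 !mxE eqxx mxE eqxx.
    by apply: rep_eq (rep0 0) => A E; rewrite expr0 !mxE eqxx mxE (negPf qp).
  by apply: rep_eq (rep0 _) => A E; rewrite expr0 !mxE (negPf ij) mxE.
pose f (A : pzRingType) (E : 'I_N -> 'I_N -> nat -> A) : A :=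
  \sum_b \sum_r (lop P E i b) q r * (xmx (lop P E) x ^+ k) b j r p + (xmx (lop P E) x ^+ k) i j q p *~ x i.
apply: (@rep_eq _ f) => [A E|].
  rewrite exprS mul_xmx mxE summxE /f; congr (_ + _).
    by apply: eq_bigr => b _; rewrite mxE.
  by case: (x i) => n; rewrite ?NegzE ?mulrNz -!pmulrn ?mxE mulmxnE.
apply: repD; last exact: repMz.
apply: rep_sum => b; apply: rep_sum => r.
have -> : (j : nat)%:Z - (i : nat)%:Z = ((b : nat)%:Z - (i : nat)%:Z) + ((j : nat)%:Z - (b : nat)%:Z) :> int.
  by lia.
apply: repM => //.
pose g (A : pzRingType) (E : 'I_N -> 'I_N -> nat -> A) : A :=
  (if (r <= q)%N then emask E i b (q - r) else 0) + (1 *~ ((r : nat) * (q == r) * (i == b))%N%:Z).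
apply: (@rep_eq _ g) => [A E|].
  rewrite /g /lop !mxE mulmxnE mxE; congr (_ + _).
  by rewrite -pmulrn !mulrnA.
apply: repD; first by case: (r <= q)%N; [exact: rep_emask|exact: rep0].
have [e|ne] := eqVneq i b; last by apply: rep_eq (rep0 _) => A E; rewrite muln0 mulr0z.
by rewrite e subrr; apply: repMz; exact: rep1.
Qed.

Lemma rep_thop P k (q p : 'I_P) : rep 0 (fun A E => (thop P E k) q p).
Proof.
apply: (@rep_eq _ (fun A E => \sum_i (xmx (lop P E) (jshift i) ^+ k) i i q p)) => [A E|].
  by rewrite /thop summxE.
by apply: rep_sum => i; rewrite -(subrr ((i : nat)%:Z)); exact: rep_xmx.
Qed.

Definition lequiv s1 s2 := forall (A : pzRingType) (E : 'I_N -> 'I_N -> nat -> A),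
  lie_rep E -> evl E s1 = evl E s2.

Definition rank x : nat := if (x.1.2 < x.1.1)%N then 0 else if (x.1.1 < x.1.2)%N then 2 else 1.
Definition leqr x y := (rank x <= rank y)%N.
(** The flag [nl] asserts the absence of lower letters. It makes the induction of [nf_ins] work: a
    diagonal letter put back in front of a normal form is in order only if no lower letter has
    appeared there. *)
Definition nfw v (nl : bool) (c : int * seq (letter N)) :=
  [&& weighted v c, sorted leqr c.2 & nl ==> all (fun x => ~~ lower x) c.2].

Lemma lower_rank x : lower x = (rank x == 0%N).
Proof. by rewrite /lower /rank; case: ltngtP. Qed.

Lemma rank_le2 x : (rank x <= 2)%N.
Proof. by rewrite /rank; case: ltngtP. Qed.

Lemma brks_ok a b w c : good a -> good b -> c \in brks a b [::] w ->
  exists z, [/\ c.2 = z :: w, good z, wt z = wt a + wt b &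
    ~~ lower a -> ~~ lower b -> ~~ lower z].
Proof.
move=> ga gb; rewrite /brks mem_cat.
have H a' b' : good a' -> good b' -> a'.1.2 = b'.1.1 -> exists z,
   [/\ (a'.1.1, b'.1.2, (a'.2 + b'.2)%N) :: w = z :: w, good z, wt z = wt a' + wt b' &
    ~~ lower a' -> ~~ lower b' -> ~~ lower z].
  move=> g1 g2 e; exists (a'.1.1, b'.1.2, (a'.2 + b'.2)%N); split=> //.
  - exact: good_brk.
  - by rewrite /wt /= e; clear; lia.
  - by rewrite /lower /= e; clear; lia.
case/orP; case: eqP => // e; rewrite inE => /eqP ->.
  exact: (H a b).
have [z [h1 h2 h3 h4]] := H b a gb ga (esym e); exists z; split=> //.
- by rewrite -h1 addnC.
- by rewrite h3 addrC.
- by move=> ? ?; apply: h4.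
Qed.

Lemma nf_flat (Q Q' : pred (int * seq (letter N))) s :
  (forall c, Q c -> exists s', all Q' s' /\ lequiv [:: c] s') -> all Q s ->
  exists s', all Q' s' /\ lequiv s s'.
Proof.
move=> h; elim: s => [|c s IH] /=; first by exists [::].
case/andP=> /h [s1 [h1 e1]] /IH [s2 [h2 e2]]; exists (s1 ++ s2); split.
  by rewrite all_cat h1.
by move=> A E hE; rewrite -cat1s !evl_cat (e1 A E hE) (e2 A E hE).
Qed.

Lemma nf_ins x w : good x -> all good w -> sorted leqr w ->
  exists s, all (nfw (wt x + wtw w) (~~ lower x && all (fun y => ~~ lower y) w)) s
    /\ lequiv [:: (1, x :: w)] s.
Proof.
have [n] := ubnP (size w); elim: n x w => // n IH x w hn gx gw sw.
have base w' : all good (x :: w') -> sorted leqr (x :: w') ->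
  exists s, all (nfw (wt x + wtw w') (~~ lower x && all (fun y => ~~ lower y) w')) s
    /\ lequiv [:: (1, x :: w')] s.
  move=> g s; exists [:: (1, x :: w')]; split=> //.
  by rewrite all_seq1 /nfw /weighted g wtw_cons eqxx s /= implybb.
case: w hn gw sw => [|y w] hn gw sw; first by apply: base; rewrite //= gx.
have [xy|yx] := leqP (rank x) (rank y).
  by apply: base; [rewrite /= gx; exact: gw | rewrite /= /leqr xy; exact: sw].
case/andP: gw => gy gw; have sw' : sorted leqr w by apply: path_sorted sw.
have leqr_tr : transitive leqr by move=> ? ? ?; apply: leq_trans.
have ny : ~~ lower y -> all (fun y => ~~ lower y) w.
  move=> nly; have /allP h := order_path_min leqr_tr sw; apply/allP => z /h.
  by move: nly; rewrite !lower_rank /leqr; clear; lia.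
have nx : ~~ lower x by move: yx; rewrite lower_rank; clear; lia.
have [s1 [h1 e1]] := IH x w hn gx gw sw'.
pose s2 := [seq (c.1, y :: c.2) | c <- s1].
set Q := nfw _ _.
have hs2 : all Q s2.
  rewrite all_map; apply: sub_all h1 => c; rewrite /Q /nfw /weighted /=.
  case/and3P=> /andP[gc /eqP wc] sc nc; rewrite gy gc wtw_cons wc wtw_cons addrCA eqxx /=.
  rewrite nx /= in nc *; apply/andP; split.
    have [ly|nly] := boolP (lower y).
      case: (c.2) sc => //= h t ->; rewrite andbT /leqr.
      by move: ly; rewrite lower_rank; case: (rank y).
    move: nc; rewrite (ny nly) /=; case: (c.2) sc => //= h t -> /andP[nh _]; rewrite andbT /leqr.
    by have := rank_le2 x; move: nh nly yx; rewrite !lower_rank; clear; lia.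
  by apply/implyP => /andP[-> h]; rewrite h /= in nc *.
have [s3 [h3 e3]] : exists s', all Q s' /\ lequiv (brks x y [::] w) s'.
  apply: (@nf_flat (fun c => c \in brks x y [::] w)); last by apply/allP.
  move=> c /(brks_ok gx gy) [z [cz gz wz nz]].
  have [s4 [h4 e4]] := IH z w hn gz gw sw'.
  exists (scalel c.1 s4); split.
    rewrite /scalel all_map; apply: sub_all h4 => c'; rewrite /Q /nfw /weighted /=.
    have <- : wt z + wtw w = wt x + wtw (y :: w) by rewrite wz wtw_cons -[LHS]addrA.
    move=> /and3P[-> -> /implyP h] /=; apply/implyP => /and3P[n1 n2 n3].
    by apply: h; rewrite nz.
  move=> A E hE; rewrite evl_scale -(e4 A E hE) !evl_cons !evl_nil cz /= mulr1z.
  by rewrite !addr0.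
exists (s2 ++ s3); split; first by rewrite all_cat hs2.
move=> A E hE; rewrite evl_cat -(e3 A E hE) evl_cons evl_nil addr0 mulr1z /=.
rewrite (evw_swap [::] w hE gx gy) /=; congr (_ + _).
rewrite evw_cons; have := e1 A E hE; rewrite evl_cons evl_nil addr0 mulr1z /= => ->.
rewrite /evl big_map mulr_sumr; apply: eq_bigr => c _ /=.
by rewrite evw_cons mulrzAr.
Qed.

Lemma nf_word w : all good w -> exists s, all (nfw (wtw w) false) s /\ lequiv [:: (1, w)] s.
Proof.
elim: w => [|x w IH] gw.
  by exists [:: (1, [::])]; split=> //; rewrite /= /nfw /weighted /= eqxx.
case/andP: gw => gx /IH [s [hs es]].
have [s' [hs' es']] : exists s', all (nfw (wtw (x :: w)) false) s' /\
    lequiv [seq (c.1, x :: c.2) | c <- s] s'.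
  apply: (@nf_flat (fun c => [&& all good c.2, head x c.2 == x, sorted leqr (behead c.2), c.2 != [::] & wtw c.2 == wtw (x :: w)])).
    move=> [c [|x' u]] /=; first by rewrite andbF.
    move=> /and4P[/andP[gx' gu] /eqP e su /eqP wu]; subst x'.
    have [s1 [h1 e1]] := nf_ins gx gu su; exists (scalel c s1); split.
      rewrite /scalel all_map; apply: sub_all h1 => c'; rewrite /nfw /weighted /= -wtw_cons wu.
      by move=> /and3P[-> ->].
    by move=> A E hE; rewrite evl_scale -(e1 A E hE) !evl_cons !evl_nil /= mulr1z !addr0.
  rewrite all_map; apply: sub_all hs => c; rewrite /nfw /weighted /=.
  by rewrite gx eqxx !wtw_cons => /and3P[/andP[-> /eqP ->] -> _]; rewrite eqxx.
exists s'; split=> // A E hE; rewrite -(es' A E hE) evl_cons evl_nil addr0 mulr1z /= evw_cons.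
have := es A E hE; rewrite evl_cons evl_nil addr0 mulr1z /= => ->.
rewrite /evl big_map mulr_sumr; apply: eq_bigr => c _ /=.
by rewrite evw_cons mulrzAr.
Qed.

Definition dword w := all (fun x => good x && (x.1.1 == x.1.2)) w.

(** Lower letters have negative weight and upper ones positive weight, so a word of weight zero that
    is not diagonal contains both; sorting puts them at the two ends. *)
Lemma nfw0_cases c : nfw 0 false c -> dword c.2 || kword c.2.
Proof.
case/and3P=> /andP[gc /eqP wc] sc _.
have [dg|ndg] := boolP (dword c.2) => //=.
case: (c.2) gc wc sc ndg => [|x w] // gw ww sw nd.
have leqr_tr : transitive leqr by move=> ? ? ?; apply: leq_trans.
rewrite /kword gw /=.
have wtr z : (rank z = 0%N /\ wt z < 0) \/ (rank z = 1%N /\ wt z = 0) \/ (rank z = 2%N /\ 0 < wt z).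
  by rewrite /rank /wt; case: ltngtP; lia.
have lastmax : forall z, z \in x :: w -> (rank z <= rank (last x w))%N.
  elim: w x sw {gw ww nd} => [|y w IH] x /= sw z; first by rewrite inE => /eqP ->.
  case/andP: sw => xy sw; rewrite inE => /orP[/eqP ->|zw]; last exact: IH.
  by apply: leq_trans xy _; apply: IH; rewrite // mem_head.
have firstmin : forall z, z \in x :: w -> (rank x <= rank z)%N.
  move=> z; rewrite inE => /orP[/eqP -> //|zw].
  exact: (allP (order_path_min leqr_tr sw)).
apply/andP; split.
  apply: contraR nd; rewrite lower_rank => rx.
  have wpos z : z \in x :: w -> 0 <= wt z.
    by move=> zw; have := firstmin z zw; have := wtr z; move: rx; clear; lia.
  move/eqP: ww; rewrite /wtw big_seq psumr_eq0 // => /allP h; apply/allP => z zw.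
  rewrite (allP gw _ zw) /=; have /implyP/(_ zw)/eqP := h z zw; rewrite /wt => hz.
  by apply/eqP/val_inj; move: hz => /=; clear; lia.
have -> : upper (last x w) = (rank (last x w) == 2%N) by rewrite /upper /rank; case: ltngtP.
apply: contraR nd => rl.
have wneg z : z \in x :: w -> 0 <= - wt z.
  by move=> zw; have := lastmax z zw; have := wtr z; have := wtr (last x w); move: rl; clear; lia.
move/eqP: ww; rewrite /wtw -oppr_eq0 -sumrN big_seq psumr_eq0 // => /allP h; apply/allP => z zw.
rewrite (allP gw _ zw) /=; have /implyP/(_ zw)/eqP := h z zw; rewrite /wt => hz.
  by apply/eqP/val_inj; move: hz => /=; clear; lia.
Qed.

Lemma evw_dword_comm (A : pzRingType) (E : 'I_N -> 'I_N -> nat -> A) u w :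
  lie_rep E -> dword u -> dword w -> evw E u * evw E w = evw E w * evw E u.
Proof.
move=> hE; elim: u => [|x u IH] du dw; first by rewrite /evw big_nil mulr1 mul1r.
case/andP: du => /andP[gx /eqP dx] du; rewrite evw_cons -mulrA IH // !mulrA; congr (_ * _).
elim: w dw {IH du} => [|y w IH] dw; first by rewrite /evw big_nil mulr1 mul1r.
case/andP: dw => /andP[gy /eqP dy] dw; rewrite evw_cons mulrA.
have -> : evx E x * evx E y = evx E y * evx E x.
  have h : evx E x * evx E y = _ := hEn hE gx gy; rewrite h /evx -dx -dy.
  case: (x.1.1 =P y.1.1) => [->|_]; rewrite ?mulr0n ?mulr1n; last by ncring.
  by ncring.
by rewrite -!mulrA IH.
Qed.

(** In second place the diagonal letter does no harm to the shape, and its bracket with the lower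
    first letter is again lower. *)
Lemma kword_consd h w : good h -> h.1.1 = h.1.2 -> kword w ->
  exists s, all (fun c => kword c.2) s /\ lequiv [:: (1, h :: w)] s.
Proof.
move=> gh dh; case: w => // x m kw.
have /andP[/= /andP[gx gm] /andP[lx ux]] := kw.
case: m gm ux {kw} => [|y m] gm ux; first by move: lx ux; rewrite /lower /upper /=; clear; lia.
exists ((1, x :: h :: y :: m) :: brks h x [::] (y :: m)); split; last first.
  move=> A E hE; rewrite !evl_cons evl_nil addr0 !mulr1z /=.
  exact: (evw_swap [::] _ hE gh gx).
rewrite /= /kword /= gx gh lx /= in gm ux *; rewrite gm ux /=.
rewrite /brks all_cat; apply/andP; split; case: eqP => //= e; rewrite /kword /= ux gm !andbT.
  by rewrite good_brk //=; move: lx; rewrite /lower /= -e dh.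
by rewrite [(h.2 + x.2)%N]addnC good_brk //=; move: lx; rewrite /lower /= -dh e.
Qed.

Lemma kword_rconsd h w : good h -> h.1.1 = h.1.2 -> kword w ->
  exists s, all (fun c => kword c.2) s /\ lequiv [:: (1, rcons w h)] s.
Proof.
move=> gh dh; case: w => // x m; case/lastP: m => [|m y] kw.
  by move: kw; rewrite /kword /= /lower /upper; lia.
have /andP[/= /andP[gx]] := kw; rewrite all_rcons last_rcons => /andP[gy gm] /andP[lx uy].
exists ((1, x :: rcons (rcons m h) y) :: brks y h (x :: m) [::]); split; last first.
  move=> A E hE; rewrite !evl_cons evl_nil addr0 !mulr1z /=.
  have := evw_swap (x :: m) [::] hE gy gh.
  by rewrite -!cats1 -!catA.
rewrite /= /kword /= gx lx !all_rcons !last_rcons gy gh gm uy /=.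
rewrite /brks all_cat; apply/andP; split; case: eqP => //= e; rewrite /kword /= all_cat /= gx gm lx last_cat /= !andbT.
  by rewrite good_brk //=; move: uy; rewrite /upper /= e dh.
by rewrite [(y.2 + h.2)%N]addnC good_brk //=; move: uy; rewrite /upper /= e -dh.
Qed.

Definition kspan s := exists s', all (fun c => kword c.2) s' /\ lequiv s s'.

Lemma kspan_dk d k : dword d -> kword k -> kspan [:: (1, d ++ k)].
Proof.
elim: d => [|h d IH] dd kk; first by exists [:: (1, k)]; rewrite /= kk.
case/andP: dd => /andP[gh /eqP dh] /IH - /(_ kk) [s [hs es]].
have [s' [hs' es']] : exists s', all (fun c => kword c.2) s' /\
    lequiv [seq (c.1, h :: c.2) | c <- s] s'.
  apply: (@nf_flat (fun c => kword (behead c.2) && (head h c.2 == h) && (c.2 != [::]))).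
    move=> [c [|x' u]] /=; first by [].
    move=> /andP[/andP[ku /eqP ->] _].
    have [s1 [h1 e1]] := kword_consd gh dh ku; exists (scalel c s1); split.
      by rewrite /scalel all_map; apply: sub_all h1.
    by move=> A E hE; rewrite evl_scale -(e1 A E hE) !evl_cons !evl_nil /= mulr1z !addr0.
  by rewrite all_map; apply: sub_all hs => c /=; rewrite eqxx andbT => ->.
exists s'; split=> // A E hE; rewrite -(es' A E hE) evl_cons evl_nil addr0 mulr1z /= evw_cons.
have := es A E hE; rewrite evl_cons evl_nil addr0 mulr1z /= => ->.
rewrite /evl big_map mulr_sumr; apply: eq_bigr => c _ /=.
by rewrite evw_cons mulrzAr.
Qed.

Lemma kspan_kd d k : dword d -> kword k -> kspan [:: (1, k ++ d)].
Proof.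
elim: d k => [|h d IH] k dd kk; first by exists [:: (1, k)]; rewrite /= cats0 kk.
case/andP: dd => /andP[gh /eqP dh] dd.
have [s [hs es]] := kword_rconsd gh dh kk.
have [s' [hs' es']] : kspan [seq (c.1, c.2 ++ d) | c <- s].
  apply: (@nf_flat (fun c => has (fun c' => (c == (c'.1, c'.2 ++ d)) && kword c'.2) s)).
    move=> c /hasP[c' _ /andP[/eqP -> kc']].
    have [s1 [h1 e1]] := IH c'.2 dd kc'; exists (scalel c'.1 s1); split.
      by rewrite /scalel all_map; apply: sub_all h1.
    by move=> A E hE; rewrite evl_scale -(e1 A E hE) !evl_cons !evl_nil /= mulr1z !addr0.
  apply/allP => c /mapP[c' c's ->]; apply/hasP; exists c' => //; rewrite eqxx.
  exact: (allP hs).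
exists s'; split=> // A E hE; rewrite -(es' A E hE) evl_cons evl_nil addr0 mulr1z /= -cat_rcons evw_cat.
have := es A E hE; rewrite evl_cons evl_nil addr0 mulr1z /= => ->.
rewrite /evl big_map mulr_suml; apply: eq_bigr => c _ /=.
by rewrite evw_cat mulrzAl.
Qed.

Lemma kword_cat u w : kword u -> kword w -> kword (u ++ w).
Proof.
case: u => // x u /andP[/= /andP[gx gu] /andP[lx _]]; case: w => // y w /andP[/= /andP[gy gw] /andP[_ uw]].
by rewrite /kword /= all_cat gx gu /= gy gw lx last_cat.
Qed.

Lemma kspan_mull s1 s2 :
  (forall c c', c \in s1 -> c' \in s2 -> kspan [:: (1, c.2 ++ c'.2)]) -> kspan (mull s1 s2).
Proof.
move=> h; apply: (@nf_flat (fun c => c \in mull s1 s2)); last by apply/allP.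
move=> c /allpairsP[[c1 c2] /= [m1 m2 ->]].
have [s [hs es]] := h c1 c2 m1 m2; exists (scalel (c1.1 * c2.1) s); split.
  by rewrite /scalel all_map; apply: sub_all hs.
by move=> A E hE; rewrite evl_scale -(es A E hE) !evl_cons !evl_nil /= mulr1z !addr0.
Qed.

Lemma rep0_split f : rep 0 f -> exists sd sk, [/\ all (fun c => dword c.2) sd,
  all (fun c => kword c.2) sk & forall (A : pzRingType) (E : 'I_N -> 'I_N -> nat -> A),
    lie_rep E -> f A E = evl E sd + evl E sk].
Proof.
move=> [s [hs es]].
have [s' [hs' es']] : exists s', all (nfw 0 false) s' /\ lequiv s s'.
  apply: (nf_flat _ hs) => c /andP[gc /eqP wc].
  have [s1 [h1 e1]] := nf_word gc; exists (scalel c.1 s1); split.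
    by rewrite /scalel all_map; apply: sub_all h1 => c'; rewrite wc.
  by move=> A E hE; rewrite evl_scale -(e1 A E hE) !evl_cons !evl_nil /= mulr1z !addr0.
exists [seq c <- s' | dword c.2], [seq c <- s' | ~~ dword c.2]; split.
- exact: filter_all.
- apply/allP => c; rewrite mem_filter => /andP[nd /(allP hs') /nfw0_cases].
  by rewrite (negPf nd).
- move=> A E hE; rewrite es (es' A E hE) /evl !big_filter.
  by rewrite (bigID (fun c => dword c.2)).
Qed.

End NormalForm.

(** * Commutation of singular families of weight zero *)

Definition singfam (N : nat) (f : family N) :=
  forall (A : pzRingType) (E : 'I_N -> 'I_N -> nat -> A), lie_rep E ->
  forall k k' eps, simple_root k k' eps -> (f _ (froot_ext E k k' eps)) 0 1 = 0.

Theorem singfam_comm N (f g : family N) : rep 0 f -> rep 0 g -> singfam f -> singfam g ->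
  forall (A : pzRingType) (E : 'I_N -> 'I_N -> nat -> A), lie_rep E ->
  f A E * g A E = g A E * f A E.
Proof.
move=> /rep0_split [sd [sk [hd hk ef]]] /rep0_split [td [tk [gd gk eg]]] sf sg.
have kd (s t : seq (int * seq (letter N))) : all (fun c => dword c.2) s -> all (fun c => kword c.2) t -> kspan (mull s t).
  by move=> hs ht; apply: kspan_mull => c c' /(allP hs) h /(allP ht) h'; apply: kspan_dk.
have kd' (s t : seq (int * seq (letter N))) : all (fun c => kword c.2) s -> all (fun c => dword c.2) t -> kspan (mull s t).
  by move=> hs ht; apply: kspan_mull => c c' /(allP hs) h /(allP ht) h'; apply: kspan_kd.
have kk (s t : seq (int * seq (letter N))) : all (fun c => kword c.2) s -> all (fun c => kword c.2) t -> kspan (mull s t).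
  move=> hs ht; apply: kspan_mull => c c' /(allP hs) h /(allP ht) h'.
  by exists [:: (1, c.2 ++ c'.2)]; rewrite /= kword_cat.
have [s1 [h1 e1]] := kd _ _ hd gk; have [s2 [h2 e2]] := kd' _ _ hk gd; have [s3 [h3 e3]] := kk _ _ hk gk.
have [t1 [i1 j1]] := kd _ _ gd hk; have [t2 [i2 j2]] := kd' _ _ gk hd; have [t3 [i3 j3]] := kk _ _ gk hk.
pose s := s1 ++ s2 ++ s3 ++ scalel (-1) (t1 ++ t2 ++ t3).
have eC (A : pzRingType) (E : 'I_N -> 'I_N -> nat -> A) : lie_rep E ->
    f A E * g A E - g A E * f A E = evl E s.
  move=> hE; rewrite /s !evl_cat evl_scale !evl_cat.
  rewrite -(e1 A E hE) -(e2 A E hE) -(e3 A E hE) -(j1 A E hE) -(j2 A E hE) -(j3 A E hE) !evl_mul.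
  rewrite (ef A E hE) (eg A E hE) mulrN1z.
  have dc : evl E sd * evl E td = evl E td * evl E sd.
    rewrite /evl mulr_suml mulr_sumr [in RHS]big_seq big_seq; apply: eq_bigr => c cs.
    rewrite mulr_suml mulr_sumr [in RHS]big_seq big_seq; apply: eq_bigr => c' c's.
    rewrite !mulrzAr !mulrzAl mulrzAC; congr (_ *~ _ *~ _).
    by apply: evw_dword_comm => //; [apply: (allP hd)|apply: (allP gd)].
  by rewrite !(mulrDl, mulrDr) dc; ncring.
have hs : all (fun c => kword c.2) s.
  rewrite /s !all_cat h1 h2 h3 /= /scalel all_map /=.
  by rewrite -[all _ _]/(all (fun c => kword c.2) (t1 ++ t2 ++ t3)) !all_cat i1 i2 i3.
pose d := (\max_(c <- s) size c.2).+1.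
have hs' : all (ksmall d) s.
  apply/allP => c cs; rewrite /ksmall (allP hs _ cs) ltnS.
  exact: (bigmaxn_sup_seq c).
move=> A E hE; apply/eqP; rewrite -subr_eq0 (eC A E hE); apply/eqP.
apply: (descent hs') hE => B F hF k k' eps kk'.
(* The corner entry of a product of two triangular matrices is built from the corners of the
   factors, so the commutator inherits singularity. *)
have hF2 := froot_ext_lie kk' hF; rewrite -(eC _ _ hF2).
have eB (X Y : 'M[B]_2) : (X - Y) 0 1 = X 0 1 - Y 0 1 by rewrite !mxE.
by rewrite eB !mulmx22E (sf B F hF _ _ _ kk') (sg B F hF _ _ _ kk') !mulr0 !mul0r !addr0 subrr.
Qed.

Theorem thop_comm N P m m' (q p q' p' : 'I_P) (A : pzRingType) (E : 'I_N -> 'I_N -> nat -> A) :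
  lie_rep E -> (thop P E m) q p * (thop P E m') q' p' = (thop P E m') q' p' * (thop P E m) q p.
Proof.
move=> hE.
have sg n (a b : 'I_P) : singfam (fun A (E : 'I_N -> 'I_N -> nat -> A) => (thop P E n) a b).
  move=> B F hF k k' eps kk'; have := thop_singular P kk' hF n.
  by move/matrixP/(_ a b); rewrite !mxE.
have h := @singfam_comm N _ _ (rep_thop N m q p) (rep_thop N m' q' p') (sg m q p) (sg m' q' p') A E hE.
exact: h.
Qed.

(** * From the normalised operators to those of the paper *)

(** Additive endomorphisms are made into a ring so that left and right multiplications of [A] can
    serve together as values of a representation. *)
Record endo (V : zmodType) := Endo { efun :> V -> V; efunB : {morph efun : x y / x - y} }.

HB.instance Definition _ (V : zmodType) := gen_eqMixin (endo V).
HB.instance Definition _ (V : zmodType) := gen_choiceMixin (endo V).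

Section EndoRing.
Variable V : zmodType.
Implicit Types f g h : endo V.

Lemma endoP f g : (forall x, f x = g x) -> f = g.
Proof.
case: f g => [f fB] [g gB] /= fg.
have e : f = g by apply: funext.
by subst g; congr Endo; apply: Prop_irrelevance.
Qed.

Lemma efun0 f : f 0 = 0.
Proof. by have := efunB f 0 0; rewrite !subrr. Qed.
Lemma efunN f x : f (- x) = - f x.
Proof. by rewrite -sub0r efunB efun0 sub0r. Qed.
Lemma efunD f x y : f (x + y) = f x + f y.
Proof. by rewrite -[y in LHS]opprK efunB efunN opprK. Qed.

Fact eaddP f g : {morph (fun x => f x + g x) : x y / x - y}.
Proof. by move=> x y; rewrite !efunB opprD addrACA. Qed.
Fact eoppP f : {morph (fun x => - f x) : x y / x - y}.
Proof. by move=> x y; rewrite efunB opprD. Qed.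
Fact e0P : {morph (fun _ : V => 0 : V) : x y / x - y}.
Proof. by move=> x y; rewrite subrr. Qed.
Fact emulP f g : {morph (fun x => f (g x)) : x y / x - y}.
Proof. by move=> x y; rewrite !efunB. Qed.
Fact e1P : {morph (fun x : V => x) : x y / x - y}.
Proof. by []. Qed.

Definition eadd f g := Endo (eaddP f g).
Definition eopp f := Endo (eoppP f).
Definition e0 := Endo e0P.
Definition emul f g := Endo (emulP f g).
Definition e1 := Endo e1P.

Fact eaddA : associative eadd. Proof. by move=> f g h; apply: endoP => x /=; rewrite addrA. Qed.
Fact eaddC : commutative eadd. Proof. by move=> f g; apply: endoP => x /=; rewrite addrC. Qed.
Fact eadd0 : left_id e0 eadd. Proof. by move=> f; apply: endoP => x /=; rewrite add0r. Qed.
Fact eaddN : left_inverse e0 eopp eadd. Proof. by move=> f; apply: endoP => x /=; rewrite addNr. Qed.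
HB.instance Definition _ := GRing.isZmodule.Build (endo V) eaddA eaddC eadd0 eaddN.
Fact emulA : associative emul. Proof. by move=> f g h; apply: endoP. Qed.
Fact emul1 : left_id e1 emul. Proof. by move=> f; apply: endoP. Qed.
Fact e1mul : right_id e1 emul. Proof. by move=> f; apply: endoP. Qed.
Fact emulDl : left_distributive emul +%R. Proof. by move=> f g h; apply: endoP. Qed.
Fact emulDr : right_distributive emul +%R. Proof. by move=> f g h; apply: endoP => x; apply: efunD. Qed.
HB.instance Definition _ := GRing.Zmodule_isPzRing.Build (endo V) emulA emul1 e1mul emulDl emulDr.

Lemma endoDE f g x : (f + g) x = f x + g x. Proof. by []. Qed.
Lemma endoNE f x : (- f) x = - f x. Proof. by []. Qed.
Lemma endoME f g x : (f * g) x = f (g x). Proof. by []. Qed.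
Lemma endo0E x : (0 : endo V) x = 0. Proof. by []. Qed.
Lemma endo1E x : (1 : endo V) x = x. Proof. by []. Qed.
Lemma endoMnE f n x : (f *+ n) x = f x *+ n.
Proof. by elim: n => [|n IH]; rewrite ?mulr0n // !mulrS endoDE IH. Qed.
Lemma endoMzE f (z : int) x : (f *~ z) x = f x *~ z.
Proof. by case: z => n; rewrite ?NegzE ?mulrNz -!pmulrn ?endoNE endoMnE. Qed.
Lemma endo_sumE (I : Type) (r : seq I) (F : I -> endo V) x : (\sum_(i <- r) F i) x = \sum_(i <- r) F i x.
Proof. by elim: r => [|i r IH]; rewrite ?big_nil // !big_cons endoDE IH. Qed.
End EndoRing.

Section MulEndo.
Variable A : pzRingType.
Fact lmP (a : A) : {morph ( *%R a) : x y / x - y}. Proof. by move=> x y; rewrite mulrBr. Qed.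
Fact rmP (a : A) : {morph ( *%R^~ a) : x y / x - y}. Proof. by move=> x y; rewrite mulrBl. Qed.
Definition lmE a : endo A := Endo (lmP a).
Definition rmE a : endo A := Endo (rmP a).
End MulEndo.

Section Passage.
Variables (A : pzRingType) (N P : nat) (E : 'I_N -> 'I_N -> nat -> A) (c : 'I_N -> A).
Hypothesis hE : lie_rep E.
Hypothesis tf2 : forall x : A, x *+ 2 = 0 -> x = 0.
Hypothesis cE : forall a, c a *+ 2 = - E a a 0%N - (2 * a)%N%:R.

Definition twist i j n : endo A := lmE (E i j n) + rmE (c i) *+ ((i == j) && (n == 0%N)).

Lemma E_diag_comm a b : E a a 0%N * E b b 0%N = E b b 0%N * E a a 0%N.
Proof.
have g (i : 'I_N) : in_gplus i i 0 by rewrite /in_gplus /= leqnn.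
by rewrite (hEn hE (g a) (g b)); case: (a =P b) => [->|_]; ncring.
Qed.

Lemma c_comm a b : c a * c b = c b * c a.
Proof.
apply/eqP; rewrite -subr_eq0; apply/eqP; apply: tf2; apply: tf2.
have nc (x : A) n : x * n%:R = n%:R * x by rewrite mulr_natl mulr_natr.
transitivity ((c a *+ 2) * (c b *+ 2) - (c b *+ 2) * (c a *+ 2)); first by ncring.
by rewrite !cE !(mulrDl, mulrDr, mulrN, mulNr) (E_diag_comm a b) !(nc (E _ _ _)) !(nc _%:R (2 * b)%N); ncring.
Qed.

(** Right multiplications commute with left ones, and among themselves by [c_comm]. Whatever
    diagonal zero modes a bracket produces occur twice with opposite signs, which is [rc]. *)
Lemma twist_lie : lie_rep twist.
Proof.
move=> a b k d r s g1 g2; rewrite /twist.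
have -> (X Y : endo A) (t : bool) : (if t then X + Y else 0) = X *+ t + Y *+ t by case: t; rewrite ?addr0.
have -> (X Y : endo A) (t : bool) : (if t then X + Y else 0) = X *+ t + Y *+ t by case: t; rewrite ?addr0.
apply: endoP => x.
rewrite !(endoDE, endoNE, endoME, endoMnE) /=.
have h := hEn hE g1 g2.
have rc : x * c a *+ ((a == d) && ((r + s)%N == 0%N)) *+ (k == b) =
          x * c k *+ ((k == b) && ((r + s)%N == 0%N)) *+ (a == d).
  case: (a =P d) => [e1|_]; case: (k =P b) => [e2|_]; rewrite ?mul0rn //= ?mulr1n ?mulr0n //.
  case: eqP => // rs0; suff -> : a = k by [].
  by apply: val_inj; subst; move: g1 g2; rewrite /in_gplus /=; clear -rs0; lia.
rewrite rc [k == b]eq_sym.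
set t1 := (a == b) && _; set t2 := (k == d) && _; set tt := _ *+ (a == d).
have cc : x * c a * c k = x * c k * c a by rewrite -!mulrA c_comm.
have hx : E a b r * (E k d s * x) = E k d s * (E a b r * x) + (E a d (r + s)%N * x) *+ (b == k)
   - (E k b (r + s)%N * x) *+ (a == d).
  by rewrite !mulrA h mulrBl mulrDl !mulrnAl.
clear rc; case: t1; case: t2; rewrite ?mulr1n ?mulr0n ?addr0 ?mulrDr ?mulrDl ?mulrA.
all: rewrite ?mulrA in hx cc *; rewrite hx ?cc; ncring.
Qed.

Definition lpap a b : 'M[A]_P := toep P (fun n => - Lplus E a b n) + (udu A P *+ 2) *+ (a == b).
Definition spap (i a : 'I_N) : int := sgz ((i : nat)%:Z - (a : nat)%:Z).
Definition thpap m : 'M[A]_P := \sum_i (xmx lpap (spap i) ^+ m) i i.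

Lemma LplusE a b n : - Lplus E a b n = emask E a b n *+ 2 - E a a 0%N *+ ((a == b) && (n == 0%N)).
Proof.
rewrite /Lplus /emask /in_gplus; case: n => [|n] /=; last first.
  by rewrite andbF mulr0n subr0 opprK mulr_natl.
rewrite opprK andbT -val_eqE; case: (ltngtP a b) => ab /=.
- by rewrite gtr0_sgz ?subr0 ?mulr_natl //; lia.
- by rewrite ltr0_sgz ?mul0r ?mul0rn ?subrr //; lia.
- by rewrite (val_inj ab) subrr sgz0 addr0 mul1r mulr2n addrK.
Qed.

(** [z] has weight epsilon_a - epsilon_i under the adjoint action of the elements E_kk[0]. *)
Definition hasw (a i : 'I_N) (z : A) := forall k,
  E k k 0%N * z = z * E k k 0%N + z *~ ((a == k)%:Z - (i == k)%:Z).

Lemma hasw_sum (I : Type) (r : seq I) (F : I -> A) a i :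
  (forall t, hasw a i (F t)) -> hasw a i (\sum_(t <- r) F t).
Proof.
move=> h k; elim: r => [|t r IH]; first by rewrite big_nil mulr0 mul0r mul0rz addr0.
by rewrite big_cons mulrDr IH h mulrDl mulrzDl; ncring.
Qed.

Lemma hasw_mul a b i y z : hasw a b y -> hasw b i z -> hasw a i (y * z).
Proof.
move=> hy hz k; rewrite mulrA hy mulrDl -mulrA hz mulrDr mulrzAl mulrzAr -addrA mulrA -mulrzDr.
by congr (_ + _ *~ _); lia.
Qed.

Lemma haswMz a i z (n : int) : hasw a i z -> hasw a i (z *~ n).
Proof. by move=> h k; rewrite mulrzAr h mulrzAl mulrzDl mulrzAC. Qed.

Lemma hasw0 a i : hasw a i 0.
Proof. by move=> k; rewrite mulr0 mul0r mul0rz addr0. Qed.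

Lemma hasw1 a : hasw a a 1.
Proof. by move=> k; rewrite mulr1 mul1r subrr mulr0z addr0. Qed.

Lemma hasw_Lplus a b n : hasw a b (- Lplus E a b n).
Proof.
have g (i : 'I_N) : in_gplus i i 0 by rewrite /in_gplus /= leqnn.
have h1 : hasw a b (emask E a b n).
  rewrite /emask; case: ifP => gab; last exact: hasw0.
  move=> k; rewrite (hEn hE (g k) gab) add0n mulrzBr -!pmulrn [k == a]eq_sym [k == b]eq_sym.
  rewrite -addrA; congr (_ + (_ - _)).
    by case: (a =P k) => [->|].
  by case: (b =P k) => [->|].
rewrite LplusE; case: (a =P b) h1 => [<-|_] h1; last by rewrite /= mulr0n subr0 pmulrn; apply: haswMz.
move=> k; have := h1 k; rewrite !subrr !mulr0z !addr0 => hk.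
case: (n == 0%N) => /=; last by rewrite subr0 mulrnAr hk mulrnAl.
by rewrite mulrBr mulrBl mulrnAr hk mulrnAl E_diag_comm.
Qed.

Lemma thpap_entry x m (i j : 'I_N) (q p : 'I_P) :
  (xmx lpap x ^+ m.+1) i j q p =
  \sum_(b < N) \sum_(r < P) (if (r <= q)%N then - Lplus E i b (q - r)%N else 0) * (xmx lpap x ^+ m) b j r p
  + (xmx lpap x ^+ m) i j q p *~ ((2 * q)%N%:Z + x i).
Proof.
rewrite exprS mul_xmx mxE summxE.
have -> : ((xmx lpap x ^+ m) i j *~ x i) q p = (xmx lpap x ^+ m) i j q p *~ x i.
  by case: (x i) => n; rewrite ?NegzE ?mulrNz -!pmulrn ?mxE mulmxnE.
rewrite mulrzDr addrA; congr (_ + _).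
set V := _ ^+ m.
rewrite (eq_bigr (fun b => \sum_(r < P) (if (r <= q)%N then - Lplus E i b (q - r)%N else 0) * V b j r p
   + (V b j q p *~ (2 * q)%N%:Z) *+ (i == b))); last first.
  move=> b _; rewrite mxE.
  rewrite (eq_bigr (fun r : 'I_P => (if (r <= q)%N then - Lplus E i b (q - r)%N else 0) * V b j r p
     + (V b j r p *~ (2 * r)%N%:Z *+ (i == b)) *+ (q == r))); last first.
    move=> r _; rewrite /lpap !mxE !mulmxnE mulrDl; congr (_ + _); rewrite mxE.
    case: (i == b); case: (q == r); rewrite ?mulr0n ?mulr1n ?mul0rn ?mul0r //.
    by rewrite -mulrnA mulr_natl -pmulrn mulnC.
  by rewrite big_split sum_delta.
by rewrite big_split sum_delta.
Qed.

Lemma hasw_xmx x m (a i : 'I_N) q p : hasw a i ((xmx lpap x ^+ m) a i q p).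
Proof.
elim: m a q => [|m IH] a q.
  rewrite expr0 !mxE; case: (a =P i) => [->|_]; last by rewrite mxE; apply: hasw0.
  by rewrite mxE; case: (q == p); [apply: hasw1|apply: hasw0].
rewrite thpap_entry => k; rewrite mulrDr (haswMz _ (IH _ _)).
rewrite (@hasw_sum _ _ _ a i) ?mulrDl ?mulrzDl; first by ncring.
move=> b; apply: hasw_sum => r; apply: hasw_mul (IH _ _).
by case: ifP => _; [apply: hasw_Lplus|apply: hasw0].
Qed.

Lemma twist_entry x m (i j : 'I_N) (q p : 'I_P) :
  (xmx (lop P twist) x ^+ m.+1) i j q p 1 =
  \sum_(b < N) \sum_(r < P) (if (r <= q)%N then emask E i b (q - r)%N else 0) * (xmx (lop P twist) x ^+ m) b j r p 1
  + (xmx (lop P twist) x ^+ m) i j q p 1 * c i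
  + (xmx (lop P twist) x ^+ m) i j q p 1 *~ (q%:Z + x i).
Proof.
have em b n y : emask twist i b n y = emask E i b n * y + (y * c i) *+ ((i == b) && (n == 0%N)).
  rewrite /emask; case: ifP => g; first by rewrite /twist endoDE endoMnE.
  rewrite endo0E mul0r add0r; case: (i =P b) => [e|//]; case: eqP => [e'|//].
  by move: g; rewrite e e' /in_gplus /= leqnn.
rewrite exprS mul_xmx mxE summxE endoDE endo_sumE.
set V := _ ^+ m.
have -> : (V i j *~ x i) q p 1 = V i j q p 1 *~ x i.
  rewrite -endoMzE; congr efun.
  by case: (x i) => n; rewrite ?NegzE ?mulrNz -!pmulrn ?mxE mulmxnE.
rewrite mulrzDr addrA; congr (_ + _).
rewrite (eq_bigr (fun b => \sum_(r < P) (if (r <= q)%N then emask E i b (q - r)%N else 0) * V b j r p 1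
   + (V b j q p 1 * c i + V b j q p 1 *~ q%:Z) *+ (i == b))); last first.
  move=> b _; rewrite mxE endo_sumE.
  rewrite (eq_bigr (fun r : 'I_P => (if (r <= q)%N then emask E i b (q - r)%N else 0) * V b j r p 1
     + ((V b j r p 1 * c i + V b j r p 1 *~ r%:Z) *+ (i == b)) *+ (q == r))); last first.
    move=> r _; rewrite /lop !mxE !mulmxnE endoME endoDE.
    have -> : (if (r <= q)%N then emask twist i b (q - r)%N else 0) (V b j r p 1) =
       (if (r <= q)%N then emask E i b (q - r)%N else 0) * V b j r p 1
       + (V b j r p 1 * c i) *+ ((i == b) && (q == r)).
      rewrite -(val_eqE q r) /= (eqn_leq q r).
      case: (leqP r q) => rq; first by rewrite em subn_eq0 andbT.
      by rewrite endo0E mul0r add0r !andbF.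
    rewrite -addrA; congr (_ + _); rewrite !mxE.
    case: (i == b); case: (q == r); rewrite ?mulr0n ?mulr1n /= ?endo0E ?addr0 //.
    by rewrite endoMnE endo1E.
  by rewrite big_split sum_delta.
by rewrite big_split sum_delta -addrA.
Qed.

(** Evaluated at 1, the twisted operators carry E_aa on the left and - E_aa / 2 on the right. Since
    the matrix entries are weight vectors, the right factor can be moved to the left; this halves
    the Cartan part and alters the diagonal shift. Doubling at every step produces the power of
    2. *)
Lemma twist_pap m (a i : 'I_N) (q p : 'I_P) :
  (xmx (lop P twist) (jshift i) ^+ m) a i q p 1 *+ 2 ^ m = (xmx lpap (spap i) ^+ m) a i q p.
Proof.
elim: m a q => [|m IH] a q.
  by rewrite !expr0 mulr1n !mxE; case: (a == i); rewrite !mxE; case: (q == p).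
rewrite twist_entry thpap_entry expnS mulrnA.
set Y := (_ ^+ m) in IH *; set Z := (_ ^+ m) in IH *.
have hz := hasw_xmx (spap i) m a i q p a; rewrite -/Z eqxx in hz.
transitivity ((\sum_(b < N) \sum_(r < P) ((if (r <= q)%N then emask E a b (q - r)%N else 0) *+ 2) * Z b i r p)
   + Z a i q p * (c a *+ 2) + Z a i q p *~ ((2 * q)%N%:Z + (jshift i a) *+ 2)).
  have dl (u v w : A) n k : (u + v + w) *+ n *+ k = u *+ n *+ k + v *+ n *+ k + w *+ n *+ k.
    by rewrite !mulrnDl.
  rewrite dl; apply: (f_equal2 +%R); [apply: (f_equal2 +%R)|].
  - rewrite -!sumrMnl; apply: eq_bigr => b _; rewrite -!sumrMnl; apply: eq_bigr => r _.
    by rewrite -IH mulrnAr mulrnAl mulrnAC.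
  - by rewrite -IH mulrnAl mulrnAr mulrnAC.
  - have zt (z : A) (t : int) n : z *~ t *+ 2 *+ n = (z *+ n) *~ (t *+ 2).
      by rewrite mulr2n -mulrzDr -mulr2n !pmulrn mulrzAC.
    by rewrite zt IH; congr (_ *~ _); lia.
rewrite (eq_bigr (fun b => \sum_(r < P) (if (r <= q)%N then - Lplus E a b (q - r)%N else 0) * Z b i r p
   + (E a a 0%N * Z b i q p) *+ (a == b))); last first.
  move=> b _.
  rewrite (eq_bigr (fun r : 'I_P => (if (r <= q)%N then - Lplus E a b (q - r)%N else 0) * Z b i r p
     + ((E a a 0%N * Z b i r p) *+ (a == b)) *+ (q == r))); last first.
    move=> r _; rewrite -(val_eqE q r) /= (eqn_leq q r) [(q <= r)%N && _]andbC.
    case: (leqP r q) => rq; last by rewrite mul0rn !mul0r mulr0n addr0.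
    rewrite LplusE subn_eq0 mulrBl; case: (a == b); case: (q <= r)%N; rewrite ?mulr0n ?mulr1n ?mul0r; ncring.
  by rewrite big_split sum_delta.
rewrite big_split sum_delta hz cE -!addrA; congr (_ + _).
have nz (n : nat) : n%:R = 1 *~ n%:Z :> A by rewrite pmulrn.
have ct (X u v w : A) : X + (u + (- X - v + w)) = u - v + w by ncring.
rewrite nz mulrBr mulrN mulrzAr mulr1 ct -mulrzBr -!mulrzDr; congr (_ *~ _).
(* The sum of all shifts, 2 (a - (i < a)) - 2 a + 1 - (i = a), is the sign of i - a. *)
rewrite /jshift /spap -val_eqE /=; case: (ltngtP i a) => ia.
- by rewrite ltr0_sgz ?subr_lt0 ?ltz_nat //; lia.
- by rewrite gtr0_sgz ?subr_gt0 ?ltz_nat //; lia.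
- have -> : sgz ((i : nat)%:Z - (a : nat)%:Z) = 0 by rewrite ia subrr.
  by clear -ia; lia.
Qed.

(** Evaluation at 1 turns a composition of twisted operators into a product in [A] only if the inner
    value can be pulled out on the right. The coefficients of [thpap] qualify because they have
    weight zero. *)
Lemma twist_rm x m (i j : 'I_N) (q p : 'I_P) y (v : A) : (forall a, c a * y = y * c a) ->
  (xmx (lop P twist) x ^+ m) i j q p (v * y) = (xmx (lop P twist) x ^+ m) i j q p v * y.
Proof.
move=> cy; pose cr (f : endo A) := f * rmE y = rmE y * f.
have cr0 : cr 0 by rewrite /cr mulr0 mul0r.
have crD f g : cr f -> cr g -> cr (f + g) by rewrite /cr mulrDr mulrDl => -> ->.
have crM f g : cr f -> cr g -> cr (f * g) by rewrite /cr mulrA => <- h; rewrite -!mulrA h.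
have crsum (I : Type) (r : seq I) (F : I -> endo A) : (forall t, cr (F t)) -> cr (\sum_(t <- r) F t).
  by move=> h; elim: r => [|t r IH]; rewrite ?big_nil ?big_cons //; apply: crD.
have crn (f : endo A) n : cr f -> cr (f *+ n) by move=> h; elim: n => [|n IH]; rewrite ?mulrS //; apply: crD.
have crN f : cr f -> cr (- f) by rewrite /cr mulrN mulNr => ->.
have cr1 : cr 1 by rewrite /cr mul1r mulr1.
have crz (f : endo A) (z : int) : cr f -> cr (f *~ z).
  by move=> h; case: z => n; rewrite ?NegzE ?mulrNz -pmulrn; [|apply: crN]; apply: crn.
have crE a b n : cr (emask twist a b n).
  rewrite /emask; case: ifP => // _; apply: crD; first by apply: endoP => z; apply: mulrA.
  by apply: crn; apply: endoP => z; rewrite /= -!mulrA cy.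
suff H a b q' p' : cr ((xmx (lop P twist) x ^+ m) a b q' p').
  by have := congr1 (fun f : endo A => f v) (H i j q p).
elim: m a q' => [|m IH] a q'.
  by rewrite expr0 !mxE; case: (a == b); rewrite !mxE ?mulr1n ?mulr0n //; case: (q' == p').
rewrite exprS mul_xmx mxE summxE; apply: (crD); last first.
  have -> : ((xmx (lop P twist) x ^+ m) a b *~ x a) q' p' = (xmx (lop P twist) x ^+ m) a b q' p' *~ x a.
    by case: (x a) => n; rewrite ?NegzE ?mulrNz -!pmulrn ?mxE mulmxnE.
  exact: crz.
apply: (crsum) => d; rewrite mxE; apply: (crsum) => r; apply: (crM) => //.
rewrite /lop !mxE mulmxnE !mxE; apply: (crD); first by case: ifP.
by apply/crn/crn/crn.
Qed.

Theorem thpap_comm m m' (q p q' p' : 'I_P) :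
  thpap m q p * thpap m' q' p' = thpap m' q' p' * thpap m q p.
Proof.
have th1 k (a b : 'I_P) : thop P twist k a b 1 *+ 2 ^ k = thpap k a b.
  rewrite /thop /thpap !summxE endo_sumE -sumrMnl.
  by apply: eq_bigr => i _; rewrite twist_pap.
have cth k (a b : 'I_P) d : c d * thpap k a b = thpap k a b * c d.
  have h : E d d 0%N * thpap k a b = thpap k a b * E d d 0%N.
    rewrite /thpap summxE mulr_sumr mulr_suml; apply: eq_bigr => i _.
    by rewrite hasw_xmx subrr mulr0z addr0.
  apply/eqP; rewrite -subr_eq0; apply/eqP; apply: tf2.
  transitivity ((c d *+ 2) * thpap k a b - thpap k a b * (c d *+ 2)); first by ncring.
  by rewrite cE mulrBl mulrBr mulNr mulrN h mulr_natl mulr_natr subrr.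
have thm k k' (a b a' b' : 'I_P) : thop P twist k a b (thpap k' a' b') *+ 2 ^ k = thpap k a b * thpap k' a' b'.
  rewrite -(th1 k a b) -[X in thop P twist k a b X]mul1r mulrnAl; congr (_ *+ _).
  rewrite /thop !summxE !endo_sumE mulr_suml; apply: eq_bigr => i _.
  apply: twist_rm => d; rewrite -summxE; exact: cth.
have eMn (f : endo A) x n : f (x *+ n) = f x *+ n.
  by elim: n => [|n IH]; rewrite ?mulr0n ?efun0 // !mulrS efunD IH.
have h := congr1 (fun f : endo A => f 1 *+ 2 ^ m *+ 2 ^ m') (@thop_comm N P m m' q p q' p' _ _ twist_lie).
rewrite /= in h.
rewrite -[LHS]thm -[in LHS](th1 m' q' p') eMn mulrnAC h.
by rewrite -eMn th1 thm.
Qed.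

End Passage.

(** * The action of differential operators on power series *)

Section Series.
Variable A : pzRingType.
Implicit Types f g h : series A.

Lemma toep_smul P f g : toep P f * toep P g = toep P (smul f g).
Proof.
rewrite toepM; apply/matrixP => q p; rewrite !mxE; case: ifP => // _.
rewrite (reindex_inj rev_ord_inj) /=; apply: eq_bigr => r _.
by rewrite subSS subKn // -ltnS.
Qed.

Lemma smulA f g h : smul f (smul g h) = smul (smul f g) h.
Proof.
(* Associativity is inherited from Toeplitz matrices of order [n.+1], whose lower left corner holds
   the coefficient of degree [n]. *)
apply: funext => n; have /matrixP /(_ ord_max ord0) := mulrA (toep n.+1 f) (toep n.+1 g) (toep n.+1 h).
by rewrite !toep_smul !mxE /= subn0.
Qed.

Lemma smul1 f : smul s1 f = f.
Proof.
apply: funext => n; rewrite /smul big_ord_recl subn0 /= mul1r big1 ?addr0 // => i _.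
by rewrite /s1 mul0r.
Qed.

Lemma smul0 f n : smul s0 f n = 0.
Proof. by rewrite /smul big1 // => i _; rewrite mul0r. Qed.

Lemma smul_suml (I : Type) (r : seq I) (Q : pred I) (F : I -> series A) g n :
  smul (fun n => \sum_(i <- r | Q i) F i n) g n = \sum_(i <- r | Q i) smul (F i) g n.
Proof. by rewrite exchange_big; apply: eq_bigr => j _; rewrite mulr_suml. Qed.

Lemma smul_sumr (I : Type) (r : seq I) (Q : pred I) f (F : I -> series A) n :
  smul f (fun n => \sum_(i <- r | Q i) F i n) n = \sum_(i <- r | Q i) smul f (F i) n.
Proof. by rewrite exchange_big; apply: eq_bigr => j _; rewrite mulr_sumr. Qed.

Lemma smulMnl f g k n : smul (fun n => f n *+ k) g n = smul f g n *+ k.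
Proof. by rewrite /smul -sumrMnl; apply: eq_bigr => i _; rewrite mulrnAl. Qed.

Lemma smulMnr f g k n : smul f (fun n => g n *+ k) n = smul f g n *+ k.
Proof. by rewrite /smul -sumrMnl; apply: eq_bigr => i _; rewrite mulrnAr. Qed.

Lemma smulMzr f g (z : int) n : smul f (fun n => g n *~ z) n = smul f g n *~ z.
Proof. by rewrite /smul mulrz_suml; apply: eq_bigr => i _; rewrite mulrzAr. Qed.

Lemma sderM f g n : sder (smul f g) n = smul (sder f) g n + smul f (sder g) n.
Proof.
rewrite /sder /smul -sumrMnl.
rewrite (eq_bigr (fun i : 'I_n.+2 => f i *+ i * g (n.+1 - i)%N + f i * (g (n.+1 - i)%N *+ (n.+1 - i)))); last first.
  by move=> i _; rewrite mulrnAl mulrnAr -mulrnDr subnKC // -ltnS.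
rewrite big_split /= big_ord_recl mulr0n mul0r add0r; congr (_ + _).
rewrite big_ord_recr /= subnn mulr0n mulr0 addr0; apply: eq_bigr => i _.
by rewrite subSn // -ltnS.
Qed.

Lemma iter_sder_sum (I : Type) (r : seq I) (Q : pred I) (F : I -> series A) k :
  iter k sder (fun n => \sum_(i <- r | Q i) F i n) = fun n => \sum_(i <- r | Q i) iter k sder (F i) n.
Proof. by elim: k => // k IH; apply: funext => n; rewrite iterS IH /sder -sumrMnl. Qed.

Lemma iter_sderMz k g (z : int) : iter k sder (fun n => g n *~ z) = fun n => iter k sder g n *~ z.
Proof. by elim: k => // k IH; apply: funext => n; rewrite iterS IH /sder /= !pmulrn mulrzAC. Qed.

Lemma leibniz f g p n : iter p sder (smul f g) n =
  \sum_(j < p.+1) smul (iter j sder f) (iter (p - j) sder g) n *+ 'C(p, j).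
Proof.
elim: p n => [|p IH] n; first by rewrite big_ord1 mulr1n.
rewrite iterS (_ : iter p _ _ = fun n => \sum_(j < p.+1) smul (iter j sder f) (iter (p - j) sder g) n *+ 'C(p, j)); last exact: funext.
pose G a b := smul (iter a sder f) (iter b sder g) n.
transitivity (\sum_(j < p.+1) (G j.+1 (p - j)%N + G j (p - j).+1) *+ 'C(p, j)).
  rewrite /sder -sumrMnl; apply: eq_bigr => j _.
  by rewrite mulrnAC; congr (_ *+ _); apply: sderM.
rewrite (eq_bigr _ (fun j _ => mulrnDl _ _ _)) big_split /=.
rewrite [X in _ + X]big_ord_recl [RHS]big_ord_recl /= !subn0 !bin0.
rewrite [in RHS](eq_bigr (fun j : 'I_p.+1 => G j.+1 (p - j)%N *+ 'C(p, j) + G j.+1 (p - j)%N *+ 'C(p, j.+1))); last first.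
  by move=> j _; rewrite /bump /= add1n subSS binS mulrnDr addrC.
rewrite [in RHS]big_split /= [in X in _ = _ + (_ + X)]big_ord_recr /= bin_small // mulr0n addr0 addrCA.
congr (_ + (_ + _)); apply: eq_bigr => j _.
by rewrite /bump /= add1n -subSn // subSS.
Qed.

(** Differential operators are handled through their action on series, where [dmul] becomes
    composition; [comm_dcoef] returns to the coefficients. *)
Definition dact (D : dop A) g : series A := fun r =>
  \sum_(k < size D) smul (dcoef D k) (iter k sder g) r.

Lemma dactW D g r n : (size D <= n)%N ->
  dact D g r = \sum_(k < n) smul (dcoef D k) (iter k sder g) r.
Proof.
move=> h; rewrite /dact (big_ord_widen n (fun k => smul (dcoef D k) (iter k sder g) r)) // [RHS](bigID (fun k : 'I_n => (k < size D)%N)) /=.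
rewrite [X in _ = _ + X]big1 ?addr0 // => k; rewrite -leqNgt => hk.
by rewrite /dcoef nth_default // smul0.
Qed.

Lemma dact_dadd D D' g r : dact (dadd D D') g r = dact D g r + dact D' g r.
Proof.
rewrite (dactW g r (leq_maxl (size D) (size D'))) (dactW g r (leq_maxr (size D) (size D'))).
rewrite /dact size_mkseq -big_split; apply: eq_bigr => k _ /=.
rewrite {1}/dcoef nth_mkseq // /smul -big_split; apply: eq_bigr => i _ /=.
by rewrite /sadd mulrDl.
Qed.

Lemma dact_dzero g r : dact dzero g r = 0.
Proof. by rewrite /dact big_ord0. Qed.

Lemma dact_done g : dact done g = g.
Proof. by apply: funext => r; rewrite /dact big_ord1 /dcoef /= smul1. Qed.

Lemma dact_big (I : Type) (s : seq I) (F : I -> dop A) g r :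
  dact (\big[dadd/dzero]_(i <- s) F i) g r = \sum_(i <- s) dact (F i) g r.
Proof. exact: (big_morph (fun D => dact D g r) (fun D D' => dact_dadd D D' g r) (dact_dzero g r)). Qed.

Lemma dact_dscal (z : int) D g r : dact (dscal z D) g r = dact D g r *~ z.
Proof.
rewrite /dact size_map mulrz_suml; apply: eq_bigr => k _.
rewrite /dcoef (nth_map s0) // /smul mulrz_suml; apply: eq_bigr => i _.
by rewrite -mulrA mulrzl.
Qed.

Lemma dact_sum (I : Type) (s : seq I) (Q : pred I) D (F : I -> series A) r :
  dact D (fun n => \sum_(i <- s | Q i) F i n) r = \sum_(i <- s | Q i) dact D (F i) r.
Proof.
rewrite /dact [RHS]exchange_big; apply: eq_bigr => k _.
by rewrite iter_sder_sum smul_sumr.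
Qed.

Lemma dactMz D g (z : int) r : dact D (fun n => g n *~ z) r = dact D g r *~ z.
Proof.
by rewrite /dact mulrz_suml; apply: eq_bigr => k _; rewrite iter_sderMz smulMzr.
Qed.

Lemma dact_dmul D D' g : dact (dmul D D') g = dact D (dact D' g).
Proof.
apply: funext => r.
transitivity (\sum_(p < size D) \sum_(q < size D') \sum_(j < p.+1)
   smul (smul (dcoef D p) (iter j sder (dcoef D' q))) (iter (p + q - j) sder g) r *+ 'C(p, j)).
  rewrite /dact size_mkseq.
  under eq_bigr => k _ do rewrite {1}/dcoef nth_mkseq // smul_suml.
  rewrite exchange_big; apply: eq_bigr => p _.
  under eq_bigr => k _ do rewrite smul_suml.
  rewrite exchange_big; apply: eq_bigr => q _.
  under eq_bigr => k _ do rewrite smul_suml.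
  rewrite exchange_big; apply: eq_bigr => j _.
  have hk : (p + q - j < size D + size D')%N.
    by have := ltn_ord p; have := ltn_ord q; clear; lia.
  rewrite (bigD1 (Ordinal hk)) //= eqxx smulMnl big1 ?addr0 // => k.
  rewrite -val_eqE eq_sym /= => /negPf ->.
  exact: smul0.
rewrite {1}/dact; apply: eq_bigr => p _.
rewrite (_ : dact D' g = fun n => \sum_(q < size D') smul (dcoef D' q) (iter q sder g) n) //.
rewrite iter_sder_sum smul_sumr; apply: eq_bigr => q _.
rewrite (_ : iter p sder _ = fun n => \sum_(j < p.+1) smul (iter j sder (dcoef D' q)) (iter (p - j) sder (iter q sder g)) n *+ 'C(p, j)); last by apply: funext => n; apply: leibniz.
rewrite smul_sumr; apply: eq_bigr => j _.
rewrite smulMnr smulA -iterD; congr (smul _ (iter _ _ _) _ *+ _).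
by have := ltn_ord j; clear; lia.
Qed.

End Series.

(** * The product of the T operators as a weighted cycle *)

Lemma smulC (f g : series int) : smul f g = smul g f.
Proof.
apply: funext => n; rewrite /smul (reindex_inj rev_ord_inj) /=.
by apply: eq_bigr => i _; rewrite subSS subKn -1?ltnS // mulrC.
Qed.

HB.instance Definition _ := Monoid.isComLaw.Build (series int) s1 smul
  (@smulA int) smulC (@smul1 int).

Lemma smul_if (b1 b2 : bool) (f g : series int) :
  smul (if b1 then f else s0) (if b2 then g else s0) = if b1 && b2 then smul f g else s0.
Proof.
case: b1; case: b2 => //=; last by apply: funext => n; rewrite smul0.
  by rewrite smulC; apply: funext => n; rewrite smul0.
by apply: funext => n; rewrite smul0.
Qed.

Lemma coordE N s (K : mi N s) (a : 'I_s) i : coord K a i = (K a == i).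
Proof.
apply/existsP/idP => [[c /andP[/eqP /val_inj -> //]]|h].
by exists a; rewrite eqxx.
Qed.

Lemma agree_offP N s (Q : pred nat) (K K' : mi N s) :
  reflect (forall c : 'I_s, ~~ Q c -> K c = K' c) (agree_off Q K K').
Proof.
apply: (iffP forallP) => h c; first by move=> q; have := h c; rewrite q => /eqP.
by apply/implyP => q; apply/eqP; apply: h.
Qed.

Lemma sum_if1 (V : nmodType) (I : finType) (F : I -> V) (i0 : I) :
  \sum_i (if i0 == i then F i else 0) = F i0.
Proof. by rewrite -[RHS](sum_delta i0 F); apply: eq_bigr => i _; rewrite mulrb. Qed.

Lemma TopE N s (a b : 'I_s) (K K' : mi N s) n : a != b ->
  Top a b K K' n = if [&& K a == K' b, K b == K' a & agree_off (pred2 (a : nat) b) K K']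
                   then tcoef (K a) (K b) n else 0.
Proof.
move=> ab; rewrite /Top.
pose L0 : mi N s := [ffun c => if c == a then K' c else K c].
have L0P i j L : [&& coord K a i, coord L a j & agree_off (pred1 (a : nat)) K L] &&
    [&& coord L b j, coord K' b i & agree_off (pred1 (b : nat)) L K'] =
    (L0 == L) && [&& K a == i, K b == j, K a == K' b, K b == K' a & agree_off (pred2 (a : nat) b) K K'].
  rewrite !coordE; apply/andP/andP => [[/and3P[/eqP h1 /eqP h2 /agree_offP h3] /and3P[/eqP h4 /eqP h5 /agree_offP h6]]|].
    have hL : L0 = L.
      apply/ffunP => c; rewrite ffunE; case: (c =P a) => [->|/eqP ca].
        by rewrite h6.
      by rewrite h3.
    have La : L a = K' a by rewrite h6.
    have Lb : L b = K b by rewrite h3 //= eq_sym.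
    split; first by rewrite hL.
    rewrite h1 h5 -Lb h4 -La h2 !eqxx; apply/agree_offP => c /norP[ca cb].
    by rewrite h3 // h6.
  case=> [/eqP <-] /and5P[/eqP <- /eqP <- /eqP h1 /eqP h2 /agree_offP h3].
  rewrite !ffunE [b == a]eq_sym (negPf ab) !eqxx h1 h2 !eqxx /=.
  split; apply/agree_offP => c cn; rewrite ffunE.
    by case: (c =P a) cn => [-> /=|//]; rewrite eqxx.
  by case: (c =P a) => // /eqP ca; rewrite h3 //= negb_or ca.
have X i j : smatmul (eop a i j) (eop b j i) K K' =
   if [&& K a == i, K b == j, K a == K' b, K b == K' a & agree_off (pred2 (a : nat) b) K K'] then s1 else s0.
  apply: funext => k; rewrite /smatmul /eop.
  under eq_bigr => L _ do rewrite smul_if L0P smul1 (if_and (L0 == L)) (fun_if (@^~ k)).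
  by rewrite sum_if1.
transitivity (\sum_i (if K a == i then \sum_j (if K b == j then
  (if [&& K a == K' b, K b == K' a & agree_off (pred2 (a : nat) b) K K'] then tcoef i j n else 0) else 0) else 0)).
  apply: eq_bigr => i _; rewrite (eq_bigr (fun j => if K a == i then if K b == j then
    (if [&& K a == K' b, K b == K' a & agree_off (pred2 (a : nat) b) K K'] then tcoef i j n else 0) else 0 else 0)).
    by case: (K a == i) => //; rewrite big1.
  move=> j _; rewrite X smulC.
  case: (K a == i); case: (K b == j); rewrite /= ?smul0 //.
  by case: ([&& _, _ & _]); rewrite ?smul0 ?smul1.
by rewrite !sum_if1.
Qed.

Definition cyc N s (t : nat) (K : mi N s.+1) : mi N s.+1 :=
  [ffun c : 'I_s.+1 => if (c < t)%N then K (inord c.+1)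
                       else if (c : nat) == t then K ord0 else K c].

(** Each factor exchanges two neighbouring copies with weight [tcoef], so the product is a cycle.
    The index [K' ord0] travels through all the factors and meets every other moved index once,
    which gives the weight. *)
Lemma Tprod_cyc N s t (K K' : mi N s.+1) : (t <= s)%N ->
  (\big[smatmul/smatid]_(a <- rev (iota 0 t)) Top a a.+1) K K' =
  if K == cyc t K' then \big[smul/s1]_(a <- iota 1 t) tcoef (K' (inord a)) (K' ord0) else s0.
Proof.
elim: t K => [|t IH] K ts.
  rewrite !big_nil /smatid; congr (if K == _ then _ else _).
  apply/ffunP => c; rewrite ffunE /=; case: eqP => // c0.
  by congr (K' _); apply: val_inj.
have -> : rev (iota 0 t.+1) = t :: rev (iota 0 t).
  by rewrite -[in LHS](addn1 t) iotaD add0n rev_cat.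
rewrite big_cons {1}/smatmul; apply: funext => n.
have -> : iota 1 t.+1 = rcons (iota 1 t) t.+1 by rewrite -[in LHS](addn1 t) iotaD cats1 add1n.
rewrite -cats1 big_cat big_seq1 /=.
set B := \big[smul/s1]_(a <- iota 1 t) _ in IH *.
pose oa : 'I_s.+1 := inord t; pose ob : 'I_s.+1 := inord t.+1.
have va : (oa : nat) = t by rewrite inordK // ltnS ltnW.
have vb : (ob : nat) = t.+1 by rewrite inordK.
rewrite (eq_bigr (fun L => if cyc t K' == L then smul (Top t t.+1 K L) B n else 0)); last first.
  move=> L _; rewrite IH; last exact: ltnW.
  by rewrite [L == _]eq_sym; case: ifP => // _; rewrite smulC smul0.
rewrite sum_if1.
have ab : oa != ob by rewrite -val_eqE /= va vb; clear; lia.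
have -> : Top t t.+1 K (cyc t K') = if K == cyc t.+1 K' then tcoef (K' ob) (K' ord0) else s0.
  apply: funext => k; have := @TopE N s.+1 oa ob K (cyc t K') k ab; rewrite va vb => ->.
  have -> : cyc t K' oa = K' ord0 by rewrite ffunE va ltnn eqxx.
  have -> : cyc t K' ob = K' ob by rewrite ffunE vb ltnNge leqnSn /= (gtn_eqF (ltnSn t)).
  have -> : [&& K oa == K' ob, K ob == K' ord0 & agree_off (pred2 t t.+1) K (cyc t K')] = (K == cyc t.+1 K').
    apply/and3P/eqP => [[/eqP h1 /eqP h2 /agree_offP h3]|->].
      apply/ffunP => c; rewrite ffunE.
      case: (ltngtP c t.+1) => ct; last first.
      - by rewrite -h2; congr (K _); apply: val_inj; exact: etrans ct (esym vb).
      - rewrite h3 ?ffunE /=; last by rewrite negb_or; apply/andP; split; apply/eqP; move: ct; clear; lia.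
        by case: (ltngtP c t) => //; move: ct; clear; lia.
      case: (ltngtP c t) => ct'; last first.
      - have -> : c = oa by apply: val_inj; exact: etrans ct' (esym va).
        by rewrite h1 va.
      - by move: ct ct'; clear; lia.
      rewrite h3 ?ffunE ?ct' //=.
      by rewrite negb_or; apply/andP; split; apply/eqP; move: ct'; clear; lia.
    rewrite !ffunE va vb ltnSn ltnn !eqxx; split=> //.
    apply/agree_offP => c /norP[/= /eqP c1 /eqP c2]; rewrite !ffunE.
    rewrite ltnS leq_eqVlt; move/eqP/negPf: c1 => ->; move/eqP/negPf: c2 => -> /=.
    by [].
  case: eqP => // e; rewrite e !ffunE va vb ltnSn ltnn eqxx //.
by rewrite smulC; case: ifP => // _; rewrite smulC smul0.
Qed.

Lemma nth_codom_ord N s (K : mi N s) (c : 'I_s) d : nth d (codom K) c = K c.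
Proof. by rewrite (nth_map c) ?size_enum_ord // nth_ord_enum. Qed.

Section ThetaAction.
Variables (A : pzRingType) (N : nat) (E : 'I_N -> 'I_N -> nat -> A).

Lemma dact_Lop s (a : 'I_s) (K L : mi N s) g r :
  dact (Lop E a K L) g r =
  if agree_off (pred1 (a : nat)) K L then dact (Lentry E (K a) (L a)) g r else 0.
Proof.
rewrite /Lop dact_big.
under eq_bigr => i _ do rewrite dact_big.
transitivity (\sum_i (if K a == i then \sum_j (if L a == j then
  (if agree_off (pred1 (a : nat)) K L then dact (Lentry E i j) g r else 0) else 0) else 0)).
  apply: eq_bigr => i _; rewrite (eq_bigr (fun j => if K a == i then if L a == j then
    (if agree_off (pred1 (a : nat)) K L then dact (Lentry E i j) g r else 0) else 0 else 0)).
    by case: (K a == i) => //; rewrite big1.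
  move=> j _; rewrite !coordE; case: (K a == i); case: (L a == j); rewrite /= ?dact_dzero //.
  by case: agree_off; rewrite ?dact_dzero.
by rewrite !sum_if1.
Qed.

Definition lfold (d : 'I_N) s (K K' : mi N s) b k g : series A :=
  foldr (fun a h => dact (Lentry E (nth d (codom K) a) (nth d (codom K') a)) h) g (iota b k).

Lemma eq_lfold d s (K L K' : mi N s) b k g : (b + k = s)%N ->
  (forall c : 'I_s, (b <= c)%N -> K c = L c) -> lfold d K K' b k g = lfold d L K' b k g.
Proof.
elim: k b => // k IH b bk h; rewrite /lfold /= -!/(lfold _ _ _ _ _ _).
have bs : (b < s)%N by move: bk; clear; lia.
rewrite -[b]/(val (Ordinal bs)) !nth_codom_ord h //= IH ?addSnnS //.
by move=> c bc; apply: h; apply: ltnW.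
Qed.

Lemma dact0 (D : dop A) r : dact D (fun=> 0) r = 0.
Proof. by have := dactMz D (fun=> 0) 0 r; rewrite !mulr0z. Qed.

Lemma Lprod_tail d s k b (K K' : mi N s) g r : (b + k = s)%N ->
  dact ((\big[dmatmul/dmatid]_(a <- iota b k) Lop E a) K K') g r =
  if agree_off (fun c => (b <= c)%N) K K' then lfold d K K' b k g r else 0.
Proof.
elim: k b K r => [|k IH] b K r bk.
  rewrite big_nil /dmatid.
  have -> : agree_off (fun c => (b <= c)%N) K K' = (K == K').
    apply/agree_offP/eqP => [h|-> //]; apply/ffunP => c; apply: h.
    by rewrite -ltnNge; have := ltn_ord c; move: bk; clear; lia.
  by case: ifP; rewrite ?dact_dzero // dact_done.
have bs : (b < s)%N by move: bk; clear; lia.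
pose ob := Ordinal bs; rewrite [iota b _]/= big_cons {1}/dmatmul dact_big.
pose L0 : mi N s := [ffun c => if c == ob then K' c else K c].
rewrite (eq_bigr (fun L => if L0 == L then if agree_off (fun c => (b <= c)%N) K K'
   then dact (Lentry E (K ob) (L ob)) (lfold d L K' b.+1 k g) r else 0 else 0)); last first.
  move=> L _; rewrite dact_dmul.
  rewrite (_ : dact _ g = fun r => if agree_off (fun c => (b.+1 <= c)%N) L K' then lfold d L K' b.+1 k g r else 0); last first.
    by apply: funext => r'; apply: IH; rewrite addSnnS.
  have := @dact_Lop s ob K L; rewrite /= => ->.
  have H : agree_off (pred1 b) K L && agree_off (fun c => (b.+1 <= c)%N) L K' =
     (L0 == L) && agree_off (fun c => (b <= c)%N) K K'.
    apply/andP/andP => [[/agree_offP h1 /agree_offP h2]|[/eqP <- /agree_offP h]].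
      have e : L0 = L.
        apply/ffunP => c; rewrite ffunE; case: (c =P ob) => [->|/eqP cb]; first by rewrite h2 //= ltnn.
        by rewrite h1.
      split; first by rewrite e.
      apply/agree_offP => c; rewrite -ltnNge => cb.
      rewrite h1 /=; last by rewrite neq_ltn cb.
      by rewrite h2 // -leqNgt ltnW.
    split; apply/agree_offP => c; rewrite ffunE.
      by case: (c =P ob) => [-> /=|//]; rewrite eqxx.
    case: (c =P ob) => // /eqP cb cb'; apply: h; move: cb cb'; rewrite -val_eqE /=; clear; lia.
  rewrite -if_and -H; case: (agree_off (pred1 b) K L) => //=.
  by case: (agree_off _ L K') => //; rewrite dact0.
rewrite sum_if1; case: ifP => // _.
have -> : lfold d L0 K' b.+1 k g = lfold d K K' b.+1 k g.
  apply: eq_lfold; first by rewrite addSnnS.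
  by move=> c bc; rewrite ffunE -val_eqE /= (gtn_eqF bc).
rewrite /L0 ffunE eqxx [in RHS]/lfold /= -/(lfold _ _ _ _ _ _).
by rewrite -[X in nth d (codom K) X]/(val ob) -[X in nth d (codom K') X]/(val ob) !nth_codom_ord.
Qed.

Fixpoint pact (i : 'I_N) (l : seq 'I_N) (g : series A) : series A :=
  if l is a :: l' then dact (Lentry E a (head i l')) (pact i l' g) else g.

Definition ptc (i : 'I_N) (l : seq 'I_N) : series int := \big[smul/s1]_(a <- l) tcoef a i.

(** Along the cycle the column index of one factor is the row index of the next, so the trace
    becomes a sum over closed paths based at [K ord0]. *)
Lemma Lprod_cyc s (K : mi N s.+1) g r :
  dact (Lprod E K (cyc s K)) g r = pact (K ord0) (codom K) g r.
Proof.
rewrite /Lprod -(big_mkord xpredT (fun a => Lop E a)) /index_iota subn0.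
rewrite (Lprod_tail (K ord0)) ?add0n //.
have -> : agree_off (fun c => (0 <= c)%N) K (cyc s K) by apply/agree_offP.
suff H k b : (b + k = s.+1)%N -> lfold (K ord0) K (cyc s K) b k g = pact (K ord0) (drop b (codom K)) g.
  by rewrite H // drop0.
have sz : size (codom K) = s.+1 by rewrite size_codom card_ord.
elim: k b => [|k IH] b bk; first by rewrite drop_oversize // sz -bk addn0.
have bs : (b < s.+1)%N by move: bk; clear; lia.
rewrite (drop_nth (K ord0)) ?sz // [lfold _ _ _ _ _ _]/lfold /= -/(lfold _ _ _ _ _ _) IH ?addSnnS //.
congr (dact (Lentry E _ _) _).
rewrite -nth0 nth_drop addn0 -[X in nth _ (codom (cyc _ _)) X]/(val (Ordinal bs)) nth_codom_ord ffunE /=.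
case: ltnP => h; first by rewrite -(nth_codom_ord K _ (K ord0)) inordK.
have eb : b = s by move: h bs; clear; lia.
by rewrite {1}eb eqxx nth_default // sz eb.
Qed.

Lemma codomS s (K : mi N s.+1) : codom K = K ord0 :: [seq K (inord a) | a <- iota 1 s].
Proof.
apply: (@eq_from_nth _ (K ord0)) => [|a]; first by rewrite size_codom card_ord /= size_map size_iota.
rewrite size_codom card_ord => h; rewrite -[X in nth _ (codom K) X]/(val (Ordinal h)) nth_codom_ord.
case: a h => [|a] h /=; first by congr (K _); apply: val_inj.
rewrite (nth_map 0%N) ?size_iota // nth_iota //; congr (K _); apply: val_inj => /=.
by rewrite inordK.
Qed.

Lemma dact_theta m g r : dact (theta E m) g r =
  \sum_(s < m) \sum_(K : mi N s.+1)
    pact (K ord0) (codom K) g r *~ ptc (K ord0) (codom K) (m - s.+1)%N.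
Proof.
rewrite /theta dact_big big_add1 /= big_mkord; apply: eq_bigr => s _.
rewrite dact_big; under eq_bigr => K _ do rewrite dact_big.
rewrite exchange_big; apply: eq_bigr => K' _ /=.
rewrite (eq_bigr (fun K => if cyc s K' == K then
   pact (K' ord0) (codom K') g r *~ ptc (K' ord0) (codom K') (m - s.+1)%N else 0)); first by rewrite sum_if1.
move=> K _; rewrite dact_dscal /Tprod /= Tprod_cyc // [K == _]eq_sym.
case: eqP => [<-|_]; last by rewrite mulr0z.
rewrite Lprod_cyc /ptc codomS big_cons big_map.
have -> : tcoef (K' ord0) (K' ord0) = s1 by rewrite /tcoef eqxx.
by rewrite smul1.
Qed.

End ThetaAction.

(** * Resummation of the path sums *)

Lemma sum_mi0 (V : nmodType) N (F : seq 'I_N -> V) : \sum_(K : mi N 0) F (codom K) = F [::].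
Proof.
rewrite (eq_bigr (fun=> F [::])); last first.
  by move=> K _; congr F; apply: size0nil; rewrite size_codom card_ord.
by rewrite sumr_const card_ffun !card_ord expn0.
Qed.

Lemma sum_miS (V : nmodType) N s (F : seq 'I_N -> V) :
  \sum_(K : mi N s.+1) F (codom K) = \sum_x \sum_(K : mi N s) F (x :: codom K).
Proof.
pose h (u : 'I_N * mi N s) : mi N s.+1 := [ffun c => oapp u.2 u.1 (unlift ord0 c)].
pose h' (K : mi N s.+1) : 'I_N * mi N s := (K ord0, [ffun c => K (lift ord0 c)]).
have hK : cancel h h'.
  move=> [x K]; rewrite /h /h' ffunE unlift_none; congr (_, _); apply/ffunP => c.
  by rewrite !ffunE liftK.
have hK' : cancel h' h.
  by move=> K; apply/ffunP => c; rewrite ffunE; case: unliftP => [c'|] -> /=; rewrite ?ffunE.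
rewrite pair_bigA /= (reindex h) /=; last by apply: onW_bij; exists h'.
apply: eq_bigr => -[x K] _ /=; congr F.
rewrite /codom /image_mem enum_ordSl /= /h ffunE unlift_none /= -map_comp; congr (_ :: _).
by apply: eq_map => c /=; rewrite ffunE liftK.
Qed.

Lemma smul_tcoef0 N (a i : 'I_N) f : smul (tcoef a i) f 0 = f 0%N.
Proof.
rewrite /smul big_ord1 /= /tcoef.
by case: (a == i); [|case: (a < i)%N]; rewrite /s1 /= ?expr0 mul1r.
Qed.

(** The series [tcoef a i] is the geometric series of 1 / (1 - sgn(i - a) y), also for [a = i],
    where the sign is zero. *)
Lemma smul_tcoefS N (a i : 'I_N) f n :
  smul (tcoef a i) f n.+1 = f n.+1 + spap i a * smul (tcoef a i) f n.
Proof.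
rewrite /smul big_ord_recl mulr_sumr subn0; congr (_ + _).
  rewrite /tcoef.
  by case: (a == i); [|case: (a < i)%N]; rewrite /s1 /= ?expr0 mul1r.
apply: eq_bigr => j _; rewrite mulrA subSS; congr (_ * _).
rewrite /= /bump /= add1n /tcoef /spap -val_eqE /=; case: (ltngtP a i) => ai.
- by rewrite gtr0_sgz ?subr_gt0 ?ltz_nat.
- by rewrite ltr0_sgz ?subr_lt0 ?ltz_nat // exprS.
- by rewrite ai subrr sgz0 mul0r.
Qed.

Section Resum.
Variables (A : pzRingType) (N : nat) (E : 'I_N -> 'I_N -> nat -> A) (i : 'I_N) (g : series A).

(* The sum over paths of length [s] from [a] to [i], at [y^n] in the product of the [T]'s. *)
Definition psum s a n : series A := fun r =>
  \sum_(K : mi N s) (pact E i (codom K) g r *~ ptc i (codom K) n) *+ (head i (codom K) == a).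

Lemma psum0 a n r : psum 0 a n r = g r *+ ((i == a) && (n == 0%N)).
Proof.
rewrite /psum (sum_mi0 (fun l => (pact E i l g r *~ ptc i l n) *+ (head i l == a))) /=.
rewrite /ptc big_nil /s1; case: (i == a); rewrite ?mulr0n ?mulr1n //=.
by case: (n == 0%N).
Qed.

Lemma psum_step s a n r : \sum_(K : mi N s)
    dact (Lentry E a (head i (codom K))) (pact E i (codom K) g) r *~ ptc i (codom K) n =
  \sum_b dact (Lentry E a b) (psum s b n) r.
Proof.
rewrite [RHS](eq_bigr (fun b => \sum_(K : mi N s)
   (dact (Lentry E a b) (pact E i (codom K) g) r *~ ptc i (codom K) n) *+ (head i (codom K) == b))); last first.
  move=> b _; rewrite /psum dact_sum; apply: eq_bigr => K _.
  by case: (_ == b); [apply: dactMz|apply: dact0].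
by rewrite exchange_big; apply: eq_bigr => K _; rewrite sum_delta.
Qed.

Lemma psumE s a n r : psum s.+1 a n r = \sum_(K : mi N s)
  dact (Lentry E a (head i (codom K))) (pact E i (codom K) g) r *~ smul (tcoef a i) (ptc i (codom K)) n.
Proof.
have := sum_miS s (fun l => (pact E i l g r *~ ptc i l n) *+ (head i l == a)); rewrite -/(psum _ _ _ _) => ->.
under eq_bigr => x _ do (rewrite /= sumrMnl eq_sym).
rewrite sum_delta; apply: eq_bigr => K _.
by rewrite /ptc big_cons.
Qed.

Lemma psumS0 s a r : psum s.+1 a 0 r = \sum_b dact (Lentry E a b) (psum s b 0) r.
Proof. by rewrite psumE -psum_step; apply: eq_bigr => K _; rewrite smul_tcoef0. Qed.

Lemma psumSS s a n r : psum s.+1 a n.+1 r =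
  \sum_b dact (Lentry E a b) (psum s b n.+1) r + psum s.+1 a n r *~ spap i a.
Proof.
rewrite !psumE -psum_step mulrz_suml -big_split; apply: eq_bigr => K _ /=.
by rewrite smul_tcoefS mulrzDr mulrC mulrzA.
Qed.

Definition rsum m a : series A := fun r => \sum_(s < m.+1) psum s a (m - s) r.

Lemma rsum0 a r : rsum 0 a r = g r *+ (i == a).
Proof. by rewrite /rsum big_ord1 psum0 andbT. Qed.

(** One unit of degree is spent either on an entry of [L], which moves the path, or on a term sgn(i
    - a) y, which stays at [a]; so [rsum] follows the powers of [L + S_i]. The empty path needs no
    correction because the sign at [a = i] is zero. *)
Lemma rsumS m a r : rsum m.+1 a r =
  \sum_b dact (Lentry E a b) (rsum m b) r + rsum m a r *~ spap i a.
Proof.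
rewrite /rsum big_ord_recl psum0 andbF mulr0n add0r.
rewrite (eq_bigr (fun b => \sum_(s < m.+1) dact (Lentry E a b) (psum s b (m - s)%N) r)); last first.
  by move=> b _; rewrite dact_sum.
rewrite exchange_big /= big_ord_recr [X in _ = X + _]big_ord_recr /= big_ord_recl /=.
rewrite /bump /= !add1n subSS !subnn psumS0 subn0 psum0.
have -> : (g r *+ ((i == a) && (m == 0%N)) + \sum_(s < m) psum (bump 0 s) a (m - bump 0 s) r) *~ spap i a =
   \sum_(s < m) psum s.+1 a (m - s.+1) r *~ spap i a.
  rewrite mulrzDl mulrz_suml; case: (i =P a) => [->|_]; last by rewrite mulr0n mul0rz add0r.
  by rewrite {1}/spap subrr sgz0 mulr0z add0r.
rewrite addrAC -big_split; congr (_ + _); apply: eq_bigr => s _ /=.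
rewrite /bump /= add1n subSS (_ : (m - s = (m - s.+1).+1)%N) ?psumSS //.
by have := ltn_ord s; clear; lia.
Qed.

Lemma dact_Lentry P (a b : 'I_N) h (q : 'I_P) : dact (Lentry E a b) h q =
  \sum_(r < P) (if (r <= q)%N then - Lplus E a b (q - r)%N else 0) * h r
  + (h q *~ (2 * q)%N%:Z) *+ (a == b).
Proof.
rewrite /dact big_ord_recl big_ord1 /dcoef /=; congr (_ + _).
  rewrite /smul (reindex_inj rev_ord_inj) /=.
  rewrite (big_ord_widen P (fun r => - Lplus E a b (q.+1 - r.+1)%N * h (q - (q.+1 - r.+1))%N)) // big_mkcond /=.
  apply: eq_bigr => r _; rewrite ltnS; case: leqP => rq; last by rewrite mul0r.
  by rewrite subSS subKn.
rewrite /smul; case: (a =P b) => /= [_|_]; last by rewrite big1 // => j _; rewrite mul0r.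
case: (nat_of_ord q) => [|n].
  by rewrite big_ord1 mul0r muln0 mulr0z.
rewrite big_ord_recl big_ord_recl /= !mul0r add0r big1 ?addr0 => [|j _]; last by rewrite mul0r.
by rewrite /bump /= /sder subSS subn0 mulr1n -pmulrn mulr_natl -mulrnA mulnC.
Qed.

Lemma rsum_entry P m (a : 'I_N) (q : 'I_P) :
  rsum m a q = \sum_(p < P) (xmx (lpap P E) (spap i) ^+ m) a i q p * g p.
Proof.
elim: m a q => [|m IH] a q.
  rewrite rsum0 expr0 (eq_bigr (fun p : 'I_P => (g p *+ (i == a)) *+ (q == p))) ?sum_delta // => p _.
  by rewrite !mxE eq_sym; case: (i == a); rewrite ?mxE; case: (q == p); rewrite ?mul0r ?mul1r ?mulr0n.
rewrite rsumS; under [RHS]eq_bigr => p _ do rewrite thpap_entry mulrDl mulr_suml.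
rewrite big_split /= exchange_big /=.
under eq_bigr => b _ do rewrite dact_Lentry.
rewrite big_split /= sum_delta -addrA -mulrzDr; congr (_ + _); last first.
  by rewrite IH mulrz_suml; apply: eq_bigr => p _; rewrite mulrzAl.
apply: eq_bigr => b _; under [RHS]eq_bigr => p _ do rewrite mulr_suml.
rewrite exchange_big; apply: eq_bigr => r _ /=.
by rewrite IH mulr_sumr; apply: eq_bigr => p _; rewrite mulrA.
Qed.

End Resum.

(** * Coefficients recovered from the action on monomials *)

Section Monomials.
Variables (A : pzRingType) (N : nat) (E : 'I_N -> 'I_N -> nat -> A).

Definition mono (p : nat) : series A := fun r => (r == p)%:R.

(** The empty path, present in [rsum] and absent from [theta], contributes only in degree zero. *)
Lemma theta_rsum m g r : (0 < m)%N ->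
  dact (theta E m) g r = \sum_i rsum E i g m i r.
Proof.
move=> m0; rewrite dact_theta.
under [RHS]eq_bigr => i _ do rewrite /rsum big_ord_recl psum0 subn0 (gtn_eqF m0) andbF add0r.
rewrite exchange_big; apply: eq_bigr => s _; rewrite exchange_big; apply: eq_bigr => K _ /=.
rewrite (eq_bigr (fun i => (pact E i (codom K) g r *~ ptc i (codom K) (m - s.+1)%N) *+ (K ord0 == i))).
  by rewrite sum_delta.
by move=> i _; rewrite codomS.
Qed.

Lemma theta_thpap P m (q p : 'I_P) : (0 < m)%N ->
  dact (theta E m) (mono p) q = thpap P E m q p.
Proof.
move=> m0; rewrite theta_rsum // /thpap summxE; apply: eq_bigr => i _.
rewrite rsum_entry (eq_bigr (fun p' : 'I_P => (xmx (lpap P E) (spap i) ^+ m) i i q p' *+ (p == p'))) ?sum_delta //.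
by move=> p' _; rewrite /mono val_eqE eq_sym mulr_natr.
Qed.

Lemma iter_sder_mono k p n : iter k sder (mono p) n = (n + k == p)%N%:R *+ (p ^_ k).
Proof.
elim: k n => [|k IH] n; first by rewrite addn0.
rewrite iterS /sder IH addSnnS -mulrnA ffactnSr; case: eqP => [<-|_]; last by rewrite !mul0rn.
by congr (_ *+ (_ * _)); lia.
Qed.

Lemma dact_mono (D : dop A) p r : dact D (mono p) r =
  \sum_(k < size D) (if (k <= p <= r + k)%N then dcoef D k (r + k - p)%N *+ (p ^_ k) else 0).
Proof.
apply: eq_bigr => k _; rewrite /smul.
under eq_bigr => j _ do rewrite iter_sder_mono mulrnAr mulr_natr.
rewrite sumrMnl; case: ifP => [/andP[h1 h2]|h]; last first.
  rewrite big1 ?mul0rn // => j _; case: eqP => [e|//].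
  by have := ltn_ord j; move: h e; clear; lia.
have hj : (r + k - p < r.+1)%N by move: h1; clear; lia.
congr (_ *+ _); rewrite (bigD1 (Ordinal hj)) //= big1 ?addr0.
  have -> : (r - (r + k - p) + k)%N = p by move: h1 h2; clear; lia.
  by rewrite eqxx.
move=> j; rewrite -val_eqE /= => jn; case: eqP => [e|//].
by case/eqP: jn; have := ltn_ord j; move: e h1 h2; clear; lia.
Qed.

(** Acting on u^k, derivatives of order above k give zero and the k-th one gives k!, so the k-th
    coefficient is determined, after division by k!, by the earlier ones. *)
Lemma comm_dcoef (y : A) (D : dop A) : (forall (x : A) n, x *+ n.+1 = 0 -> x = 0) ->
  (forall p r, y * dact D (mono p) r = dact D (mono p) r * y) ->
  forall k n, y * dcoef D k n = dcoef D k n * y.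
Proof.
move=> tf h; elim/ltn_ind => k IH n.
case: (ltnP k (size D)) => kD; last by rewrite /dcoef nth_default // mulr0 mul0r.
have := h k n; rewrite dact_mono (bigD1 (Ordinal kD)) //= leqnn leq_addl addnK ffactnn.
set S := bigop _ _ _.
have hS : y * S = S * y.
  rewrite mulr_sumr mulr_suml; apply: eq_bigr => j; rewrite -val_eqE /= => jk.
  case: ifP => [/andP[jk' _]|_]; last by rewrite mulr0 mul0r.
  by rewrite mulrnAr IH ?mulrnAl // ltn_neqAle jk.
rewrite mulrDr mulrDl hS => /addIr; rewrite mulrnAr mulrnAl => /eqP.
rewrite -subr_eq0 -mulrnBl => /eqP; have := fact_gt0 k; case: (k`!)%N => // f _ /tf /eqP.
by rewrite subr_eq0 => /eqP.
Qed.

End Monomials.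

Theorem theorem2p1 (F : fieldType) (hF : [pchar F] =i pred0)
  (A : lalgType F) (N : nat) (E : 'I_N -> 'I_N -> nat -> A) (hE : lie_rep E)
  (m1 k1 n1 m2 k2 n2 : nat) :
  (1 <= m1)%N -> (k1 <= m1)%N -> (1 <= m2)%N -> (k2 <= m2)%N ->
  theta_coef E m1 k1 n1 * theta_coef E m2 k2 n2
    = theta_coef E m2 k2 n2 * theta_coef E m1 k1 n1.
Proof.
move=> m1_gt0 _ m2_gt0 _.
have nz n : n.+1%:R != 0 :> F.
  by rewrite pcharf0P in hF; rewrite hF.
have tf (x : A) n : x *+ n.+1 = 0 -> x = 0.
  move=> h; rewrite -[x]scale1r -(mulVf (nz n)) -scalerA.
  by rewrite scaler_nat h scaler0.
pose c (a : 'I_N) : A := - ((2%:R : F)^-1 *: E a a 0%N) - a%:R.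
have cE a : c a *+ 2 = - E a a 0%N - (2 * a)%N%:R.
  rewrite /c mulrnBl mulNrn -scaler_nat scalerA divff ?scale1r ?nz //.
  by rewrite -mulrnA mulnC.
have comm p r p' r' : dact (theta E m1) (mono A p) r * dact (theta E m2) (mono A p') r' =
   dact (theta E m2) (mono A p') r' * dact (theta E m1) (mono A p) r.
  (* The truncated operators reproduce the action exactly below the truncation order, so any order
     above the four exponents serves. *)
  pose P := (p + r + p' + r').+1.
  have [hp hr hp' hr'] : [/\ p < P, r < P, p' < P & r' < P]%N by split; rewrite /P; clear; lia.
  have e1 := @theta_thpap A N E P m1 (Ordinal hr) (Ordinal hp) m1_gt0.
  have e2 := @theta_thpap A N E P m2 (Ordinal hr') (Ordinal hp') m2_gt0.
  by rewrite /= in e1 e2; rewrite e1 e2; apply: (thpap_comm (c := c)) => // x; apply: tf.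
rewrite /theta_coef; apply: comm_dcoef => // p r; symmetry.
by apply: comm_dcoef => // p' r'; rewrite comm.
Qed.
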